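(* Let $(M,g)$ be a Riemann-Lorentz space with polar end $D^{\infty}$. For every $p\in D^\infty$ there exists a $C^\infty$ pregeodesic through $p$ crossing $D^\infty$ transversely, i.e. a smooth immersed curve $\gamma:(-\varepsilon,\varepsilon)\to M$ with $\gamma(0)=p$, $\gamma'(0)\notin T_pD^\infty$, $\gamma(t)\in M-D^\infty$ for $t\ne0$, and such that $\gamma|_{(-\varepsilon,0)}$ and $\gamma|_{(0,\varepsilon)}$ are, up to reparametrization, geodesics of $g$. This pregeodesic is unique near $p$ up to reparametrization, and it crosses $D^\infty$ in the polar-normal direction, i.e. $\gamma'(0)$ is proportional to $N(p)$ for any polar-normal vector field $N$ defined near $p$.
   Context: Riemann-Lorentz space with polar end: $M$ is a smooth manifold of dimension $m\ge 2$, $D^\infty\subset M$ is a nonempty closed subset, and $g$ is a smooth nondegenerate symmetric $(0,2)$-tensor field on $M-D^\infty$. The dual metric $g^*$ on $T^*(M-D^\infty)$ is $g^*(\alpha,\beta)=g(X_\alpha,X_\beta)$, where $g(X_\alpha,\cdot)=\alpha$. It is required that: (D1) $g^*$ extends smoothly to all of $M$ (extension still denoted $g^*$), and for every coframe $(\theta^1,\dots,\theta^m)$ on an open set $U$ meeting $D^\infty$ one has $U\cap D^\infty=\{x\in U:\det(g^*(\theta^a,\theta^b))|_x=0\}$ and $d_x\det(g^*(\theta^a,\theta^b))\neq0$ for all $x\in U\cap D^\infty$ (so $D^\infty$ is a hypersurface and the radical $\mathrm{Rad}_p(g^* )\subset T_p^*M$ is one-dimensional for $p\in D^\infty$); (D2)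 for every $p\in D^\infty$ the annihilator $\{X\in T_pM:\mu(X)=0\ \forall\mu\in \mathrm{Rad}_p(g^* )\}$ equals $T_pD^\infty$; (RL) every connected component of $M-D^\infty$ is either Riemannian or Lorentzian (one minus sign) for $g$. Polar-normal vector fields: a vector field $Z$ is transversal to $D^\infty$ if $Z(x)\notin T_xD^\infty$ for $x\in D^\infty$. Let $\square_AB(C)=g(\nabla_AB,C)$ on $M-D^\infty$, with $\nabla$ the Levi-Civita connection. For $Z$ transversal and $V\in\mathfrak{X}(D^\infty)$, choose (locally) a vector field $X$ on $M$ with $X|_{D^\infty}=V$ and $g(X,Z)=0$ on $M-D^\infty$; then $(\square_ZZ)(X)/g(Z,Z)$ extends smoothly across $D^\infty$, its restriction to $D^\infty$ does not depend on $X$, and is denoted $\beta_Z(V)$. $Z$ is polar-normal if it is transversal to $D^\infty$ and $\beta_Z=0$. Near each polar point polar-normal vector fields exist, and any two are proportional along $D^\infty$. *)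

(* Defs.v *)
From HB Require Import structures.
From mathcomp Require Import all_boot all_order all_algebra.
From mathcomp Require Import all_classical all_reals all_analysis.
Set Implicit Arguments.
Unset Strict Implicit.
Unset Printing Implicit Defensive.
Import Order.TTheory GRing.Theory Num.Theory.
Import numFieldNormedType.Exports.
Local Open Scope classical_set_scope.
Local Open Scope ring_scope.

(* MathComp-Analysis, over an arbitrary [R : realType]. *)

(* [A] is always an open set in what follows, so the derivatives at points of
   [A] do not depend on the values of [f] outside [A]. *)
Fixpoint Cn {R : realType} {V W : normedModType R}
    (n : nat) (A : set V) (f : V -> W) : Prop :=
  (forall x, A x -> {for x, continuous f}) /\
  (if n is k.+1 then
     forall v, (forall x, A x -> derivable f x v) /\ Cn k A ('D_v f)
   else True).

Definition smooth_on {R : realType} {V W : normedModType R}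
  (A : set V) (f : V -> W) : Prop := forall n, Cn n A f.

(** ** Smooth manifolds *)

Record chart (R : realType) (m : nat) (M : topologicalType) := Chart {
  cdom : set M;
  cmap :> M -> 'rV[R]_m;
  cinv : 'rV[R]_m -> M;
  cdom_open : open cdom;
  cimg_open : open (cmap @` cdom);
  cmapK : forall x, cdom x -> cinv (cmap x) = x;
  cmap_cont : forall x, cdom x -> {for x, continuous cmap};
  cinv_cont : forall y, (cmap @` cdom) y -> {for y, continuous cinv} }.

(* [chart_at x] is a distinguished chart of the atlas around [x]; it serves only
   to identify [T_x M] with the model space, see [coord_jac]. *)
Record smoothManifold (R : realType) (m : nat) := SmoothManifold {
  carrier :> topologicalType;
  carrier_hausdorff : hausdorff_space carrier;
  carrier_countable : @second_countable carrier;
  atlas : set (chart R m carrier);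
  chart_at : carrier -> chart R m carrier;
  chart_at_atlas : forall x, atlas (chart_at x);
  chart_at_dom : forall x, cdom (chart_at x) x;
  atlas_compat : forall c c', atlas c -> atlas c' ->
    smooth_on (c @` (cdom c `&` cdom c')) (c' \o cinv c) }.

Definition smooth_fun {R : realType} {m : nat} {M : smoothManifold R m}
    (W : set M) (f : M -> R) : Prop :=
  forall c, atlas c -> smooth_on (c @` (W `&` cdom c)) (f \o cinv c).

(** ** Tangent vectors and tensor fields

   [T_x M] is represented by the row vectors of coordinates, and [T*_x M] by the
   column vectors of coordinates, with respect to the chart [chart_at x].  A
   covector [a] thus acts on a vector [v] as [v *m a], a [(0,2)]-tensor at [x]
   is its Gram matrix on the coordinate basis of [chart_at x], and a
   [(2,0)]-tensor is its Gram matrix on the dual basis.  Smoothness of a field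
   refers to its components in the charts of the atlas, obtained with the
   Jacobian matrices (acting on row vectors) of the changes of charts. *)

Definition coord_jac {R : realType} {m : nat} {M : smoothManifold R m}
    (c c' : chart R m M) (x : M) : 'M[R]_m := jacobian (c' \o cinv c) (c x).

Definition vec_coord {R : realType} {m : nat} {M : smoothManifold R m}
    (c : chart R m M) (X : M -> 'rV[R]_m) (y : 'rV[R]_m) : 'rV[R]_m :=
  let x := cinv c y in X x *m coord_jac (chart_at x) c x.

Definition covec_coord {R : realType} {m : nat} {M : smoothManifold R m}
    (c : chart R m M) (a : M -> 'cV[R]_m) (y : 'rV[R]_m) : 'cV[R]_m :=
  let x := cinv c y in coord_jac c (chart_at x) x *m a x.

Definition tens02_coord {R : realType} {m : nat} {M : smoothManifold R m}
    (c : chart R m M) (g : M -> 'M[R]_m) (y : 'rV[R]_m) : 'M[R]_m :=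
  let x := cinv c y in let P := coord_jac c (chart_at x) x in
  P *m g x *m P^T.

Definition tens20_coord {R : realType} {m : nat} {M : smoothManifold R m}
    (c : chart R m M) (h : M -> 'M[R]_m) (y : 'rV[R]_m) : 'M[R]_m :=
  let x := cinv c y in let P := coord_jac (chart_at x) c x in
  P^T *m h x *m P.

Definition smooth_vec {R : realType} {m : nat} {M : smoothManifold R m}
    (W : set M) (X : M -> 'rV[R]_m) : Prop :=
  forall c, atlas c -> smooth_on (c @` (W `&` cdom c)) (vec_coord c X).

Definition smooth_covec {R : realType} {m : nat} {M : smoothManifold R m}
    (W : set M) (a : M -> 'cV[R]_m) : Prop :=
  forall c, atlas c -> smooth_on (c @` (W `&` cdom c)) (covec_coord c a).

Definition smooth_tens02 {R : realType} {m : nat} {M : smoothManifold R m}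
    (W : set M) (g : M -> 'M[R]_m) : Prop :=
  forall c, atlas c -> smooth_on (c @` (W `&` cdom c)) (tens02_coord c g).

Definition smooth_tens20 {R : realType} {m : nat} {M : smoothManifold R m}
    (W : set M) (h : M -> 'M[R]_m) : Prop :=
  forall c, atlas c -> smooth_on (c @` (W `&` cdom c)) (tens20_coord c h).

Definition covec_app {R : realType} {m : nat} (a : 'cV[R]_m) (v : 'rV[R]_m) : R :=
  (v *m a) 0 0.

Definition ev02 {R : realType} {m : nat}
  (G : 'M[R]_m) (v w : 'rV[R]_m) : R := (v *m G *m w^T) 0 0.

Definition ev20 {R : realType} {m : nat}
  (H : 'M[R]_m) (a b : 'cV[R]_m) : R := (a^T *m H *m b) 0 0.

Definition coframe {R : realType} {m : nat} {M : smoothManifold R m}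
    (U : set M) (theta : 'I_m -> M -> 'cV[R]_m) : Prop :=
  (forall a, smooth_covec U (theta a)) /\
  (forall x, U x -> \matrix_(i, a) theta a x i 0 \in unitmx).

Definition diff_fun {R : realType} {m : nat} {M : smoothManifold R m}
    (f : M -> R) (x : M) (v : 'rV[R]_m) : R :=
  'D_v (f \o cinv (chart_at x)) (chart_at x x).

(** ** Curves *)

Definition smooth_curve {R : realType} {m : nat} {M : smoothManifold R m}
    (I : set R) (gamma : R -> M) : Prop :=
  (forall t, I t -> {for t, continuous gamma}) /\
  (forall c, atlas c -> smooth_on (I `&` gamma @^-1` cdom c) (c \o gamma)).

Definition velocity {R : realType} {m : nat} {M : smoothManifold R m}
    (gamma : R -> M) (t : R) : 'rV[R]_m :=
  derive1 (chart_at (gamma t) \o gamma) t.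

(* [T_x D] for a hypersurface [D]: velocities of the curves lying in [D]. *)
Definition tangent {R : realType} {m : nat} {M : smoothManifold R m}
    (D : set M) (x : M) (v : 'rV[R]_m) : Prop :=
  exists (e : R) (sigma : R -> M),
    [/\ 0 < e, smooth_curve `]-e, e[ sigma,
        forall t, t \in `]-e, e[ -> D (sigma t), sigma 0 = x &
        velocity sigma 0 = v].

(* The domains of definition [I] and [J] are open intervals; if [I] is one and
   [s] is smooth on [I] with [s' <> 0], then [s @` I] is one as well and [s] is
   a diffeomorphism onto it. *)
Definition reparam {R : realType} {m : nat} {M : smoothManifold R m}
    (I : set R) (gamma : R -> M) (J : set R) (sigma : R -> M) : Prop :=
  exists s : R -> R,
    [/\ smooth_on I s, forall t, I t -> derive1 s t != 0, s @` I = J &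
        forall t, I t -> gamma t = sigma (s t)].

(** ** The Levi-Civita connection *)

(* Christoffel symbols of the metric with component matrix [G] in a chart, as
   a bilinear map: the [k]-th component of [christoffel G y v w] is
   [\sum_(i, j) Gamma^k_ij v_i w_j], where
   [Gamma^k_ij = 1/2 \sum_l G^kl (d_i G_jl + d_j G_il - d_l G_ij)]. *)
Definition christoffel {R : realType} {m : nat} (G : 'rV[R]_m -> 'M[R]_m)
    (y v w : 'rV[R]_m) : 'rV[R]_m :=
  2^-1 *: (w *m 'D_v G y + v *m 'D_w G y
           - \row_l ev02 ('D_(delta_mx 0 l) G y) v w) *m invmx (G y).

Definition nabla {R : realType} {m : nat} {M : smoothManifold R m}
    (g : M -> 'M[R]_m) (A B : M -> 'rV[R]_m) (x : M) : 'rV[R]_m :=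
  let c := chart_at x in
  'D_(A x) (vec_coord c B) (c x)
  + christoffel (tens02_coord c g) (c x) (A x) (B x).

Definition box {R : realType} {m : nat} {M : smoothManifold R m}
    (g : M -> 'M[R]_m) (A B C : M -> 'rV[R]_m) (x : M) : R :=
  ev02 (g x) (nabla g A B x) (C x).

(* The covariant derivative of the velocity of a curve along the curve. *)
Definition acceleration {R : realType} {m : nat} {M : smoothManifold R m}
    (g : M -> 'M[R]_m) (gamma : R -> M) (t : R) : 'rV[R]_m :=
  let c := chart_at (gamma t) in
  derive1 (derive1 (c \o gamma)) t
  + christoffel (tens02_coord c g) (c (gamma t))
      (velocity gamma t) (velocity gamma t).

(** ** Riemann-Lorentz spaces with polar end *)

Definition riemannian_at {R : realType} {m : nat} (G : 'M[R]_m) : Prop :=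
  forall v, v != 0 -> 0 < ev02 G v v.

Definition lorentzian_at {R : realType} {m : nat} (G : 'M[R]_m) : Prop :=
  exists2 P : 'M[R]_m, P \in unitmx &
    P *m G *m P^T = diag_mx (\row_(i < m) (if i == 0%N :> nat then -1 else 1)).

Definition radical {R : realType} {m : nat} (H : 'M[R]_m) (mu : 'cV[R]_m) :=
  forall a, ev20 H mu a = 0.

(* [metric] is meaningful on [~` polar] only; [dual_metric] is the extension to
   all of [M] of the dual metric. *)
Record riemannLorentz (R : realType) (m : nat) := RiemannLorentz {
  underlying :> smoothManifold R m;
  polar : set underlying;
  metric : underlying -> 'M[R]_m;
  dual_metric : underlying -> 'M[R]_m;
  polar_nonempty : polar !=set0;
  polar_closed : closed polar;
  metric_smooth : smooth_tens02 (~` polar) metric;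
  metric_symmetric : forall x, ~ polar x ->
    forall v w, ev02 (metric x) v w = ev02 (metric x) w v;
  metric_nondegenerate : forall x, ~ polar x ->
    forall v, (forall w, ev02 (metric x) v w = 0) -> v = 0;
  dual_metricE : forall x, ~ polar x -> forall a b v w,
    (forall u, ev02 (metric x) v u = covec_app a u) ->
    (forall u, ev02 (metric x) w u = covec_app b u) ->
    ev20 (dual_metric x) a b = ev02 (metric x) v w;
  dual_metric_smooth : smooth_tens20 setT dual_metric;
  polar_det : forall (U : set underlying) (theta : 'I_m -> underlying -> 'cV[R]_m),
    open U -> U `&` polar !=set0 -> coframe U theta ->
    let f x := \det (\matrix_(a, b)
                 ev20 (dual_metric x) (theta a x) (theta b x)) in
    U `&` polar = [set x | U x /\ f x = 0] /\
    (forall x, (U `&` polar) x -> exists v, diff_fun f x v != 0);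
  polar_tangent : forall p, polar p ->
    [set v | forall mu, radical (dual_metric p) mu -> covec_app mu v = 0]
    = tangent polar p;
  polar_signature : forall x, ~ polar x ->
    let C := connected_component (~` polar) x in
    (forall y, C y -> riemannian_at (metric y)) \/
    (forall y, C y -> lorentzian_at (metric y)) }.

Arguments polar {R m} M : rename.
Arguments metric {R m} M : rename.
Arguments dual_metric {R m} M : rename.

(** ** Polar-normal vector fields *)

Definition transversal {R : realType} {m : nat} {M : riemannLorentz R m}
    (U : set M) (Z : M -> 'rV[R]_m) : Prop :=
  forall x, U x -> polar M x -> ~ tangent (polar M) x (Z x).

(* Smooth vector fields on the hypersurface [polar M], restricted to [U]. *)
Definition polar_vec {R : realType} {m : nat} {M : riemannLorentz R m}
    (U : set M) (V : M -> 'rV[R]_m) : Prop :=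
  forall x, U x -> polar M x ->
    tangent (polar M) x (V x) /\
    (exists (W : set M) (Y : M -> 'rV[R]_m),
      [/\ open W, W x, smooth_vec W Y &
          forall y, (W `&` U) y -> polar M y -> Y y = V y]).

(* [is_beta Z V q b]: the function [beta_Z(V)] takes the value [b] at the polar
   point [q].  In the definition, [X] is an admissible local extension of [V]
   around [q] and [h] is the smooth extension of [box_Z Z (X) / g(Z, Z)]. *)
Definition is_beta {R : realType} {m : nat} {M : riemannLorentz R m}
    (Z V : M -> 'rV[R]_m) (q : M) (b : R) : Prop :=
  exists (W : set M) (X : M -> 'rV[R]_m) (h : M -> R),
    [/\ open W, W q, smooth_vec W X, smooth_fun W h & h q = b] /\
    [/\ forall x, W x -> polar M x -> X x = V x,
        forall x, W x -> ~ polar M x ->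
          ev02 (metric M x) (X x) (Z x) = 0 &
        forall x, W x -> ~ polar M x ->
          h x = box (metric M) Z Z X x / ev02 (metric M x) (Z x) (Z x)].

Definition polar_normal {R : realType} {m : nat} {M : riemannLorentz R m}
    (U : set M) (Z : M -> 'rV[R]_m) : Prop :=
  [/\ smooth_vec U Z, transversal U Z &
      forall V, polar_vec U V ->
        forall q, U q -> polar M q -> is_beta Z V q 0].

(** ** Geodesics *)

Definition geodesic {R : realType} {m : nat} {M : riemannLorentz R m}
    (J : set R) (sigma : R -> M) : Prop :=
  smooth_curve J sigma /\
  (forall t, J t -> ~ polar M (sigma t) /\
                    acceleration (metric M) sigma t = 0).

Definition pregeodesic {R : realType} {m : nat} {M : riemannLorentz R m}
    (I : set R) (gamma : R -> M) : Prop :=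
  exists J sigma, geodesic J sigma /\ reparam I gamma J sigma.

Definition crossing_pregeodesic {R : realType} {m : nat}
    {M : riemannLorentz R m} (p : M) (e : R) (gamma : R -> M) : Prop :=
  [/\ 0 < e, smooth_curve `]-e, e[ gamma &
      forall t, t \in `]-e, e[ -> velocity gamma t != 0] /\
  [/\ gamma 0 = p,
      ~ tangent (polar M) p (velocity gamma 0),
      forall t, t \in `]-e, e[ -> t != 0 -> ~ polar M (gamma t),
      pregeodesic `]-e, 0[ gamma &
      pregeodesic `]0, e[ gamma].

(* Main.v *)
(* In a chart around a polar point let [h] be the dual metric.  Since [det h] is
   regular and its differential spans the radical, one can divide: there are a
   defining function [f] of the polar end and smooth [n], [B] with [df h = f n],
   [df(n) = 1] on the polar end and [B h = f], so that [B / f] is the metric.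

   An unparametrized geodesic solves [y' = X h], [X' = lam X - (1/2) X (dh) X].
   With [X = df / f + w] and [f] as parameter, the Hessian of [f] enters only
   through the derivative of [df] along the curve, and the equations become a
   system [z' = F z - (1/(2t)) Pi (z - z0)] with [F] smooth and [Pi] a coordinate
   projection.  Its bounded solutions are fixed points of an operator built from
   the means [f |-> t^(-3/2) \int_0^t u^(1/2) f], which preserve smoothness: this
   yields existence, uniqueness by a Gronwall estimate, and the velocity [n] at
   the polar end.

   For a polar-normal [N] and an admissible [X] equal to [w h] at [p], multiply
   the equation for [box_N N (X) / g(N, N)] by [f] and differentiate it at [p] in
   the direction [N]: this gives [N (D_N B) X = df(N) Hess f (N, X)], whereas
   [n B = df] gives [n (D_N B) X = Hess f (N, X)].  Hence [T = N - df(N) n]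
   satisfies [0 = T (D_N B) (w h) = df(N) (T . w)] because [B h = f], for every
   [w]; so [N] is proportional to [n]. *)

From HB Require Import structures.
Require Import Defs.
From mathcomp Require Import all_boot all_order all_algebra.
From mathcomp Require Import all_classical all_reals all_analysis.
From mathcomp Require Import ring lra.
Set Implicit Arguments.
Unset Strict Implicit.
Unset Printing Implicit Defensive.
Import Order.TTheory GRing.Theory Num.Theory.
Import numFieldNormedType.Exports.
Local Open Scope classical_set_scope.
Local Open Scope ring_scope.

(** * Calculus of maps of class C^n *)

(** The obstacle is that [B / f] and its Christoffel symbols have poles on the polar end, while the
    dual metric is smooth. Curves are therefore described by position and covector, where the only
    singularity left is the term [df / f] of the covector. Its double pole cancels, and a pole
    [1/(2t)] remains on the regular part [w]. The homogeneous solution of that part is [t^(-1/2)],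
    unbounded at 0: boundedness leaves no free initial datum, so the point [p] alone determines the
    curve and its direction.

    Existence and uniqueness use different gauges. For existence [w] is unconstrained and [lam] is
    chosen to make the system regular. For uniqueness the curve is given, [f] is the parameter, and
    the constraint [df(Y') = 1] determines [lam].

    Two features of the definitions shape the calculus. [Cn] speaks of iterated derivatives in fixed
    directions, so Frechet differentiability has to be recovered before maps can be composed. And
    identities involving the metric hold only off the polar end; they are extended by continuity,
    because the zeros of a function with non-zero differential have empty interior. *)

Section DerivativeAlong.
Context {R : realType}.

Lemma derive_line0 (V W : normedModType R) (f : V -> W) (x v : V) :
  'D_v f x = 'D_1 (fun h : R => f (h *: v + x)) 0.
Proof.
rewrite /derive; set g1 := (fun h => h^-1 *: _); set g2 := (fun h => h^-1 *: _).
suff -> : g1 = g2 by [].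
by rewrite funeqE /g1 /g2 => h /=; rewrite addr0 scale0r add0r [_%:A]mulr1.
Qed.

(** [g] is only derivable in the direction [v], so the chain rule for differentials is applied to
    its restriction to a line, where derivability and differentiability agree. *)
Lemma is_derive_chain (V U W : normedModType R) (g : V -> U) (f : U -> W)
    (x v : V) (dg : U) :
  is_derive x v g dg -> differentiable f (g x) ->
  is_derive x v (f \o g) ('d f (g x) dg).
Proof.
move=> [dgx dgE] dfx.
have dl : differentiable (fun h : R => g (h *: v + x)) 0.
  by apply/derivable1_diffP; exact: (proj1 (derivable1P g x v) dgx).
have dfx' : differentiable f ((fun h : R => g (h *: v + x)) 0).
  by rewrite scale0r add0r.
have dc := differentiable_comp dl dfx'.
apply: DeriveDef.
  by apply: (proj2 (derivable1P _ x v)); apply/derivable1_diffP.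
rewrite derive_line0 deriveE // (diff_comp dl dfx') /= scale0r add0r -dgE.
by congr ('d f _ _); rewrite derive_line0 deriveE.
Qed.

Lemma is_derive_chain1 (V W : normedModType R) (g : V -> R) (f : R -> W)
    (x v : V) (dg : R) (df : W) :
  is_derive x v g dg -> is_derive (g x) 1 f df ->
  is_derive x v (f \o g) (dg *: df).
Proof.
move=> gx [fx <-]; have dfx : differentiable f (g x) by apply/derivable1_diffP.
by have := is_derive_chain gx dfx; rewrite deriv1E // derive1E.
Qed.

Lemma is_derive_line (V W : normedModType R) (f : V -> W) (x v : V) (t : R) :
  derivable f (x + t *: v) v ->
  is_derive t 1 (fun s : R => f (x + s *: v)) ('D_v f (x + t *: v)).
Proof.
move=> df.
have E : (fun h : R => h^-1 *: (((fun s : R => f (x + s *: v)) \o shift t) (h *: 1)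
            - f (x + t *: v)))
       = (fun h : R => h^-1 *: ((f \o shift (x + t *: v)) (h *: v)
            - f (x + t *: v))).
  apply/funext => h /=; congr (_ *: (f _ - _)).
  by rewrite [_ *: 1]mulr1 scalerDl addrCA.
apply: DeriveDef; first by rewrite /derivable E.
by rewrite /derive E.
Qed.

Lemma is_derive_scale_dir (V W : normedModType R) (f : V -> W) (x v : V) (c : R) :
  derivable f x v -> is_derive x (c *: v) f (c *: 'D_v f x).
Proof.
have E (u : V) (F : V -> W) : (fun s : R => F (x + s *: u)) 0 = F x.
  by rewrite scale0r addr0.
move=> df; have df0 : derivable f (x + 0 *: v) v by rewrite scale0r addr0.
have d1 := is_derive_line df0.
have d2 : is_derive (0 : R) 1 (fun s : R => s * c) c.
  have := @is_deriveM R R id (cst c) 0 1 1 0 _ _.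
  rewrite /cst /= /GRing.scale /= mulr0 add0r mulr1; exact.
have d1' : is_derive ((fun s : R => s * c) 0) 1 (fun s : R => f (x + s *: v))
    ('D_v f x).
  by rewrite mul0r -[in X in is_derive _ _ _ X](addr0 x) -[in X in is_derive _ _ _ X](scale0r v).
have [d3 d3E] := is_derive_chain1 d2 d1'.
have -> : f = (fun y => f y) by [].
have F : (fun h : R => f (h *: (c *: v) + x)) =
    (fun s : R => f (x + s *: v)) \o (fun s : R => s * c).
  by apply/funext => h /=; rewrite scalerA addrC.
apply: DeriveDef; first by apply: (proj2 (derivable1P _ x _)); rewrite F.
by rewrite -d3E -F derive_line0.
Qed.

Lemma MVT_line (V : normedModType R) (f : V -> R) (x v : V) :
  (forall t, t \in `[0, 1] -> derivable f (x + t *: v) v) ->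
  exists2 t, t \in `]0, 1[ & f (x + v) - f x = 'D_v f (x + t *: v).
Proof.
move=> df.
have [||t t01] := @MVT R (fun s : R => f (x + s *: v))
  (fun s : R => 'D_v f (x + s *: v)) 0 1 ltr01.
- by move=> s /subset_itv_oo_cc s01; apply: is_derive_line; apply: df.
- apply: derivable_within_continuous => s s01.
  by have [] := is_derive_line (df _ s01).
by rewrite scale1r scale0r addr0 subr0 mulr1 => E; exists t.
Qed.

End DerivativeAlong.

Lemma near_eq_continuous (T U : topologicalType) (f g : T -> U) x :
  (\near x, f x = g x) -> {for x, continuous f} -> {for x, continuous g}.
Proof.
move=> fg fc; have gf : g x = f x by rewrite (nbhs_singleton fg).
rewrite /prop_for /continuous_at gf; apply: cvg_trans fc.
by apply: near_eq_cvg; apply: filterS fg => y ->.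
Qed.

Section CnBasics.
Context {R : realType} {V : normedModType R}.

Lemma Cn_cont (W : normedModType R) n (A : set V) (f : V -> W) x :
  Cn n A f -> A x -> {for x, continuous f}.
Proof. by case: n => [|n] [fc _]; exact: fc. Qed.

Lemma Cn_derivable (W : normedModType R) n (A : set V) (f : V -> W) x v :
  Cn n.+1 A f -> A x -> derivable f x v.
Proof. by move=> [_ fd] Ax; exact: (fd v).1. Qed.
Arguments Cn_derivable {W n A f x} v _ _.

Lemma Cn_is_derive (W : normedModType R) n (A : set V) (f : V -> W) x v :
  Cn n.+1 A f -> A x -> is_derive x v f ('D_v f x).
Proof. by move=> fC Ax; apply/derivableP; exact: Cn_derivable fC Ax. Qed.
Arguments Cn_is_derive {W n A f x} v _ _.

Lemma Cn_derive (W : normedModType R) n (A : set V) (f : V -> W) v :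
  Cn n.+1 A f -> Cn n A ('D_v f).
Proof. by move=> [_ fd]; exact: (fd v).2. Qed.
Arguments Cn_derive {W n A f} v _.

Lemma CnW (W : normedModType R) n (A : set V) (f : V -> W) : Cn n.+1 A f -> Cn n A f.
Proof.
elim: n f => [|n IH] f [fc fd]; first by split.
by split=> // v; split; [exact: (fd v).1|apply: IH; exact: (fd v).2].
Qed.

Lemma Cn_leq (W : normedModType R) n k (A : set V) (f : V -> W) :
  (k <= n)%N -> Cn n A f -> Cn k A f.
Proof.
move=> /subnK <-; elim: (n - k)%N => // j IH; rewrite addSn => /CnW; exact: IH.
Qed.

Lemma Cn_sub (W : normedModType R) n (A B : set V) (f : V -> W) :
  A `<=` B -> Cn n B f -> Cn n A f.
Proof.
move=> AB; elim: n f => [|n IH] f [fc fd]; split=> //.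
- by move=> x /AB; exact: fc.
- by move=> x /AB; exact: fc.
by move=> v; split; [move=> x /AB; exact: (fd v).1|apply: IH; exact: (fd v).2].
Qed.

(** Openness of [A] turns equality on [A] into equality of germs, which all iterated derivatives
    respect. *)
Lemma Cn_eq (W : normedModType R) n (A : set V) (f g : V -> W) : open A ->
  (forall x, A x -> f x = g x) -> Cn n A f -> Cn n A g.
Proof.
move=> oA; elim: n f g => [|n IH] f g fg [fc fd].
  split=> // x Ax; apply: near_eq_continuous (fc _ Ax).
  by near=> y; apply: fg; near: y; exact: open_nbhs_nbhs.
have nfg x : A x -> \near x, f x = g x.
  by move=> Ax; near=> y; apply: fg; near: y; exact: open_nbhs_nbhs.
split=> [x Ax|v].
  by apply: near_eq_continuous (fc _ Ax); exact: nfg.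
split=> [x Ax|]; first by apply: near_eq_derivable ((fd v).1 _ Ax); exact: nfg.
apply: IH (fd v).2 => x Ax; apply: near_eq_derive; exact: nfg.
Unshelve. all: by end_near. Qed.

Lemma Cn_cst (W : normedModType R) n (A : set V) (c : W) : Cn n A (fun _ : V => c).
Proof.
elim: n c => [|n IH] c; split=> //; try by move=> x _; exact: cvg_cst.
move=> v; split=> [x _|]; first exact: derivable_cst.
suff -> : 'D_v (fun _ : V => c) = (fun _ => 0) by exact: IH.
by apply/funext => x; rewrite derive_cst.
Qed.

Lemma CnD (W : normedModType R) n (A : set V) (f g : V -> W) : open A ->
  Cn n A f -> Cn n A g -> Cn n A (fun x => f x + g x).
Proof.
move=> oA; elim: n f g => [|n IH] f g fC gC.
  split=> // x Ax; apply: continuousD; [exact: (Cn_cont fC)|exact: (Cn_cont gC)].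
split=> [x Ax|v].
  apply: continuousD; [exact: (Cn_cont fC)|exact: (Cn_cont gC)].
split=> [x Ax|].
  exact: (derivableD (Cn_derivable v fC Ax) (Cn_derivable v gC Ax)).
apply: (Cn_eq oA); last exact: IH (Cn_derive v fC) (Cn_derive v gC).
move=> x Ax /=; rewrite deriveD//.
- exact: (Cn_derivable v fC Ax).
- exact: (Cn_derivable v gC Ax).
Qed.

Lemma CnM n (A : set V) (f g : V -> R) : open A ->
  Cn n A f -> Cn n A g -> Cn n A (fun x => f x * g x).
Proof.
move=> oA; elim: n f g => [|n IH] f g fC gC.
  split=> // x Ax; apply: continuousM; [exact: (Cn_cont fC)|exact: (Cn_cont gC)].
split=> [x Ax|v].
  apply: continuousM; [exact: (Cn_cont fC)|exact: (Cn_cont gC)].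
split=> [x Ax|].
  exact: (derivableM (Cn_derivable v fC Ax) (Cn_derivable v gC Ax)).
apply: (Cn_eq oA); last first.
  apply: (CnD oA (IH _ _ (CnW fC) (Cn_derive v gC)) (IH _ _ (CnW gC) (Cn_derive v fC))).
move=> x Ax /=; rewrite deriveM//.
- exact: (Cn_derivable v fC Ax).
- exact: (Cn_derivable v gC Ax).
Qed.

Lemma CnN n (A : set V) (f : V -> R) : open A -> Cn n A f -> Cn n A (fun x => - f x).
Proof.
move=> oA fC; apply: (Cn_eq oA); last exact: (CnM oA (Cn_cst n A (-1 : R)) fC).
by move=> x _ /=; rewrite mulN1r.
Qed.

Lemma CnB n (A : set V) (f g : V -> R) : open A ->
  Cn n A f -> Cn n A g -> Cn n A (fun x => f x - g x).
Proof. by move=> oA fC gC; exact: (CnD oA fC (CnN oA gC)). Qed.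

Lemma CnV n (A : set V) (f : V -> R) : open A -> (forall x, A x -> f x != 0) ->
  Cn n A f -> Cn n A (fun x => (f x)^-1).
Proof.
move=> oA f0; elim: n => [|n IH] fC.
  by split=> // x Ax; apply: continuousV; [exact: f0|exact: (Cn_cont fC)].
split=> [x Ax|v].
  by apply: continuousV; [exact: f0|exact: (Cn_cont fC)].
split=> [x Ax|].
  by apply: derivableV; [exact: f0|exact: (Cn_derivable v fC Ax)].
have IV := IH (CnW fC).
apply: (Cn_eq oA); last exact: (CnM oA (CnN oA (CnM oA IV IV)) (Cn_derive v fC)).
move=> x Ax /=; rewrite deriveV//; last exact: (Cn_derivable v fC Ax); last exact: f0.
by rewrite /GRing.scale /= expr2 invfM.
Qed.

Lemma Cn_expR n (A : set V) (f : V -> R) : open A ->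
  Cn n A f -> Cn n A (fun x => expR (f x)).
Proof.
move=> oA; elim: n => [|n IH] fC.
  by split=> // x Ax; apply: continuous_comp; [exact: (Cn_cont fC)|exact: continuous_expR].
have dE x v : A x -> is_derive x v (expR \o f) ('D_v f x *: expR (f x)).
  by move=> Ax; apply: is_derive_chain1; exact: (Cn_is_derive v fC Ax).
split=> [x Ax|v].
  by apply: continuous_comp; [exact: (Cn_cont fC)|exact: continuous_expR].
split=> [x Ax|]; first by have [] := dE x v Ax.
apply: (Cn_eq oA); last exact: (CnM oA (Cn_derive v fC) (IH (CnW fC))).
by move=> x Ax /=; have [_] := dE x v Ax.
Qed.

Lemma Cn_sum (I : Type) (r : seq I) (P : pred I) n (A : set V) (f : I -> V -> R) :
  open A -> (forall i, P i -> Cn n A (f i)) -> Cn n A (fun x => \sum_(i <- r | P i) f i x).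
Proof.
move=> oA fC; elim: r => [|i r IH].
  by apply: (Cn_eq oA); last exact: (Cn_cst n A (0 : R)); move=> x _; rewrite big_nil.
case Pi : (P i).
  apply: (Cn_eq oA); last exact: (CnD oA (fC i Pi) IH).
  by move=> x _; rewrite big_cons Pi.
by apply: (Cn_eq oA); last exact: IH; move=> x _; rewrite big_cons Pi.
Qed.

Lemma Cn_prod (I : Type) (r : seq I) (P : pred I) n (A : set V) (f : I -> V -> R) :
  open A -> (forall i, P i -> Cn n A (f i)) -> Cn n A (fun x => \prod_(i <- r | P i) f i x).
Proof.
move=> oA fC; elim: r => [|i r IH].
  by apply: (Cn_eq oA); last exact: (Cn_cst n A (1 : R)); move=> x _; rewrite big_nil.
case Pi : (P i).
  apply: (Cn_eq oA); last exact: (CnM oA (fC i Pi) IH).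
  by move=> x _; rewrite big_cons Pi.
by apply: (Cn_eq oA); last exact: IH; move=> x _; rewrite big_cons Pi.
Qed.

End CnBasics.
Arguments Cn_derivable {R V W n A f x} v _ _.
Arguments Cn_is_derive {R V W n A f x} v _ _.
Arguments Cn_derive {R V W n A f} v _.

Section CnMatrix.
Context {R : realType} {V : normedModType R}.

Lemma continuous_mxP m n (f : V -> 'M[R]_(m, n)) x :
  {for x, continuous f} <-> forall i j, {for x, continuous (fun y => f y i j)}.
Proof.
split=> [fc i j|fc].
  apply: (@continuous_comp _ _ _ f (fun M : 'M[R]_(m, n) => M i j) x fc).
  exact: coord_continuous.
apply/cvgrPdist_le => /= e e0; near=> y.
rewrite /Num.Def.normr/= mx_normrE (bigmax_le _ (ltW e0))//= => i _.
rewrite !mxE/=; move: i; near: y; apply: filter_forall => /= i.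
by have /cvgrPdist_le := fc i.1 i.2; exact.
Unshelve. all: by end_near. Qed.

Lemma is_derive_mxP m n (f : V -> 'M[R]_(m, n)) x v df :
  is_derive x v f df <-> forall i j, is_derive x v (fun y => f y i j) (df i j).
Proof.
split=> [[fd <-] i j|fd].
  apply: DeriveDef; first by move/derivable_mxP: fd.
  by rewrite derive_mx // mxE.
have dfx : derivable f x v by apply/derivable_mxP => i j; have [] := fd i j.
apply: DeriveDef => //; rewrite derive_mx //; apply/matrixP => i j; rewrite mxE.
by have [_] := fd i j.
Qed.

Lemma derive_mxE m n (f : V -> 'M[R]_(m, n)) x v i j :
  derivable f x v -> 'D_v f x i j = 'D_v (fun y => f y i j) x.
Proof. by move=> fd; rewrite derive_mx // mxE. Qed.

Lemma Cn_mxP m p n (A : set V) (f : V -> 'M[R]_(m, p)) : open A ->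
  Cn n A f <-> forall i j, Cn n A (fun x => f x i j).
Proof.
move=> oA; elim: n f => [|n IH] f; split.
- by move=> [fc _] i j; split=> // x Ax; move/continuous_mxP: (fc x Ax).
- move=> fC; split=> // x Ax; apply/continuous_mxP => i j; exact: (Cn_cont (fC i j)).
- move=> fC i j; split=> [x Ax|v].
    by move/continuous_mxP: (Cn_cont fC Ax).
  split=> [x Ax|]; first by move/derivable_mxP: (Cn_derivable v fC Ax).
  have /IH /(_ i j) := Cn_derive v fC; apply: (Cn_eq oA) => x Ax.
  by rewrite derive_mxE //; exact: (Cn_derivable v fC Ax).
- move=> fC; split=> [x Ax|v].
    by apply/continuous_mxP => i j; exact: (Cn_cont (fC i j)).
  have fd x : A x -> derivable f x v.
    by move=> Ax; apply/derivable_mxP => i j; exact: (Cn_derivable v (fC i j) Ax).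
  split=> //; apply/IH => i j; apply: (Cn_eq oA); last exact: (Cn_derive v (fC i j)).
  by move=> x Ax; rewrite derive_mxE //; exact: fd.
Qed.

Lemma Cn_mulmx m p q n (A : set V) (f : V -> 'M[R]_(m, p)) (g : V -> 'M[R]_(p, q)) :
  open A -> Cn n A f -> Cn n A g -> Cn n A (fun x => f x *m g x).
Proof.
move=> oA /(Cn_mxP n f oA) fC /(Cn_mxP n g oA) gC; apply/(Cn_mxP _ _ oA) => i j.
apply: (Cn_eq oA); last by apply: (Cn_sum (index_enum 'I_p) (P := xpredT) oA
  (f := fun k x => f x i k * g x k j)) => k _; apply: (CnM oA); [exact: fC|exact: gC].
by move=> x _; rewrite mxE.
Qed.

Lemma Cn_tr m p n (A : set V) (f : V -> 'M[R]_(m, p)) :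
  open A -> Cn n A f -> Cn n A (fun x => (f x)^T).
Proof.
move=> oA /(Cn_mxP n f oA) fC; apply/(Cn_mxP _ _ oA) => i j.
by apply: (Cn_eq oA); last exact: (fC j i); move=> x _; rewrite mxE.
Qed.

Lemma Cn_scale m p n (A : set V) (k : V -> R) (f : V -> 'M[R]_(m, p)) :
  open A -> Cn n A k -> Cn n A f -> Cn n A (fun x => k x *: f x).
Proof.
move=> oA kC /(Cn_mxP n f oA) fC; apply/(Cn_mxP _ _ oA) => i j.
by apply: (Cn_eq oA); last exact: (CnM oA kC (fC i j)); move=> x _; rewrite mxE.
Qed.

Lemma Cn_oppmx m p n (A : set V) (f : V -> 'M[R]_(m, p)) :
  open A -> Cn n A f -> Cn n A (fun x => - f x).
Proof.
move=> oA /(Cn_mxP n f oA) fC; apply/(Cn_mxP _ _ oA) => i j.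
by apply: (Cn_eq oA); last exact: (CnN oA (fC i j)); move=> x _; rewrite mxE.
Qed.

Lemma Cn_subm m p n (A : set V) (f g : V -> 'M[R]_(m, p)) :
  open A -> Cn n A f -> Cn n A g -> Cn n A (fun x => f x - g x).
Proof. by move=> oA fC gC; exact: (CnD oA fC (Cn_oppmx oA gC)). Qed.

Lemma Cn_entry m p n (A : set V) (f : V -> 'M[R]_(m, p)) i j :
  open A -> Cn n A f -> Cn n A (fun x => f x i j).
Proof. by move=> oA /(Cn_mxP n f oA). Qed.

Lemma Cn_mx m p n (A : set V) (f : V -> 'I_m -> 'I_p -> R) :
  open A -> (forall i j, Cn n A (fun x => f x i j)) ->
  Cn n A (fun x => \matrix_(i, j) f x i j).
Proof.
move=> oA fC; apply/(Cn_mxP _ _ oA) => i j.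
by apply: (Cn_eq oA); last exact: (fC i j); move=> x _; rewrite mxE.
Qed.

Lemma Cn_det m n (A : set V) (f : V -> 'M[R]_m) :
  open A -> Cn n A f -> Cn n A (fun x => \det (f x)).
Proof.
move=> oA fC; rewrite /determinant.
apply: (Cn_sum _ oA) => s _; apply: (CnM oA); first exact: Cn_cst.
by apply: (Cn_prod _ oA) => i _; exact: Cn_entry.
Qed.

Lemma Cn_adj m n (A : set V) (f : V -> 'M[R]_m) :
  open A -> Cn n A f -> Cn n A (fun x => \adj (f x)).
Proof.
move=> oA fC; apply/(Cn_mxP _ _ oA) => i j.
apply: (Cn_eq oA (f := fun x => cofactor (f x) j i)); first by move=> x _; rewrite mxE.
apply: (CnM oA); first exact: Cn_cst.
apply: (Cn_det oA); apply/(Cn_mxP _ _ oA) => k l.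
apply: (Cn_eq oA); last exact: (Cn_entry (lift j k) (lift i l) oA fC).
by move=> x _; rewrite !mxE.
Qed.

Lemma is_derive_mulmx m p q (f : V -> 'M[R]_(m, p)) (g : V -> 'M[R]_(p, q)) x v df dg :
  is_derive x v f df -> is_derive x v g dg ->
  is_derive x v (fun y => f y *m g y) (df *m g x + f x *m dg).
Proof.
move=> /is_derive_mxP fd /is_derive_mxP gd; apply/is_derive_mxP => i j.
rewrite (_ : (fun y => _) = \sum_(k < p) (fun y => f y i k * g y k j)); last first.
  by apply/funext => y; rewrite mxE fct_sumE.
rewrite !mxE -big_split /=.
apply: (@is_derive_sum _ _ _ _ (fun k y => f y i k * g y k j) x v
  (fun k => df i k * g x k j + f x i k * dg k j)) => k.
have := @is_deriveM _ _ (fun y => f y i k) (fun y => g y k j) x v _ _ (fd i k) (gd k j).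
by move=> h; apply: (is_derive_eq h); rewrite /GRing.scale /=; ring.
Qed.

Lemma is_derive_tr m p (f : V -> 'M[R]_(m, p)) x v df :
  is_derive x v f df -> is_derive x v (fun y => (f y)^T) df^T.
Proof.
move=> /is_derive_mxP fd; apply/is_derive_mxP => i j; rewrite mxE.
by rewrite (_ : (fun y => _) = (fun y => f y j i)) //; apply/funext => y; rewrite mxE.
Qed.

Lemma is_derive_scalemx m p (k : V -> R) (f : V -> 'M[R]_(m, p)) x v dk df :
  is_derive x v k dk -> is_derive x v f df ->
  is_derive x v (fun y => k y *: f y) (dk *: f x + k x *: df).
Proof.
move=> kd /is_derive_mxP fd; apply/is_derive_mxP => i j; rewrite !mxE.
rewrite (_ : (fun y => _) = (fun y => k y * f y i j)); last by apply/funext => y; rewrite mxE.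
have := @is_deriveM _ _ k (fun y => f y i j) x v _ _ kd (fd i j).
by move=> h; apply: (is_derive_eq h); rewrite /GRing.scale /=; ring.
Qed.

End CnMatrix.

Section Differentiable.
Context {R : realType} {m : nat}.
Local Notation E := 'rV[R]_m.
Local Notation e_ i := (delta_mx 0 i : 'rV[R]_m).

Lemma mx_norm_coord n p (M : 'M[R]_(n, p)) i j : `|M i j| <= `|M|.
Proof.
rewrite [leRHS]/Num.Def.normr/= mx_normrE.
exact: (le_bigmax _ (fun ij => `|M ij.1 ij.2|) (i, j)).
Qed.

Lemma mx_norm_le n p (M : 'M[R]_(n, p)) c : 0 <= c ->
  (forall i j, `|M i j| <= c) -> `|M| <= c.
Proof.
move=> c0 Mc; rewrite [leLHS]/Num.Def.normr/= mx_normrE.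
by apply: bigmax_le => // ij _; exact: Mc.
Qed.

Lemma row_dec (v : E) : v = \sum_i v 0 i *: e_ i.
Proof. exact: row_sum_delta. Qed.

Lemma covec_app_is_linear (a : 'cV[R]_m) : linear (covec_app a).
Proof.
by move=> k u v; rewrite /covec_app mulmxDl -scalemxAl !mxE.
Qed.
HB.instance Definition _ (a : 'cV[R]_m) := GRing.isLinear.Build R E R *:%R
  (covec_app a) (covec_app_is_linear a).

Lemma covec_appE (a : 'cV[R]_m) v : covec_app a v = \sum_i v 0 i * a i 0.
Proof. by rewrite /covec_app mxE. Qed.

Lemma covec_app_continuous (a : 'cV[R]_m) : continuous (covec_app a).
Proof.
have -> : covec_app a = \sum_i (fun v : E => v 0 i * a i 0).
  by apply/funext => v; rewrite covec_appE fct_sumE.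
elim/big_ind: _ => [x|g h gc hc x|i _ x]; first exact: (@cst_continuous _ _ (0 : R)).
  exact: (cvgD (gc x) (hc x)).
have h := @coord_continuous R 1 m 0 i x; exact: (cvgMr_tmp (b:=a i 0) h).
Qed.

(** Continuous partial derivatives give a Frechet differential: one moves from [x] to [x + h] by
    changing one coordinate at a time and applies the mean value theorem to each step. *)
Lemma Cn1_diff_aux (A : set E) (f : E -> R) x : open A -> A x -> Cn 1 A f ->
  f \o shift x = cst (f x) + covec_app (\col_i 'D_(e_ i) f x) +o_ (0 : E) id.
Proof.
move=> oA Ax fC; apply/eqaddoP => e e0.
(* There are [m] steps to share [e]; dividing by [m.+1] also covers [m = 0]. *)
have e'0 : 0 < e / m.+1%:R by rewrite divr_gt0.
have [d /= d0 dP] : exists2 d, 0 < d & forall y, `|x - y| < d ->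
    A y /\ forall i, `|'D_(e_ i) f x - 'D_(e_ i) f y| <= e / m.+1%:R.
  have : \forall y \near x, A y /\ forall i, `|'D_(e_ i) f x - 'D_(e_ i) f y| <= e / m.+1%:R.
    near=> y; split; first by near: y; exact: open_nbhs_nbhs.
    near: y; apply: filter_forall => i.
    have /cvgrPdist_le := Cn_cont (Cn_derive (e_ i) fC) Ax; exact.
  by move=> /nbhs_ballP[d /= d0 dP]; exists d => // y xy; apply: dP; rewrite -ball_normE.
near=> h; rewrite !fctE /=.
have hd : `|h| < d.
  by near: h; apply/nbhs_ballP; exists d => //= y; rewrite -ball_normE /= sub0r normrN.
(* [tr k] keeps the first [k] coordinates of [h]; the segment from [tr k] to [tr k.+1] stays in the
   sup-norm ball whose radius is the norm of [h]. *)
pose tr k : E := \row_j (if (j < k)%N then h 0 j else 0).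
have trS (k : 'I_m) t : `|t| <= 1 -> `|tr k + t *: (h 0 k *: e_ k)| <= `|h|.
  move=> t1; apply: mx_norm_le => // i j; rewrite !mxE (ord1 i).
  have [->|jk] := eqVneq j k.
    rewrite ltnn add0r eqxx mulr1 normrM (le_trans _ (mx_norm_coord h 0 k))//.
    by rewrite ler_piMl.
  rewrite andbF !mulr0 addr0; case: ifP => _; first exact: mx_norm_coord.
  by rewrite normr0.
have tr_step (k : 'I_m) : exists2 y, `|x - y| < d &
    f (x + tr k.+1) - f (x + tr k) = h 0 k * 'D_(e_ k) f y.
  have inA t : t \in `[0, 1] -> A (x + tr k + t *: (h 0 k *: e_ k)).
    rewrite in_itv /= => /andP[t0 t1]; apply: (dP _ _).1.
    rewrite -addrA opprD addrA subrr sub0r normrN (le_lt_trans _ hd)//.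
    by apply: trS; rewrite ger0_norm.
  have -> : x + tr k.+1 = x + tr k + h 0 k *: e_ k.
    rewrite -addrA; congr (_ + _); apply/rowP => j; rewrite !mxE eqxx /=.
    by rewrite ltnS leq_eqVlt val_eqE; have [->|jk] := eqVneq j k;
      rewrite ?ltnn ?mulr1 ?add0r ?mulr0 ?addr0.
  have [t t01|t t01 E0] := MVT_line (f := f) (x := x + tr k) (v := h 0 k *: e_ k) _.
    by have [] := is_derive_scale_dir (h 0 k) (Cn_derivable (e_ k) fC (inA t t01)).
  have t01' : t \in `[0, 1] by apply: subset_itv_oo_cc.
  exists (x + tr k + t *: (h 0 k *: e_ k)).
    rewrite -addrA opprD addrA subrr sub0r normrN (le_lt_trans _ hd)//.
    apply: trS; move: t01'; rewrite in_itv /= => /andP[t0 t1].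
    by rewrite ger0_norm.
  by rewrite E0; have [_ ->//] := is_derive_scale_dir (h 0 k)
    (Cn_derivable (e_ k) fC (inA t t01')).
have -> : f (h + x) - (f x + covec_app (\col_i 'D_(e_ i) f x) h) =
  \sum_(k < m) ((f (x + tr k.+1) - f (x + tr k)) - h 0 k * 'D_(e_ k) f x).
  rewrite sumrB opprD addrA; congr (_ - _); last first.
    by rewrite covec_appE; apply: eq_bigr => i _; rewrite mxE.
  rewrite -(big_mkord xpredT (fun k => f (x + tr k.+1) - f (x + tr k))) telescope_sumr//.
  have -> : tr m = h by apply/rowP => j; rewrite !mxE ltn_ord.
  have -> : tr 0%N = 0 by apply/rowP => j; rewrite !mxE.
  by rewrite addr0 [h + x]addrC.
rewrite (le_trans (ler_norm_sum _ _ _))//.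
apply: (@le_trans _ _ (\sum_(k < m) `|h| * (e / m.+1%:R))).
  apply: ler_sum => k _; have [y yd ->] := tr_step k.
  rewrite -mulrBr normrM ler_pM//; first exact: mx_norm_coord.
  by rewrite distrC; exact: (dP _ yd).2.
rewrite sumr_const card_ord -mulrnAr mulrC ler_wpM2r// -mulr_natr -mulrA.
by rewrite ler_piMr ?(ltW e0)// mulrC ler_pdivrMr// mul1r ler_nat.
Unshelve. all: by end_near. Qed.

Lemma Cn1_diffE (A : set E) (f : E -> R) x : open A -> A x -> Cn 1 A f ->
  'd f x = covec_app (\col_i 'D_(e_ i) f x) :> (E -> R).
Proof.
move=> oA Ax fC; apply: diff_unique; last exact: Cn1_diff_aux Ax fC.
exact: covec_app_continuous.
Qed.

Lemma Cn1_differentiable_scalar (A : set E) (f : E -> R) x : open A -> A x ->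
  Cn 1 A f -> differentiable f x.
Proof.
move=> oA Ax fC; apply/diff_locallyP; rewrite (Cn1_diffE oA Ax fC).
by split; [exact: covec_app_continuous|exact: Cn1_diff_aux Ax fC].
Qed.

Lemma Cn1_differentiable n p (A : set E) (f : E -> 'M[R]_(n, p)) x :
  open A -> A x -> Cn 1 A f -> differentiable f x.
Proof.
move=> oA Ax fC.
have -> : f = \sum_(ij : 'I_n * 'I_p) (fun y => f y ij.1 ij.2 *: delta_mx ij.1 ij.2).
  apply/funext => y; rewrite fct_sumE {1}(matrix_sum_delta (f y)).
  by rewrite pair_bigA.
elim/big_ind: _ => [|g h gd hd|ij _]; first exact: differentiable_cst.
  exact: differentiableD.
apply: differentiableZl; apply: (Cn1_differentiable_scalar oA Ax).
exact: Cn_entry.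
Qed.

Lemma derive_dirE n p (A : set E) (f : E -> 'M[R]_(n, p)) x v :
  open A -> A x -> Cn 1 A f -> 'D_v f x = \sum_i v 0 i *: 'D_(e_ i) f x.
Proof.
move=> oA Ax fC; have fd := Cn1_differentiable oA Ax fC.
rewrite deriveE// {1}(row_dec v) linear_sum /=; apply: eq_bigr => i _.
by rewrite linearZ /= deriveE.
Qed.

Lemma derive_dirE_scalar (A : set E) (f : E -> R) x v :
  open A -> A x -> Cn 1 A f -> 'D_v f x = \sum_i v 0 i * 'D_(e_ i) f x.
Proof.
move=> oA Ax fC; have fd := Cn1_differentiable_scalar oA Ax fC.
rewrite deriveE// {1}(row_dec v) linear_sum /=; apply: eq_bigr => i _.
by rewrite linearZ /= deriveE.
Qed.

Lemma is_derive_comp (V : normedModType R) n p (A : set E) (f : E -> 'M[R]_(n, p))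
    (g : V -> E) x v dg : open A -> A (g x) -> Cn 1 A f -> is_derive x v g dg ->
  is_derive x v (fun y => f (g y)) ('D_dg f (g x)).
Proof.
move=> oA Ax fC gd; have fd := Cn1_differentiable oA Ax fC.
by have := is_derive_chain gd fd; rewrite -deriveE.
Qed.

Lemma is_derive_comp_scalar (V : normedModType R) (A : set E) (f : E -> R)
    (g : V -> E) x v dg : open A -> A (g x) -> Cn 1 A f -> is_derive x v g dg ->
  is_derive x v (fun y => f (g y)) ('D_dg f (g x)).
Proof.
move=> oA Ax fC gd; have fd := Cn1_differentiable_scalar oA Ax fC.
by have := is_derive_chain gd fd; rewrite -deriveE.
Qed.

(** The direction in which [f] is differentiated varies with the point, whereas [Cn] controls fixed
    directions only. Expanding over the partial derivatives of [f] gives a sum of products to which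
    the induction applies. *)
Lemma Cn_comp_scalar (V : normedModType R) k (A : set V) (B : set E) (f : E -> R)
    (g : V -> E) : open A -> open B -> (forall x, A x -> B (g x)) ->
  Cn k A g -> Cn k B f -> Cn k A (fun x => f (g x)).
Proof.
move=> oA oB gB; elim: k f => [|k IH] f gC fC.
  split=> // x Ax; apply: continuous_comp; first exact: (Cn_cont gC).
  exact: (Cn_cont fC (gB _ Ax)).
have f1 : Cn 1 B f by apply: Cn_leq fC.
split=> [x Ax|v].
  apply: continuous_comp; first exact: (Cn_cont gC).
  exact: (Cn_cont fC (gB _ Ax)).
have dE x : A x -> is_derive x v (fun y => f (g y)) ('D_('D_v g x) f (g x)).
  move=> Ax; apply: (is_derive_comp_scalar oB (gB _ Ax) f1).
  exact: (Cn_is_derive v gC Ax).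
split=> [x Ax|]; first by have [] := dE x Ax.
apply: (Cn_eq oA (f := fun x => \sum_i 'D_v g x 0 i * 'D_(e_ i) f (g x))).
  move=> x Ax; have [_ ->] := dE x Ax.
  by rewrite (derive_dirE_scalar _ oB (gB _ Ax) f1).
apply: (Cn_sum _ oA) => i _; apply: (CnM oA).
  exact: (Cn_entry 0 i oA (Cn_derive v gC)).
exact: IH (CnW gC) (Cn_derive (e_ i) fC).
Qed.

Lemma Cn_comp (V : normedModType R) n p k (A : set V) (B : set E)
    (f : E -> 'M[R]_(n, p)) (g : V -> E) :
  open A -> open B -> (forall x, A x -> B (g x)) ->
  Cn k A g -> Cn k B f -> Cn k A (fun x => f (g x)).
Proof.
move=> oA oB gB gC fC; apply/(Cn_mxP _ _ oA) => i j.
by apply: (Cn_comp_scalar (f := fun y => f y i j) oA oB gB gC); exact: Cn_entry.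
Qed.

End Differentiable.

Section CompositionOneVariable.
Context {R : realType}.

Lemma Cn_comp1 (V : normedModType R) k (A : set V) (B : set R) (f : R -> R)
    (g : V -> R) : open A -> open B -> (forall x, A x -> B (g x)) ->
  Cn k A g -> Cn k B f -> Cn k A (fun x => f (g x)).
Proof.
move=> oA oB gB; elim: k f => [|k IH] f gC fC.
  split=> // x Ax; apply: continuous_comp; first exact: (Cn_cont gC).
  exact: (Cn_cont fC (gB _ Ax)).
split=> [x Ax|v].
  apply: continuous_comp; first exact: (Cn_cont gC).
  exact: (Cn_cont fC (gB _ Ax)).
have dE x : A x -> is_derive x v (fun y => f (g y)) ('D_v g x *: 'D_1 f (g x)).
  move=> Ax; apply: (is_derive_chain1 (g := g) (f := f)); first exact: (Cn_is_derive v gC Ax).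
  exact: (Cn_is_derive (1 : R) fC (gB _ Ax)).
split=> [x Ax|]; first by have [] := dE x Ax.
apply: (Cn_eq oA (f := fun x => 'D_v g x * 'D_1 f (g x))).
  by move=> x Ax; have [_ ->] := dE x Ax.
apply: (CnM oA); first exact: (Cn_derive v gC).
exact: IH (CnW gC) (Cn_derive (1 : R) fC).
Qed.

Lemma Cn_comp1_mx (V : normedModType R) n p k (A : set V) (B : set R)
    (f : R -> 'M[R]_(n, p)) (g : V -> R) :
  open A -> open B -> (forall x, A x -> B (g x)) ->
  Cn k A g -> Cn k B f -> Cn k A (fun x => f (g x)).
Proof.
move=> oA oB gB gC fC; apply/(Cn_mxP _ _ oA) => i j.
by apply: (Cn_comp1 (f := fun y => f y i j) oA oB gB gC); exact: Cn_entry.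
Qed.

Lemma derive_dir1 (W : normedModType R) (f : R -> W) x v :
  derivable f x 1 -> is_derive x v f (v *: 'D_1 f x).
Proof.
by move=> fd; have := is_derive_scale_dir v fd; rewrite /GRing.scale /= mulr1.
Qed.

Lemma Cn_id k (V : normedModType R) (A : set V) : Cn k A (fun x : V => x).
Proof.
case: k => [|k]; split=> //; try by move=> x _; exact: cvg_id.
move=> v; split=> [x _|]; first exact: derivable_id.
suff -> : 'D_v (fun x : V => x) = (fun _ => v) by exact: Cn_cst.
by apply/funext => x; rewrite derive_id.
Qed.

Lemma Cn_fst k (V W : normedModType R) (A : set (V * W)) : Cn k A (fun x => x.1).
Proof.
have cc : continuous (fun x : V * W => x.1) by move=> x; exact: cvg_fst.
case: k => [|k]; split=> //; try by move=> x _; exact: cc.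
move=> v; have dE x : is_derive x v (fun x : V * W => x.1) v.1.
  have E : (fun h : R => h^-1 *: (((fun x : V * W => x.1) \o shift x) (h *: v) - x.1))
     = (fun h : R => h^-1 *: ((id \o shift x.1) (h *: v.1) - id x.1)) by [].
  have [] := @is_derive_id R V x.1 v.1.
  by rewrite /derivable /derive -E => *; apply: DeriveDef.
split=> [x _|]; first by have [] := dE x.
suff -> : 'D_v (fun x : V * W => x.1) = (fun _ => v.1) by exact: Cn_cst.
by apply/funext => x; have [] := dE x.
Qed.

Lemma Cn_comp_snd k (V W U : normedModType R) (A : set W) (f : W -> U) :
  Cn k A f -> Cn k (snd @^-1` A : set (V * W)) (fun x => f x.2).
Proof.
have cc : continuous (fun x : V * W => x.2) by move=> x; exact: cvg_snd.
elim: k f => [|k IH] f [fc fd].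
  by split=> // x Ax; apply: (continuous_comp (cc x)); exact: fc.
split; first by move=> x Ax; apply: (continuous_comp (cc x)); exact: fc.
move=> v; have E x : (fun h : R => h^-1 *: (((fun x : V * W => f x.2) \o shift x) (h *: v) - f x.2))
     = (fun h : R => h^-1 *: ((f \o shift x.2) (h *: v.2) - f x.2)) by [].
split=> [x Ax|]; first by have := (fd v.2).1 _ Ax; rewrite /derivable -E.
suff -> : 'D_v (fun x : V * W => f x.2) = (fun x => 'D_(v.2) f x.2).
  exact: IH (fd v.2).2.
by apply/funext => x; rewrite /derive -E.
Qed.

End CompositionOneVariable.

(** * Symmetry of second derivatives *)

Section Schwarz.
Context {R : realType} {V : normedModType R}.

(** Two mean values: along [u] for the increment [y |-> f (y + v) - f y], then along [v] for
    ['D_u f]. *)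
Lemma second_difference (A : set V) (f : V -> R) (x u v : V) :
  Cn 2 A f -> (forall s t, s \in `[0, 1] -> t \in `[0, 1] -> A (x + s *: u + t *: v)) ->
  exists s t, [/\ s \in `[0, 1], t \in `[0, 1] &
    f (x + u + v) - f (x + u) - (f (x + v) - f x) =
    'D_v ('D_u f) (x + s *: u + t *: v)].
Proof.
move=> fC inA.
have i0 : (0 : R) \in `[0, 1] by rewrite in_itv /= lexx ler01.
have i1 : (1 : R) \in `[0, 1] by rewrite in_itv /= lexx ler01.
pose g y := f (y + v) - f y.
have dg s : s \in `[0, 1] -> is_derive (x + s *: u) u g
    ('D_u f (x + s *: u + v) - 'D_u f (x + s *: u)).
  move=> s01; apply: is_deriveB.
    have E : (fun h : R => h^-1 *: (((fun y => f (y + v)) \o shift (x + s *: u)) (h *: u)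
        - f (x + s *: u + v))) =
      (fun h : R => h^-1 *: ((f \o shift (x + s *: u + v)) (h *: u)
        - f (x + s *: u + v))).
      by apply/funext => h /=; rewrite -!addrA.
    have : is_derive (x + s *: u + v) u f ('D_u f (x + s *: u + v)).
      by apply: (Cn_is_derive u fC); have := inA s 1 s01 i1; rewrite scale1r.
    by move=> [d1 _]; apply: DeriveDef; rewrite /derivable /derive E.
  by apply: (Cn_is_derive u fC); have := inA s 0 s01 i0; rewrite scale0r addr0.
have [s s01|s s01 E] := MVT_line (f := g) (x := x) (v := u) _.
  by have [] := dg s s01.
have s01' : s \in `[0, 1] by apply: subset_itv_oo_cc.
have [t t01|t t01 E2] := MVT_line (f := 'D_u f) (x := x + s *: u) (v := v) _.
  by apply: (Cn_derivable v (Cn_derive u fC)); exact: inA.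
exists s, t; split => //; first exact: subset_itv_oo_cc.
rewrite -E2; have [_ <-] := dg s s01'; rewrite -E /g.
by rewrite [x + u + v]addrAC.
Qed.

Lemma continuous2_ball (A : set V) (g h : V -> R) (x : V) (e : R) :
  open A -> A x -> 0 < e -> {for x, continuous g} -> {for x, continuous h} ->
  exists2 d, 0 < d & forall y, `|x - y| < d ->
    [/\ A y, `|g x - g y| <= e & `|h x - h y| <= e].
Proof.
move=> oA Ax e0 gc hc.
have : \forall y \near x, [/\ A y, `|g x - g y| <= e & `|h x - h y| <= e].
  near=> y; split; near: y; first exact: open_nbhs_nbhs.
  - by have /cvgrPdist_le := gc; exact.
  - by have /cvgrPdist_le := hc; exact.
by move=> /nbhs_ballP[d /= d0 dP]; exists d => // y xy; apply: dP; rewrite -ball_normE.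
Unshelve. all: by end_near. Qed.

(** The second difference is symmetric in the two vectors, so it is a value of either mixed
    derivative at some point near [x]; scaling [u] and [v] by a small [r] brings these points into a
    ball where both derivatives are almost constant. *)
Lemma schwarz (A : set V) (f : V -> R) (x u v : V) : open A -> A x -> Cn 2 A f ->
  'D_u ('D_v f) x = 'D_v ('D_u f) x.
Proof.
move=> oA Ax fC; apply/eqP; rewrite -subr_eq0 -normr_le0; apply/ler_addgt0Pl => e e0.
rewrite addr0.
have [d /= d0 dP] : exists2 d, 0 < d & forall y, `|x - y| < d ->
    [/\ A y, `|'D_u ('D_v f) x - 'D_u ('D_v f) y| <= e / 2 &
     `|'D_v ('D_u f) x - 'D_v ('D_u f) y| <= e / 2].
  apply: (continuous2_ball oA Ax _ (Cn_cont (Cn_derive u (Cn_derive v fC)) Ax)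
    (Cn_cont (Cn_derive v (Cn_derive u fC)) Ax)).
  by rewrite divr_gt0.
have [r r0 rd] : exists2 r : R, 0 < r & r * (`|u| + `|v|) < d.
  have n0 : 0 < `|u| + `|v| + 1 by rewrite ltr_wpDl.
  exists (d / (`|u| + `|v| + 1)); first by rewrite divr_gt0.
  by rewrite mulrAC ltr_pdivrMr// ltr_pM2l// ltrDl.
have close s t : s \in `[0, 1] -> t \in `[0, 1] ->
    `|x - (x + s *: (r *: u) + t *: (r *: v))| < d.
  rewrite !in_itv /= => /andP[s0 s1] /andP[t0 t1].
  rewrite -addrA opprD addrA subrr sub0r normrN (le_lt_trans (ler_normD _ _))//.
  rewrite !normrZ !(ger0_norm s0, ger0_norm t0, gtr0_norm r0).
  rewrite (le_lt_trans _ rd)// mulrDr.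
  by apply: lerD; apply: ler_piMl => //; rewrite mulr_ge0// ltW.
have [s|s [t [s01 t01 E1]]] := second_difference (x := x) (u := r *: u) (v := r *: v) fC _.
  by move=> t s01 t01; have [] := dP _ (close _ _ s01 t01).
have close' s' t' : s' \in `[0, 1] -> t' \in `[0, 1] ->
    `|x - (x + s' *: (r *: v) + t' *: (r *: u))| < d.
  by move=> s01' t01'; rewrite addrAC; exact: close.
have [s'|s' [t' [s01' t01' E2]]] := second_difference (x := x) (u := r *: v) (v := r *: u) fC _.
  by move=> t' s01' t01'; have [] := dP _ (close' _ _ s01' t01').
have D2 y a b : A y -> 'D_(r *: a) ('D_(r *: b) f) y = r *: (r *: 'D_a ('D_b f) y).
  move=> Ay.
  have -> : 'D_(r *: a) ('D_(r *: b) f) y = 'D_(r *: a) (r *: 'D_b f) y.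
    apply: near_eq_derive; near=> z.
    have Az : A z by near: z; exact: open_nbhs_nbhs.
    by have [_ ->] := is_derive_scale_dir r (Cn_derivable b fC Az).
  have db := Cn_derivable a (Cn_derive b fC) Ay.
  have [_ ->] := is_derive_scale_dir r (derivableZ (k := r) db).
  by rewrite deriveZ.
have [A1 _ B1] := dP _ (close _ _ s01 t01).
have [A2 B2 _] := dP _ (close' _ _ s01' t01').
have Ec : x + r *: v + r *: u = x + r *: u + r *: v by rewrite addrAC.
rewrite (D2 _ v u A1) in E1; rewrite (D2 _ u v A2) Ec in E2.
move: E1 E2 B1 B2; move: ('D_v ('D_u f) _) ('D_u ('D_v f) _) => a b E1 E2 B1 B2.
have E3 : a = b.
  apply: (mulfI (lt0r_neq0 r0)); apply: (mulfI (lt0r_neq0 r0)).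
  by move: E1 E2; rewrite /GRing.scale /= => <- <-; ring.
rewrite -E3 in B2; rewrite distrC in B1.
by rewrite -[X in X - _](subrK a) -addrA (le_trans (ler_normD _ _))// (splitr e) lerD.
Unshelve. all: by end_near. Qed.

End Schwarz.

Lemma open_setI_preimage (S T : topologicalType) (A : set S) (B : set T) (f : S -> T) :
  open A -> open B -> (forall x, A x -> {for x, continuous f}) ->
  open (A `&` f @^-1` B).
Proof.
move=> oA oB fc; rewrite openE => x [Ax Bfx]; rewrite /interior.
apply: filterI; first exact: open_nbhs_nbhs.
by apply: (fc x Ax); exact: open_nbhs_nbhs.
Qed.

(** * Integrals, inverse and implicit functions *)

Section IntegralOverUnitInterval.
Context {R : realType}.
Implicit Types f g F G : R -> R.

Lemma primitive_exists f (a b : R) : a <= b ->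
  (forall s, s \in `[a, b] -> {for s, continuous f}) ->
  exists F, forall s, s \in `[a, b] -> is_derive s 1 F (f s).
Proof.
move=> ab fc; pose cl (s : R) : R := Num.max a (Num.min s b).
have clI s : cl s \in `[a, b].
  by rewrite in_itv /= /cl le_max lexx /= ge_max ab /= ge_min lexx orbT.
have clE s : s \in `[a, b] -> cl s = s.
  by rewrite in_itv /= /cl => /andP[sa sb]; rewrite (min_idPl sb) (max_idPr sa).
have clc : continuous cl.
  move=> s; apply: (@continuous_max _ _ (fun=> a) (fun s => Num.min s b)).
    exact: cvg_cst.
  by apply: (@continuous_min _ _ (fun s => s) (fun=> b)); [exact: cvg_id|exact: cvg_cst].
have fclc : continuous (f \o cl).
  by move=> s; apply: continuous_comp; [exact: clc|apply: fc; exact: clI].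
exists (fun x => \int[lebesgue_measure]_(t in [set` `[a - 1, x]]) (f \o cl) t)%R.
move=> s sab; have /andP[sa sb] : a <= s <= b by move: sab; rewrite in_itv.
have [|||| d1 d2] := @continuous_FTC1_closed R (f \o cl) (a - 1) s (b + 1).
- by rewrite (le_lt_trans sb)// ltrDl.
- apply: continuous_compact_integrable; first exact: segment_compact.
  by apply: continuous_subspaceT; exact: fclc.
- by rewrite (lt_le_trans _ sa)// ltrBlDr ltrDl.
- exact: fclc.
by apply: DeriveDef => //; rewrite -derive1E d2 /= clE.
Qed.

Definition primitive01 f F := forall s : R, s \in `[0, 1] -> is_derive s 1 F (f s).
Definition continuous01 f := forall s : R, s \in `[0, 1] -> {for s, continuous f}.

Lemma primitive01_exists f : continuous01 f -> exists F, primitive01 f F.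
Proof. exact: primitive_exists. Qed.

Lemma primitive01_mean f F : primitive01 f F ->
  exists2 s, s \in `]0, 1[ & F 1 - F 0 = f s.
Proof.
move=> fF; have [||s s01 E] := @MVT R F f 0 1 ltr01.
- by move=> s s01; apply: fF; exact: subset_itv_oo_cc.
- by apply: derivable_within_continuous => s /fF[].
by exists s => //; rewrite E subr0 mulr1.
Qed.

(** The integral over [[0, 1]] is encoded as the increment of an arbitrary primitive, with default 0
    when there is none; bounds and linearity then come from the mean value theorem, and measure
    theory enters only through the existence of primitives. *)
Definition Int01 f : R := xget 0 [set r | exists2 F, primitive01 f F & r = F 1 - F 0].

Lemma Int01E f F : primitive01 f F -> Int01 f = F 1 - F 0.
Proof.
move=> fF; rewrite /Int01; case: xgetP => [r -> [G fG ->]|/(_ (F 1 - F 0))]; last first.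
  by case; exists F.
have [|s s01] := @primitive01_mean (fun s => f s - f s) (fun s => G s - F s).
  by move=> s s01; apply: is_deriveB; [exact: fG|exact: fF].
by rewrite subrr => E; lra.
Qed.

Lemma Int01_mean f : continuous01 f -> exists2 s, s \in `]0, 1[ & Int01 f = f s.
Proof.
move=> /primitive01_exists[F fF]; have [s s01 E] := primitive01_mean fF.
by exists s => //; rewrite (Int01E fF).
Qed.

Lemma Int01Z f c : continuous01 f -> Int01 (fun s => c * f s) = c * Int01 f.
Proof.
move=> /primitive01_exists[F fF].
rewrite (Int01E fF) (@Int01E _ (fun s => c * F s)); first by ring.
by move=> s s01; apply: is_deriveZ; exact: fF.
Qed.

Lemma Int01B f g : continuous01 f -> continuous01 g ->
  Int01 (fun s => f s - g s) = Int01 f - Int01 g.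
Proof.
move=> /primitive01_exists[F fF] /primitive01_exists[G gG].
rewrite (Int01E fF) (Int01E gG) (@Int01E _ (fun s => F s - G s)); first by ring.
by move=> s s01; apply: is_deriveB; [exact: fF|exact: gG].
Qed.

Lemma Int01_norm f c : continuous01 f -> (forall s, s \in `[0, 1] -> `|f s| <= c) ->
  `|Int01 f| <= c.
Proof.
move=> fc fle; have [s s01 ->] := Int01_mean fc.
by apply: fle; exact: subset_itv_oo_cc.
Qed.

Context {V : normedModType R}.

(** Tube lemma: compactness of [[0, 1]], in near-covering form, makes the estimate uniform in
    [s]. *)
Lemma uniform01 (H : R * V -> R) (y0 : V) :
  (forall s, s \in `[0, 1] -> {for (s, y0), continuous H}) ->
  forall e, 0 < e -> \forall y \near y0, forall s, s \in `[0, 1] ->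
    `|H (s, y) - H (s, y0)| <= e.
Proof.
move=> Hc e e0.
have cov := proj1 (compact_near_coveringP _) (@segment_compact R 0 1) V (nbhs y0)
  (fun y s => `|H (s, y) - H (s, y0)| <= e) _.
apply: filterS (cov _ _) => [y Py s s01|s s01]; first exact: Py.
have e20 : 0 < e / 2 by rewrite divr_gt0.
have /cvgrPdist_le /(_ _ e20) := Hc s s01.
move=> [[U1 U2] /= [nU1 nU2] U12].
near=> s' y => /=.
have h1 : `|H (s, y0) - H (s', y)| <= e / 2.
  by apply: (U12 (s', y)); split => /=; [near: s'|near: y].
have h2 : `|H (s, y0) - H (s', y0)| <= e / 2.
  apply: (U12 (s', y0)); split => /=; last exact: nbhs_singleton.
  by near: s'.
rewrite (_ : _ - _ = (H (s, y0) - H (s', y0)) - (H (s, y0) - H (s', y))); last by ring.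
by rewrite (le_trans (ler_normB _ _))// (splitr e) lerD.
Unshelve. all: by end_near. Qed.

Lemma continuous01_section (H : R * V -> R) (y : V) :
  (forall s, s \in `[0, 1] -> {for (s, y), continuous H}) ->
  continuous01 (fun s => H (s, y)).
Proof.
move=> Hc s s01; apply: (@continuous_comp _ _ _ (fun s => (s, y)) H); last exact: Hc.
by apply: (@cvg_pair _ _ _ (nbhs s) (nbhs s) (nbhs y)); [exact: cvg_id|exact: cvg_cst].
Qed.

Lemma continuous_Int01 (A : set V) (H : R * V -> R) (y0 : V) : open A -> A y0 ->
  (forall (s : R) y, s \in `[0, 1] -> A y -> {for (s, y), continuous H}) ->
  {for y0, continuous (fun y => Int01 (fun s => H (s, y)))}.
Proof.
move=> oA Ay0 Hc; apply/cvgrPdist_le => e e0; near=> y.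
have Ay : A y by near: y; exact: open_nbhs_nbhs.
have c0 := continuous01_section (fun s s01 => Hc s y0 s01 Ay0).
have c1 := continuous01_section (fun s s01 => Hc s y s01 Ay).
rewrite distrC -Int01B//; apply: Int01_norm => [s s01|].
  by apply: continuousB; [exact: c1|exact: c0].
by near: y; apply: uniform01 => // s s01; exact: Hc.
Unshelve. all: by end_near. Qed.

(** Differentiation under the integral sign: for each [s] the difference quotient is a value of the
    partial derivative at an intermediate point, and [uniform01] bounds its distance to the limit
    uniformly in [s]. The direction [(0, v)] moves the parameter only. *)
Lemma Cn_Int01 n (Om : set (R * V)) (A : set V) (H : R * V -> R) : open A ->
  (forall (s : R) y, s \in `[0, 1] -> A y -> Om (s, y)) -> Cn n Om H ->
  Cn n A (fun y => Int01 (fun s => H (s, y))).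
Proof.
move=> oA AOm; elim: n H => [|n IH] H HC.
  split=> // y Ay; apply: (continuous_Int01 oA Ay) => s z s01 Az.
  by apply: (Cn_cont HC); exact: AOm.
have cI y : A y -> {for y, continuous (fun y => Int01 (fun s => H (s, y)))}.
  move=> Ay; apply: (continuous_Int01 oA Ay) => s z s01 Az.
  by apply: (Cn_cont HC); exact: AOm.
have dI y v : A y -> is_derive y v (fun y => Int01 (fun s => H (s, y)))
    (Int01 (fun s => 'D_(0, v) H (s, y))).
  move=> Ay; have HC' := Cn_derive ((0, v) : R * V) HC.
  suff dl : h^-1 *: (((fun y => Int01 (fun s => H (s, y))) \o shift y) (h *: v)
       - Int01 (fun s => H (s, y))) @[h --> 0^'] --> Int01 (fun s => 'D_(0, v) H (s, y)).
    by apply: DeriveDef; [apply/cvg_ex; eexists; exact: dl|apply/cvg_lim].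
  apply/cvgrPdist_le => e e0.
  have [d /= d0 dP] : exists2 d, 0 < d & forall z, `|y - z| < d -> A z /\
      forall s : R, s \in `[0, 1] -> `|'D_(0, v) H (s, z) - 'D_(0, v) H (s, y)| <= e.
    have : \forall z \near y, A z /\ forall s : R, s \in `[0, 1] ->
        `|'D_(0, v) H (s, z) - 'D_(0, v) H (s, y)| <= e.
      near=> z; split; near: z; first exact: open_nbhs_nbhs.
      apply: (@uniform01 ('D_((0, v) : R * V) H) y _ e e0) => s s01; apply: (Cn_cont HC'); exact: AOm.
    by move=> /nbhs_ballP[d /= d0 dP]; exists d => // z yz; apply: dP; rewrite -ball_normE.
  have nd : \forall h \near (0 : R)^', `|h| * `|v| < d.
    have [->|v0] := eqVneq v 0; first by near=> h; rewrite normr0 mulr0.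
    near=> h; rewrite -ltr_pdivlMr ?normr_gt0//; near: h; apply: dnbhs0_lt.
    by rewrite divr_gt0// normr_gt0.
  near=> h.
  have h0 : h != 0 by near: h; exact: nbhs_dnbhs_neq.
  have hd : `|h| * `|v| < d by near: h.
  have seg t : t \in `[0, 1] -> `|y - (y + t *: (h *: v))| < d.
    rewrite in_itv /= => /andP[t0 t1]; rewrite opprD addrA subrr sub0r normrN !normrZ.
    by rewrite (le_lt_trans _ hd)// ler_piMl// ?mulr_ge0// ger0_norm.
  have Ah : A (h *: v + y).
    have : (1 : R) \in `[0, 1] by rewrite in_itv /= ler01 lexx.
    by move=> /seg/dP[]; rewrite scale1r addrC.
  have c1 : continuous01 (fun s => H (s, h *: v + y)).
    by apply: continuous01_section => s s01; apply: (Cn_cont HC); exact: AOm.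
  have c0 : continuous01 (fun s => H (s, y)).
    by apply: continuous01_section => s s01; apply: (Cn_cont HC); exact: AOm.
  have c2 : continuous01 (fun s => 'D_(0, v) H (s, y)).
    apply: (@continuous01_section ('D_((0, v) : R * V) H)) => s s01.
    by apply: (Cn_cont HC'); exact: AOm.
  have c10 : continuous01 (fun s => H (s, h *: v + y) - H (s, y)).
    by move=> s s01; apply: continuousB; [exact: c1|exact: c0].
  have c10h : continuous01 (fun s => h^-1 * (H (s, h *: v + y) - H (s, y))).
    by move=> s s01; apply: continuousM; [exact: cvg_cst|exact: c10].
  rewrite /= /GRing.scale /= -Int01B// -Int01Z// -Int01B//.
  apply: Int01_norm => [s s01|s s01].
    by apply: continuousB; [exact: c2|exact: c10h].
  have dOm t : t \in `[0, 1] -> Om ((s, y) + t *: (h *: (0, v))).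
    move=> t01; rewrite (_ : _ + _ = (s, y + t *: (h *: v))).
      by apply: AOm => //; exact: (dP _ (seg t t01)).1.
    by congr (_, _); rewrite /= !scaler0 addr0.
  have [t t01|t t01 E] := MVT_line (f := H) (x := (s, y)) (v := h *: (0, v)) _.
    by have [] := is_derive_scale_dir h (Cn_derivable (0, v) HC (dOm t t01)).
  have t01' : t \in `[0, 1] by apply: subset_itv_oo_cc.
  rewrite (_ : (s, y) + h *: (0, v) = (s, h *: v + y)) in E; last first.
    by congr (_, _); rewrite /= ?scaler0 ?addr0// addrC.
  have [_ E2] := is_derive_scale_dir h (Cn_derivable (0, v) HC (dOm t t01')).
  have Ept : (s, y) + t *: (h *: (0, v)) = (s, y + t *: (h *: v)).
    by congr (_, _); rewrite /= ?scaler0 ?addr0.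
  rewrite E E2 Ept -[h *: _]/(h * _) mulKf// distrC.
  by apply: (dP _ (seg t t01')).2.
split=> // v; split=> [y Ay|]; first by have [] := dI y v Ay.
apply: (Cn_eq oA); last exact: IH (Cn_derive ((0, v) : R * V) HC).
by move=> y Ay; have [_ ->] := dI y v Ay.
Unshelve. all: by end_near. Qed.

End IntegralOverUnitInterval.

Section OneVariable.
Context {R : realType}.

Lemma CnZ_cst (V W : normedModType R) n (A : set V) (c : R) (f : V -> W) : open A ->
  Cn n A f -> Cn n A (fun x => c *: f x).
Proof.
move=> oA; have cZ (g : V -> W) x : {for x, continuous g} ->
    {for x, continuous (fun y => c *: g y)}.
  by move=> gc; exact: cvgZl_tmp.
elim: n f => [|n IH] f fC; first by split=> // x Ax; apply: cZ; exact: (Cn_cont fC).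
split=> [x Ax|v]; first by apply: cZ; exact: (Cn_cont fC).
split=> [x Ax|]; first exact: (derivableZ (k := c) (Cn_derivable v fC Ax)).
apply: (Cn_eq oA); last exact: IH (Cn_derive v fC).
by move=> x Ax; rewrite (deriveZ c (Cn_derivable v fC Ax)).
Qed.

Lemma Cn_antiderivative (W : normedModType R) n (A : set R) (F f : R -> W) : open A ->
  (forall x, A x -> is_derive x 1 F (f x)) -> Cn n A f -> Cn n.+1 A F.
Proof.
move=> oA Ff fC; split=> [x Ax|v].
  by have [/derivable1_diffP Fd _] := Ff x Ax; exact: differentiable_continuous.
have dE x : A x -> is_derive x v F (v *: f x).
  by move=> Ax; have [Fd <-] := Ff x Ax; exact: derive_dir1.
split=> [x Ax|]; first by have [] := dE x Ax.
apply: (Cn_eq oA); last exact: (CnZ_cst v oA fC).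
by move=> x Ax; have [_ ->] := dE x Ax.
Qed.

Lemma is_derive_affine (c k s : R) : is_derive s 1 (fun s : R => c + s * k) k.
Proof.
have h1 := is_deriveM (is_derive_id s 1) (is_derive_cst k s 1).
have h2 := is_deriveD (is_derive_cst c s 1) h1.
by apply: (is_derive_eq h2); rewrite /cst /GRing.scale /=; ring.
Qed.

Lemma itv_oo_open (a b : R) : open (`]a, b[%classic : set R).
Proof. exact: interval_open. Qed.

(** One formula based at the midpoint [c] serves the whole open interval, near whose ends [f] may be
    unbounded. Its derivative at [x0] is found by comparison with a primitive on a compact interval
    whose interior contains [c] and [x0]. *)
Lemma antiderivative_exists (f : R -> R) (a b : R) : a < b ->
  (forall x, x \in `]a, b[ -> {for x, continuous f}) ->
  exists F, forall x, x \in `]a, b[ -> is_derive x 1 F (f x).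
Proof.
move=> ab fc; pose c := (a + b) / 2.
exists (fun x => (x - c) * Int01 (fun s => f (c + s * (x - c)))) => x0 /[dup] x0ab.
rewrite in_itv /= => /andP[ax xb].
pose al := (a + Num.min c x0) / 2; pose be := (b + Num.max c x0) / 2.
have cab : a < c < b by rewrite /c; lra.
have [c1 c2] : Num.min c x0 <= c /\ Num.min c x0 <= x0 by rewrite !ge_min !lexx orbT.
have [c3 c4] : c <= Num.max c x0 /\ x0 <= Num.max c x0 by rewrite !le_max !lexx orbT.
have am : a < Num.min c x0 by rewrite lt_min ax andbT; case/andP: cab.
have mb : Num.max c x0 < b by rewrite gt_max xb andbT; case/andP: cab.
have [G GP] : exists G, forall s, s \in `[al, be] -> is_derive s 1 G (f s).
  apply: primitive_exists; first by rewrite /al /be; lra.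
  move=> s; rewrite in_itv /= => /andP[sal sbe]; apply: fc; rewrite in_itv /=.
  by move: sal sbe; rewrite /al /be => *; apply/andP; split; lra.
have GE x : x \in `]al, be[ -> G x - G c = (x - c) * Int01 (fun s => f (c + s * (x - c))).
  rewrite in_itv /= => /andP[alx xbe].
  have inab s : s \in `[0, 1] -> c + s * (x - c) \in `[al, be].
    rewrite !in_itv /= => /andP[s0 s1].
    have alc : al < c by rewrite /al; lra.
    have cbe : c < be by rewrite /be; lra.
    apply/andP; split.
      rewrite (_ : c + s * (x - c) = (1 - s) * c + s * x); last by ring.
      rewrite (_ : al = (1 - s) * al + s * al); last by ring.
      by apply: lerD; apply: ler_wpM2l; lra.
    rewrite (_ : c + s * (x - c) = (1 - s) * c + s * x); last by ring.
    rewrite [X in _ <= X](_ : be = (1 - s) * be + s * be); last by ring.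
    by apply: lerD; apply: ler_wpM2l; lra.
  have aff (s : R) := is_derive_affine c (x - c) s.
  have fc1 : continuous01 (fun s => f (c + s * (x - c))).
    move=> s s01; apply: (@continuous_comp _ _ _ (fun s : R => c + s * (x - c)) f).
      apply: differentiable_continuous; apply/derivable1_diffP.
      by have [] := aff s.
    apply: fc; move: (inab s s01); rewrite !in_itv /= => /andP[h1 h2].
    by move: h1 h2; rewrite /al /be => *; apply/andP; split; lra.
  rewrite -Int01Z// (@Int01E _ _ (fun s => G (c + s * (x - c)))).
    by congr (G _ - G _); ring.
  by move=> s s01; apply: (is_derive_chain1 (aff s)); exact: GP (inab s s01).
have x0al : x0 \in `]al, be[ by rewrite in_itv /= /al /be; apply/andP; split; lra.
apply: (@near_eq_is_derive _ _ _ (fun x => G x - G c)).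
  near=> x; apply: GE; near: x; exact: near_in_itvoo.
have hG := GP x0 (subset_itv_oo_cc x0al).
by have := is_deriveB hG (is_derive_cst (G c) x0 1); rewrite subr0.
Unshelve. all: by end_near. Qed.

Lemma derive1_increasing (f df : R -> R) (a b : R) :
  (forall x, x \in `]a, b[ -> is_derive x 1 f (df x)) ->
  (forall x, x \in `]a, b[ -> 0 < df x) ->
  forall x y, x \in `]a, b[ -> y \in `]a, b[ -> x < y -> f x < f y.
Proof.
move=> fd df0 x y; rewrite !in_itv /= => /andP[ax xb] /andP[ay yb] xy.
have sub z : z \in `[x, y] -> z \in `]a, b[.
  rewrite !in_itv /= => /andP[xz zy].
  by rewrite (lt_le_trans ax xz) (le_lt_trans zy yb).
have H1 z : z \in `]x, y[ -> is_derive z 1 f (df z).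
  by move=> zxy; apply/fd/sub; exact: subset_itv_oo_cc.
have H2 : {within `[x, y], continuous f}.
  by apply: derivable_within_continuous => z /sub/fd[].
have [z z01 E] := MVT xy H1 H2.
rewrite -subr_gt0 E mulr_gt0 ?subr_gt0//; apply: df0; apply: sub.
exact: subset_itv_oo_cc.
Qed.

(** Smoothness of the inverse is bootstrapped from [g' = 1 / (df o g)]: if [g] is of class [C^n], so
    is its derivative. *)
Lemma inverse_function1 (f df : R -> R) (a b : R) :
  (forall x, x \in `]a, b[ -> is_derive x 1 f (df x)) ->
  (forall x, x \in `]a, b[ -> 0 < df x) -> smooth_on `]a, b[%classic df ->
  exists g : R -> R, [/\ forall x, x \in `]a, b[ -> g (f x) = x,
    open (f @` `]a, b[%classic), smooth_on (f @` `]a, b[%classic) g &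
    forall x, x \in `]a, b[ -> is_derive (f x) 1 g (df x)^-1].
Proof.
move=> fd df0 dfS; have mono := derive1_increasing fd df0.
have inj x y : x \in `]a, b[ -> y \in `]a, b[ -> f x = f y -> x = y.
  move=> xab yab fxy; have [xy|yx|//] := ltgtP x y.
    by have := mono _ _ xab yab xy; rewrite fxy ltxx.
  by have := mono _ _ yab xab yx; rewrite fxy ltxx.
pose g t := xget a (fun x : R => (x \in `]a, b[) /\ f x = t).
have gK x : x \in `]a, b[ -> g (f x) = x.
  move=> xab; rewrite /g; case: xgetP => [y _ [yab /inj ->//]|/(_ x)].
  by case.
have fc x : x \in `]a, b[ -> {for x, continuous f}.
  move=> /fd[/derivable1_diffP ? _]; exact: differentiable_continuous.
have nearab x : x \in `]a, b[ -> \forall y \near x, y \in `]a, b[.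
  exact: near_in_itvoo.
have gd x : x \in `]a, b[ -> is_derive (f x) 1 g (df x)^-1.
  move=> xab; apply: is_derive_inverse.
  - by near=> y; apply: gK; near: y; exact: nearab.
  - by near=> y; apply: fc; near: y; exact: nearab.
  - exact: fd.
  - by rewrite gt_eqF// df0.
have oJ : open (f @` `]a, b[%classic).
  rewrite openE => _ [x /= xab <-]; have := xab; rewrite in_itv /= => /andP[ax xb].
  pose x1 := (a + x) / 2; pose x2 := (x + b) / 2.
  have x1ab : x1 \in `]a, b[ by rewrite in_itv /= /x1; apply/andP; split; lra.
  have x2ab : x2 \in `]a, b[ by rewrite in_itv /= /x2; apply/andP; split; lra.
  have x12 : x1 <= x2 by rewrite /x1 /x2; lra.
  have fx1 : f x1 < f x by apply: mono => //; rewrite /x1; lra.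
  have fx2 : f x < f x2 by apply: mono => //; rewrite /x2; lra.
  have nfx : f x \in `]f x1, f x2[ by rewrite in_itv /= fx1 fx2.
  apply: filterS (near_in_itvoo nfx) => t; rewrite in_itv /= => /andP[t1 t2].
  have sub z : z \in `[x1, x2] -> z \in `]a, b[.
    by rewrite !in_itv /= /x1 /x2 => /andP[? ?]; apply/andP; split; lra.
  have [||z zx <-] := @IVT R f x1 x2 t x12.
  - by apply: derivable_within_continuous => z /sub/fd[].
  - by rewrite ge_min le_max (ltW t1) (ltW t2) orbT.
  by exists z => //=; exact: sub.
exists g; split=> //; elim=> [|n IH].
  split=> // _ [x xab <-]; have [/derivable1_diffP ? _] := gd x xab.
  exact: differentiable_continuous.
apply: (@Cn_antiderivative _ n _ g (fun t => (df (g t))^-1)) => //.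
  by move=> _ [x xab <-]; rewrite gK//; exact: gd.
have gab t : (f @` `]a, b[%classic) t -> g t \in `]a, b[ by move=> [x xab <-]; rewrite gK.
apply: (CnV oJ) => [t /gab/df0/lt0r_neq0//|].
exact: (Cn_comp1 oJ (@itv_oo_open a b) gab IH (dfS n)).
Unshelve. all: by end_near. Qed.

End OneVariable.

(** * Division by a defining function, bump functions *)

Section Division.
Context {R : realType} {m : nat}.
Local Notation E := 'rV[R]_m.

Lemma derive_lin (A : set E) (f : E -> R) x (a b : R) (u v : E) :
  open A -> A x -> Cn 1 A f ->
  'D_(a *: u + b *: v) f x = a * 'D_u f x + b * 'D_v f x.
Proof.
move=> oA Ax fC; have fd := Cn1_differentiable_scalar oA Ax fC.
by rewrite !deriveE // linearD !linearZ.
Qed.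

Lemma pos_continuous_near (T : topologicalType) (f : T -> R) x :
  {for x, continuous f} -> 0 < f x -> \forall y \near x, 0 < f y.
Proof.
by move=> fc fx; apply: (fc [set t | 0 < t]); apply: open_nbhs_nbhs; split => //; exact: open_gt.
Qed.

Lemma neg_continuous_near (T : topologicalType) (f : T -> R) x :
  {for x, continuous f} -> f x < 0 -> \forall y \near x, f y < 0.
Proof.
by move=> fc fx; apply: (fc [set t | t < 0]); apply: open_nbhs_nbhs; split => //; exact: open_lt.
Qed.

Lemma continuous_near_lt (T : topologicalType) (f : T -> R) x :
  (forall e, 0 < e -> \forall y \near x, `|f x - f y| < e) -> {for x, continuous f}.
Proof. by move=> h; apply/cvgrPdist_lt => e e0; exact: h. Qed.

(** [th y] is the signed time at which the line through [y] in the direction [e] meets [g = 0]. The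
    last clause keeps the whole segment in the region where [g] increases along [e]; division
    integrates along that segment. *)
Lemma implicit_function (O : set E) (g : E -> R) (p e : E) :
  open O -> smooth_on O g -> O p -> g p = 0 -> 0 < 'D_e g p ->
  exists (O1 : set E) (th : E -> R), [/\ open O1, O1 p, O1 `<=` O, smooth_on O1 th &
    forall y, O1 y -> g (y + th y *: e) = 0 /\
      forall s, s \in `[0, 1] -> O (y + (s * th y) *: e) /\ 0 < 'D_e g (y + (s * th y) *: e)].
Proof.
move=> oO gS Op gp gep.
have gc y : O y -> {for y, continuous g} by exact: (Cn_cont (gS 0%N)).
have Dc y : O y -> {for y, continuous ('D_e g)} by exact: (Cn_cont (Cn_derive e (gS 1%N))).
have [d /= d0 dP] : exists2 d, 0 < d & forall y, `|p - y| < d -> O y /\ 0 < 'D_e g y.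
  have : \forall y \near p, O y /\ 0 < 'D_e g y.
    near=> y; split; near: y; first exact: open_nbhs_nbhs.
    exact: (pos_continuous_near (Dc p Op) gep).
  by move=> /nbhs_ballP[d /= d0 dP]; exists d => // y xy; apply: dP; rewrite -ball_normE.
(* Half of the radius [d] is left for [y], half for the displacement along [e]. *)
have [r r0 rd] : exists2 r : R, 0 < r & r * `|e| < d / 2.
  have n0 : 0 < `|e| + 1 by rewrite ltr_wpDl.
  exists (d / 2 / (`|e| + 1)); first by rewrite !divr_gt0.
  by rewrite mulrAC ltr_pdivrMr// ltr_pM2l ?divr_gt0// ltrDl.
have inO (y : E) (t : R) : `|p - y| < d / 2 -> `|t| <= r -> `|p - (y + t *: e)| < d.
  move=> yd tr; rewrite opprD addrA (le_lt_trans (ler_normB _ _))//.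
  rewrite [d]splitr ltrD// (le_lt_trans _ rd)// normrZ ler_wpM2r//.
have mono (y : E) (t1 t2 : R) : `|p - y| < d / 2 -> `|t1| <= r -> `|t2| <= r -> t1 < t2 ->
    g (y + t1 *: e) < g (y + t2 *: e).
  move=> yd t1r t2r t12.
  have sr (s : R) : s \in `[0, 1] -> `|t1 + s * (t2 - t1)| <= r.
    rewrite in_itv /= => /andP[s0 s1].
    rewrite (_ : t1 + _ = (1 - s) * t1 + s * t2); last by ring.
    rewrite (le_trans (ler_normD _ _))// !normrM (ger0_norm s0) ger0_norm ?subr_ge0//.
    rewrite (_ : r = (1 - s) * r + s * r); last by ring.
    by apply: lerD; apply: ler_wpM2l => //; rewrite subr_ge0.
  have pt (s : R) : y + t1 *: e + s *: ((t2 - t1) *: e) = y + (t1 + s * (t2 - t1)) *: e.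
    by rewrite scalerA -addrA -scalerDl.
  have OD (s : R) : s \in `[0, 1] -> O (y + t1 *: e + s *: ((t2 - t1) *: e)) /\
      0 < 'D_e g (y + t1 *: e + s *: ((t2 - t1) *: e)).
    by move=> s01; rewrite pt; apply: dP; apply: inO => //; exact: sr.
  have [s s01|s s01 E0] := MVT_line (f := g) (x := y + t1 *: e) (v := (t2 - t1) *: e) _.
    by have [] := is_derive_scale_dir (t2 - t1) (Cn_derivable e (gS 1%N) (OD s s01).1).
  have s01' : s \in `[0, 1] by apply: subset_itv_oo_cc.
  have [Os Ds] := OD s s01'.
  have [_ E1] := is_derive_scale_dir (t2 - t1) (Cn_derivable e (gS 1%N) Os).
  rewrite -subr_gt0 (_ : y + t2 *: e = y + t1 *: e + (t2 - t1) *: e); last first.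
    by rewrite -addrA -scalerDl [t1 + _]addrC subrK.
  by rewrite E0 E1 mulr_gt0// subr_gt0.
have rr : `|r| <= r by rewrite gtr0_norm.
have rNr : `|- r| <= r by rewrite normrN gtr0_norm.
pose B := [set y : E | `|p - y| < d / 2].
have oB : open B.
  by rewrite (_ : B = ball p (d / 2)) ?ball_normE//; [exact: ball_open; rewrite divr_gt0|rewrite -ball_normE].
(* On [O1] the signs of [g] at the times [r] and [- r] force a zero in between, unique by [mono]. *)
pose O1 := (B `&` (fun y : E => g (y + r *: e)) @^-1` [set t | 0 < t]) `&`
           (fun y : E => g (y + (- r) *: e)) @^-1` [set t | t < 0].
have cline (t : R) (y : E) : {for y, continuous (fun y : E => y + t *: e)}.
  exact: (@Cn_cont _ _ _ 0 setT _ y (CnD openT (Cn_id 0 setT) (Cn_cst 0 setT (t *: e))) I). 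
have cg (t : R) : `|t| <= r ->
    forall y, B y -> {for y, continuous (fun y : E => g (y + t *: e))}.
  move=> tr y By; apply: (continuous_comp (cline t y)); apply: gc.
  exact: (dP _ (inO _ _ By tr)).1.
have oB1 : open (B `&` (fun y : E => g (y + r *: e)) @^-1` [set t | 0 < t]).
  apply: (@open_setI_preimage E R B [set t | 0 < t] (fun y : E => g (y + r *: e)) oB).
    exact: open_gt.
  exact: cg.
have oO1 : open O1.
  apply: (@open_setI_preimage E R _ [set t | t < 0] (fun y : E => g (y + (- r) *: e)) oB1).
    exact: open_lt.
  by move=> y [By _]; exact: cg.
have Bp : B p by rewrite /B /= subrr normr0 divr_gt0.
have n0r : `|0 : R| <= r by rewrite normr0 ltW.
have O1p : O1 p.
  split; first split => //=.
    have := mono p 0 r Bp n0r rr r0; rewrite scale0r addr0 gp; exact.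
  have := mono p (- r) 0 Bp rNr n0r; rewrite scale0r addr0 gp oppr_lt0; exact.
pose th (y : E) : R := xget 0 [set t : R | `|t| <= r /\ g (y + t *: e) = 0].
have thP (y : E) : O1 y -> `|th y| < r /\ g (y + th y *: e) = 0.
  move=> [[By gr] gNr]; rewrite /th; case: xgetP => [t _ [tr gt]|].
    split => //; rewrite lt_neqAle tr andbT; apply/eqP => tE.
    have [t0|t0] := leP 0 t.
      by move: gr; rewrite /= -tE ger0_norm// gt ltxx.
    by move: gNr; rewrite /= -tE ltr0_norm// opprK gt ltxx.
  have [|||t tr gt] := @IVT R (fun t : R => g (y + t *: e)) (- r) r 0.
  - by rewrite ge0_cp // ltW.
  - apply: derivable_within_continuous => t; rewrite in_itv /= => tr.
    have [] := is_derive_line (f := g) (x := y) (v := e) (t := t) _ => //.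
    apply: (Cn_derivable e (gS 1%N)); apply: (dP _ (inO _ _ By _)).1.
    by rewrite ler_norml.
  - by rewrite ge_min le_max (ltW gNr) (ltW gr) orbT.
  by move=> /(_ t) []; split => //; move: tr; rewrite in_itv /= ler_norml.
have thlt (y : E) (t : R) : O1 y -> `|t| <= r -> 0 < g (y + t *: e) -> th y < t.
  move=> O1y tr gt; have [thr th0] := thP y O1y; rewrite ltNge; apply/negP => tth.
  have := tth; rewrite le_eqVlt => /orP[/eqP tE|tlt].
    by move: gt; rewrite tE th0 ltxx.
  by have := mono y t (th y) O1y.1.1 tr (ltW thr) tlt; rewrite th0 ltNge (ltW gt).
have thgt (y : E) (t : R) : O1 y -> `|t| <= r -> g (y + t *: e) < 0 -> t < th y.
  move=> O1y tr gt; have [thr th0] := thP y O1y; rewrite ltNge; apply/negP => tth.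
  have := tth; rewrite le_eqVlt => /orP[/eqP tE|tlt].
    by move: gt; rewrite -tE th0 ltxx.
  by have := mono y (th y) t O1y.1.1 (ltW thr) tr tlt; rewrite th0 ltNge (ltW gt).
(* Since [g] is strictly increasing in the time, its signs at [th y + eta] and [th y - eta] persist
   for nearby [z] and trap [th z]. *)
have thc (y : E) : O1 y -> {for y, continuous th}.
  move=> O1y; have [thr th0] := thP y O1y.
  apply: continuous_near_lt => eps eps0.
  pose eta := Num.min eps ((r - `|th y|) / 2).
  have eta0 : 0 < eta by rewrite lt_min eps0 divr_gt0 ?subr_gt0.
  have etae : eta <= eps by rewrite ge_min lexx.
  have etar : eta <= (r - `|th y|) / 2 by rewrite ge_min lexx orbT.
  have r1 : `|th y + eta| <= r.
    by rewrite (le_trans (ler_normD _ _))// (gtr0_norm eta0); lra.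
  have r2 : `|th y - eta| <= r.
    by rewrite (le_trans (ler_normB _ _))// (gtr0_norm eta0); lra.
  have g1 : 0 < g (y + (th y + eta) *: e).
    by rewrite -th0; apply: (mono _ _ _ O1y.1.1) => //; [exact: ltW|rewrite ltrDl].
  have g2 : g (y + (th y - eta) *: e) < 0.
    by rewrite -[X in _ < X]th0; apply: (mono _ _ _ O1y.1.1) => //; [exact: ltW|rewrite gtrBl].
  near=> z.
  have O1z : O1 z by near: z; exact: open_nbhs_nbhs.
  have z1 : th z < th y + eta.
    apply: thlt => //; near: z.
    exact: (pos_continuous_near (cg _ r1 y O1y.1.1) g1).
  have z2 : th y - eta < th z.
    apply: thgt => //; near: z.
    exact: (neg_continuous_near (cg _ r2 y O1y.1.1) g2).
  rewrite distrC ltr_distl (le_lt_trans _ z2) ?lerD2l ?lerN2//.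
  by rewrite (lt_le_trans z1)// lerD2l.
have inO1 (y : E) (s : R) : O1 y -> s \in `[0, 1] -> `|p - (y + (s * th y) *: e)| < d.
  move=> O1y; rewrite in_itv /= => /andP[s0 s1]; apply: inO; first exact: O1y.1.1.
  by rewrite normrM (ger0_norm s0) (le_trans _ (ltW (thP y O1y).1))// ler_piMl.
have i1 : (1 : R) \in `[0, 1] by rewrite in_itv /= lexx ler01.
have inO1' (y : E) : O1 y -> O (y + th y *: e) /\ 0 < 'D_e g (y + th y *: e).
  by move=> O1y; apply: dP; have := inO1 y 1 O1y i1; rewrite mul1r.
have thd (y v : E) : O1 y -> is_derive y v th
    (- ('D_v g (y + th y *: e) / 'D_e g (y + th y *: e))).
  move=> O1y; have [Oy Dy] := inO1' y O1y.
  pose q (z : E) := - ('D_v g z / 'D_e g z).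
  have qc : {for y + th y *: e, continuous q}.
    apply: continuousN; apply: continuousM; last first.
      by apply: continuousV; [rewrite gt_eqF|exact: Dc].
    exact: (Cn_cont (Cn_derive v (gS 1%N))).
  suff dl : h^-1 *: ((th \o shift y) (h *: v) - th y) @[h --> 0^'] --> q (y + th y *: e).
    by apply: DeriveDef; [apply/cvg_ex; eexists; exact: dl|apply/cvg_lim].
  apply/cvgrPdist_le => eps eps0.
  have /cvgrPdist_le /(_ _ eps0) := qc.
  move=> /nbhs_ballP[d1 /= d10 d1P].
  have [d2 /= d20 d2P] : exists2 d2, 0 < d2 & forall z, `|y + th y *: e - z| < d2 ->
      [/\ O z, 0 < 'D_e g z & `|q (y + th y *: e) - q z| <= eps].
    have : \forall z \near (y + th y *: e), O z /\ 0 < 'D_e g z.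
      near=> z; split; near: z; first exact: open_nbhs_nbhs.
      exact: (pos_continuous_near (Dc _ Oy) Dy).
    move=> /nbhs_ballP[d2 /= d20 d2P]; exists (Num.min d1 d2); first by rewrite lt_min d10.
    move=> z; rewrite lt_min => /andP[z1 z2].
    have [] := d2P z; first by rewrite -ball_normE.
    by move=> Oz Dz; split => //; apply: d1P; rewrite -ball_normE.
  have nh : \forall h \near (0 : R), O1 (h *: v + y) /\
      `|h *: v + (th (h *: v + y) - th y) *: e| < d2.
    have c1 : {for 0, continuous (fun h : R => h *: v + y)}.
      by apply: continuousD; [apply: cvgZr_tmp; exact: cvg_id|exact: cvg_cst].
    have c1' : h *: v + y @[h --> (0 : R)] --> y.
      by have := c1; rewrite /prop_for /continuous_at scale0r add0r.
    have c2 : {for 0, continuous (fun h : R => h *: v + (th (h *: v + y) - th y) *: e)}.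
      apply: continuousD; first by apply: cvgZr_tmp; exact: cvg_id.
      apply: cvgZr_tmp; apply: cvgB; last exact: cvg_cst.
      apply: (continuous_comp (f := fun h : R => h *: v + y) c1).
      by rewrite scale0r add0r; exact: thc.
    near=> h; split.
      by near: h; apply: c1'; exact: open_nbhs_nbhs.
    near: h; move/cvgrPdist_lt : c2 => /(_ _ d20).
    by apply: filterS => h; rewrite !scale0r !add0r subrr scale0r sub0r normrN.
  near=> h.
  have h0 : h != 0 by near: h; exact: nbhs_dnbhs_neq.
  have [h1O dh] : O1 (h *: v + y) /\
      `|h *: v + (th (h *: v + y) - th y) *: e| < d2.
    by near: h; exact: nbhs_dnbhs.
  set D := th (h *: v + y) - th y in dh *.
  have seg (t : R) : t \in `[0, 1] -> [/\ O (y + th y *: e + t *: (h *: v + D *: e)),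
      0 < 'D_e g (y + th y *: e + t *: (h *: v + D *: e)) &
      `|q (y + th y *: e) - q (y + th y *: e + t *: (h *: v + D *: e))| <= eps].
    rewrite in_itv /= => /andP[t0 t1]; apply: d2P.
    rewrite opprD addrA subrr sub0r normrN normrZ (le_lt_trans _ dh)//.
    by rewrite ler_piMl// ger0_norm.
  (* Both endpoints lie on [g = 0], so the mean value theorem reads [0 = h 'D_v g + D 'D_e g] at an
     intermediate point: the quotient [D / h] is exactly a value of [q]. *)
  have [t t01|t t01 E0] := MVT_line (f := g) (x := y + th y *: e) (v := h *: v + D *: e) _.
    by have [Ot _ _] := seg t t01; exact: (Cn_derivable _ (gS 1%N)).
  have t01' : t \in `[0, 1] by apply: subset_itv_oo_cc.
  have [Ot Dt qt] := seg t t01'.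
  move: E0; rewrite (derive_lin h D v e oO Ot (gS 1%N)).
  rewrite (_ : y + th y *: e + (h *: v + D *: e) = h *: v + y + th (h *: v + y) *: e); last first.
    by rewrite /D scalerBl addrACA [_ *: e + (_ - _)]addrC subrK [y + _]addrC.
  rewrite (thP _ h1O).2 (thP _ O1y).2 subrr => E0.
  rewrite /= /GRing.scale /= -/D.
  rewrite (_ : h^-1 * D = q (y + th y *: e + t *: (h *: v + D *: e)))//.
  rewrite /q; have Dt0 := lt0r_neq0 Dt.
  apply: (mulfI h0); apply: (mulIf Dt0).
  rewrite mulVKf// -[RHS]mulrA mulNr divfK//.
  by apply/eqP; rewrite mulrN -addr_eq0 addrC -E0.
exists O1, th; split => //.
- by move=> y O1y; have := (dP y); case => //; rewrite (lt_trans O1y.1.1)// ltr_pdivrMr// ltr_pMr// ltrDl.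
(* Bootstrap: the derivative of [th] is a smooth expression in [th] itself. *)
- elim=> [|n IH]; first by split.
  split=> // v; split=> [y O1y|]; first by have [] := thd y v O1y.
  apply: (Cn_eq oO1 (f := fun y => - ('D_v g (y + th y *: e) / 'D_e g (y + th y *: e)))).
    by move=> y O1y; have [_ ->] := thd y v O1y.
  have lC : Cn n O1 (fun y => y + th y *: e).
    by apply: (CnD oO1); [exact: Cn_id|apply: (Cn_scale oO1 IH); exact: Cn_cst].
  apply: (CnN oO1); apply: (CnM oO1).
    apply: (Cn_comp_scalar (f := 'D_v g) oO1 oO _ lC); last exact: Cn_derive (gS n.+1).
    by move=> y /inO1'[].
  apply: (CnV oO1); first by move=> y /inO1'[_ /lt0r_neq0].
  apply: (Cn_comp_scalar (f := 'D_e g) oO1 oO _ lC); last exact: Cn_derive (gS n.+1).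
  by move=> y /inO1'[].
- move=> y O1y; split; first exact: (thP y O1y).2.
  by move=> s s01; apply: dP; exact: inO1.
Unshelve. all: by end_near. Qed.

End Division.

Section Division.
Context {R : realType} {m : nat}.
Local Notation E := 'rV[R]_m.

(** Hadamard's lemma along the lines of direction [e]: [f] and [g] vanish at the point where the
    line meets [g = 0], so each equals [- th y] times the integral of its [e]-derivative over the
    segment. The factor [th y] cancels in the quotient, and the integral for [g] is positive. *)
Lemma smooth_division_pos (O : set E) (g : E -> R) (p e : E) :
  open O -> smooth_on O g -> O p -> g p = 0 -> 0 < 'D_e g p ->
  exists U : set E, [/\ open U, U p, U `<=` O &
    forall f : E -> R, smooth_on O f -> (forall y, O y -> g y = 0 -> f y = 0) ->
    exists2 q, smooth_on U q & forall y, U y -> f y = g y * q y].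
Proof.
move=> oO gS Op gp gep.
have [U [th [oU Up UO thS thP]]] := implicit_function oO gS Op gp gep.
exists U; split=> // f fS f0.
pose L (x : R * E) : E := x.2 + (x.1 * th x.2) *: e.
have oP : open (snd @^-1` U : set (R * E)).
  by apply: open_comp => // x _; exact: cvg_snd.
have LC n : Cn n (snd @^-1` U) L.
  apply: (CnD oP); first exact: (@Cn_comp_snd R n R E E U (fun x : E => x) (Cn_id n U)).
  apply: (Cn_scale oP); last exact: Cn_cst.
  by apply: (CnM oP); [exact: Cn_fst|exact: (@Cn_comp_snd R n R E R U th (thS n))].
pose Om := (snd @^-1` U) `&` L @^-1` O.
have oOm : open Om.
  by apply: (open_setI_preimage oP oO) => x Px; exact: (Cn_cont (LC 0%N) Px).
have OmP (s : R) y : s \in `[0, 1] -> U y -> Om (s, y).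
  by move=> s01 Uy; split => //; exact: ((thP y Uy).2 s s01).1.
pose H k (x : R * E) : R := 'D_e k (L x).
pose I (k : E -> R) y := Int01 (fun s => H k (s, y)).
have HC k n : smooth_on O k -> Cn n Om (H k).
  move=> kS; apply: (Cn_comp_scalar (f := 'D_e k) oOm oO _ _ (Cn_derive e (kS n.+1))).
    by move=> x [].
  by apply: Cn_sub (LC n) => x [].
have IS k : smooth_on O k -> smooth_on U (I k).
  by move=> kS n; apply: (Cn_Int01 oU OmP); exact: HC.
have c01 k y : smooth_on O k -> U y -> continuous01 (fun s => H k (s, y)).
  move=> kS Uy; apply: continuous01_section => s s01.
  by apply: (Cn_cont (HC k 0%N kS)); exact: OmP.
have IE k y : smooth_on O k -> U y ->
    k (y + th y *: e) - k y = th y * I k y.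
  move=> kS Uy; rewrite -Int01Z; last exact: c01.
  rewrite (@Int01E _ _ (fun s => k (y + s *: (th y *: e)))).
    by rewrite scale1r scale0r addr0.
  move=> s s01; have [Os _] := (thP y Uy).2 s s01.
  have Os' : O (y + s *: (th y *: e)) by rewrite scalerA.
  have [d1 d2] := is_derive_scale_dir (th y) (Cn_derivable e (kS 1%N) Os').
  by have := is_derive_line d1; rewrite d2 scalerA.
have Ig y : U y -> 0 < I g y.
  move=> Uy; rewrite /I; have [s s01 ->] := Int01_mean (c01 g y gS Uy).
  exact: ((thP y Uy).2 s (subset_itv_oo_cc s01)).2.
exists (fun y => I f y / I g y).
  move=> n; apply: (CnM oU); first exact: IS.
  by apply: (CnV oU); [move=> y /Ig/lt0r_neq0|exact: IS].
move=> y Uy; have [gy yP] := thP y Uy.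
have i1 : (1 : R) \in `[0, 1] by rewrite in_itv /= lexx ler01.
have Oy : O (y + th y *: e) by have [] := yP 1 i1; rewrite mul1r.
have := IE f y fS Uy; rewrite (f0 _ Oy gy) sub0r => fE.
have := IE g y gS Uy; rewrite gy sub0r => gE.
rewrite -[f y]opprK -[g y]opprK fE gE; have := lt0r_neq0 (Ig y Uy) => Ig0.
by field.
Qed.

Lemma smooth_division (O : set E) (g : E -> R) (p e : E) :
  open O -> smooth_on O g -> O p -> g p = 0 -> 'D_e g p != 0 ->
  exists U : set E, [/\ open U, U p, U `<=` O &
    forall f : E -> R, smooth_on O f -> (forall y, O y -> g y = 0 -> f y = 0) ->
    exists2 q, smooth_on U q & forall y, U y -> f y = g y * q y].
Proof.
move=> oO gS Op gp; rewrite neq_lt => /orP[ge|]; last exact: smooth_division_pos.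
apply: (smooth_division_pos (e := - e)) => //.
have [_] := is_derive_scale_dir (- 1) (Cn_derivable e (gS 1%N) Op).
by rewrite scaleN1r => ->; rewrite /GRing.scale /= mulN1r oppr_gt0.
Qed.

(** In the scalar lemma [U] is quantified before [f], so all entries are divided on the same
    neighbourhood. *)
Lemma smooth_division_mx n k (O : set E) (g : E -> R) (p e : E) :
  open O -> smooth_on O g -> O p -> g p = 0 -> 'D_e g p != 0 ->
  exists U : set E, [/\ open U, U p, U `<=` O &
    forall f : E -> 'M[R]_(n, k), smooth_on O f -> (forall y, O y -> g y = 0 -> f y = 0) ->
    exists2 q, smooth_on U q & forall y, U y -> f y = g y *: q y].
Proof.
move=> oO gS Op gp ge; have [U [oU Up UO div]] := smooth_division oO gS Op gp ge.
exists U; split => // f fS f0.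
have /choice [q qP] : forall ij : 'I_n * 'I_k, exists q : E -> R, smooth_on U q /\
    forall y, U y -> f y ij.1 ij.2 = g y * q y.
  move=> [i j]; have [||q qS qE] := div (fun y => f y i j).
  - by move=> l; exact: Cn_entry.
  - by move=> y Oy gy; rewrite f0// mxE.
  by exists q.
exists (fun y => \matrix_(i, j) q (i, j) y).
  by move=> l; apply: (Cn_mx (f := fun y i j => q (i, j) y) oU) => i j; exact: (qP (i, j)).1.
by move=> y Uy; apply/matrixP => i j; rewrite !mxE; exact: (qP (i, j)).2.
Qed.

End Division.

(** * Smooth bump functions *)

Section BumpFunction.
Context {R : realType}.

(* [flat k x = x^-k exp(- 1 / x)] for [x > 0]: the family is closed under
   differentiation. *)
Definition flat (k : nat) (x : R) : R := if 0 < x then x ^- k * expR (- x^-1) else 0.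

Lemma flat_bound k x : 0 < x -> flat k x <= k.+1%:R ^+ k.+1 * x.
Proof.
move=> x0; rewrite /flat x0; set c : R := k.+1%:R; have c0 : 0 < c by rewrite ltr0n.
have cn0 := lt0r_neq0 c0; have xn0 := lt0r_neq0 x0.
(* From [exp (1/x) = exp (1/(c x)) ^ c] with [c = k + 1], and [exp u >= 1 + u]. The exponent exceeds
   [k] by one, which leaves the factor [x] in the bound. *)
have e1 : (x^-1 / c) ^+ k.+1 <= expR (x^-1).
  have -> : expR (x^-1) = expR (x^-1 / c) ^+ k.+1.
    by rewrite -expRM_natl; congr expR; rewrite -/c mulrCA divff// mulr1.
  apply: lerXn2r.
  - by rewrite nnegrE divr_ge0 ?invr_ge0 ?ltW.
  - by rewrite nnegrE expR_ge0.
  - by rewrite (le_trans _ (expR_ge1Dx _))// lerDr.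
rewrite expRN ler_pdivrMr ?expR_gt0// (le_trans _ (ler_wpM2l _ e1))//; last first.
  by rewrite mulr_ge0// ?exprn_ge0// ltW.
rewrite expr_div_n exprVn !exprS le_eqVlt; apply/orP; left; apply/eqP.
have := expf_neq0 k xn0; have := expf_neq0 k cn0.
move: (x ^+ k) (c ^+ k) => y d d0 y0.
by field; apply/and4P; split=> //; rewrite addrC natr1.
Qed.

Lemma flat_ge0 k x : 0 <= flat k x.
Proof.
rewrite /flat; case: ifP => // x0; rewrite mulr_ge0 ?expR_ge0// invr_ge0 exprn_ge0// ltW//.
Qed.

Lemma flat_le k x : `|flat k x| <= k.+1%:R ^+ k.+1 * `|x|.
Proof.
rewrite ger0_norm ?flat_ge0//; have [x0|x0] := ltP 0 x.
  by rewrite (gtr0_norm x0) flat_bound.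
by rewrite /flat ltNge x0 /= mulr_ge0// exprn_ge0.
Qed.

Lemma flat_cvg0 k : flat k x @[x --> (0 : R)] --> (0 : R).
Proof.
have c0 : 0 < (k.+1%:R : R) ^+ k.+1 by rewrite exprn_gt0// ltr0n.
apply/cvgrPdist_le => e e0; have ec : 0 < e / k.+1%:R ^+ k.+1 by rewrite divr_gt0.
near=> x; have xe : `|x| < e / k.+1%:R ^+ k.+1 by near: x; exact: (@nbhs0_lt R R _ ec).
by rewrite sub0r normrN (le_trans (flat_le k x))// mulrC -ler_pdivlMr// ltW.
Unshelve. all: by end_near. Qed.

Lemma flat_derive k (x : R) :
  is_derive x 1 (flat k) (- k%:R * flat k.+1 x + flat k.+2 x).
Proof.
have EX (f : R -> R) n y : (f ^+ n) y = f y ^+ n.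
  by elim: n => [|n IH]; rewrite ?expr0// !exprS -IH.
have [x0|x0|<-] := ltgtP 0 x.
- have xn0 := lt0r_neq0 x0.
  have dV := is_deriveV xn0 (is_derive_id x 1).
  have dN := is_deriveN dV.
  have dE := is_derive_chain1 dN (is_derive_expR _).
  have dX := @is_deriveX _ _ _ k x 1 _ dV.
  have := is_deriveM dX dE.
  rewrite /= => dM; apply: (@near_eq_is_derive _ _ _ _ (flat k) x 1 _ _ (is_derive_eq dM _)).
    near=> y; have y0 : 0 < y by near: y; exact: (lt_nbhsr x0).
    by rewrite /flat y0 -[LHS]/(([eta GRing.inv] ^+ k) y * expR (- y^-1)) EX exprVn.
  rewrite /flat x0 !EX /GRing.scale /= !exprVn !mulr1 -[(- [eta GRing.inv]) x]/(- x^-1).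
  move: (expR _) => w; case: k {dX dM} => [|k] /=.
    by rewrite expr0 mulr0n; field.
  rewrite !exprS; have := expf_neq0 k xn0; move: (x ^+ k) => y y0.
  by field; apply/andP.
- apply: (@near_eq_is_derive _ _ _ (cst 0)).
    near=> y; have y0 : y < 0 by near: y; exact: (lt_nbhsl x0).
    by rewrite /flat ltNge (ltW y0).
  by rewrite /flat ltNge (ltW x0) /= mulr0 addr0; exact: is_derive_cst.
have -> : - k%:R * flat k.+1 0 + flat k.+2 0 = 0 :> R by rewrite /flat ltxx mulr0 addr0.
suff dl : h^-1 *: ((flat k \o shift 0) (h *: 1) - flat k 0) @[h --> (0 : R)^'] --> (0 : R).
  by apply: DeriveDef; [apply/cvg_ex; eexists; exact: dl|apply/cvg_lim].
have fE (h : R) : h^-1 *: ((flat k \o shift 0) (h *: 1) - flat k 0) = flat k.+1 h.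
  rewrite /= addr0 [h *: 1]mulr1 /flat ltxx subr0; case: ifP => [h0|_]; last exact: scaler0.
  by rewrite /GRing.scale /= mulrA exprS invfM.
rewrite (_ : (fun h => _) = flat k.+1); last by apply/funext.
exact: cvg_within_filter (flat_cvg0 k.+1).
Unshelve. all: by end_near. Qed.

Lemma Cn_flat n k : Cn n setT (flat k).
Proof.
elim: n k => [|n IH] k.
  split=> // x _; have [/derivable1_diffP ? _] := flat_derive k x.
  exact: differentiable_continuous.
apply: (Cn_antiderivative openT (fun x _ => flat_derive k x)).
by apply: (CnD openT); [apply: (CnM openT); [exact: Cn_cst|exact: IH]|exact: IH].
Qed.

(** The Euclidean square is used because it is smooth, unlike the sup norm; the Euclidean ball of
    radius [r] lies in the sup-norm ball. *)
Lemma bump_exists m (p : 'rV[R]_m) (r : R) : 0 < r ->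
  exists b : 'rV[R]_m -> R, [/\ smooth_on setT b, b p != 0 &
    forall y, b y != 0 -> `|y - p| < r].
Proof.
move=> r0; pose N (y : 'rV[R]_m) := r ^+ 2 - \sum_i (y 0 i - p 0 i) * (y 0 i - p 0 i).
exists (fun y => flat 0 (N y)); split.
- move=> n; apply: (Cn_comp1 openT openT _ _ (Cn_flat n 0)) => //.
  apply: (CnB openT); first exact: Cn_cst.
  apply: (Cn_sum _ openT) => i _.
  have h : Cn n setT (fun y : 'rV[R]_m => y 0 i - p 0 i).
    by apply: (CnB openT); [exact: (Cn_entry _ _ openT (Cn_id n setT))|exact: Cn_cst].
  exact: (CnM openT).
- rewrite /flat /N big1 ?subr0 ?exprn_gt0//; last by move=> i _; rewrite subrr mulr0.
  by rewrite expr0 invr1 mul1r gt_eqF// expR_gt0.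
- move=> y; rewrite /flat; case: ifP => [Ny _|]; last by rewrite eqxx.
  have cl i : `|y 0 i - p 0 i| < r.
    rewrite -(ltr_pXn2r (n := 2))// ?nnegrE ?ltW// real_normK ?num_real//.
    move: Ny; rewrite subr_gt0; apply: le_lt_trans; rewrite (bigD1 i)//= expr2 lerDl.
    by apply: sumr_ge0 => j _; rewrite -expr2 sqr_ge0.
  rewrite [ltLHS]/Num.Def.normr/= mx_normrE; apply/bigmax_ltP; split => // -[i j] _ /=.
  by rewrite ord1 !mxE; exact: cl.
Qed.

End BumpFunction.

(** * A singular differential equation *)

Section WeightedAverage.
Context {R : realType}.
Implicit Types (f : R -> R) (e : R) (b : bool).

(** For [t > 0], in the variable [u = s^2 t], this is [t^(-1 - b/2)] times the integral of
    [u^(b/2) f u] from 0 to [t]. The variable [s] makes the weight polynomial for both values of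
    [b], and the formula meaningful and smooth across [t = 0]. *)
Definition average b f (t : R) : R := Int01 (fun s => 2 * s ^+ b.+1 * f (s ^+ 2 * t)).

Lemma scaled_in_itv e (s t : R) : s \in `[0, 1] -> t \in `]-e, e[ -> s ^+ 2 * t \in `]-e, e[.
Proof.
rewrite !in_itv /= -!ltr_norml => /andP[s0 s1] te; rewrite (le_lt_trans _ te)// normrM.
by rewrite ler_piMl// normrX ger0_norm// exprn_ile1.
Qed.

Lemma is_derive_pow n (s : R) : is_derive s 1 (fun s : R => s ^+ n) (n%:R * s ^+ n.-1).
Proof.
have h := @is_deriveX R R id n s 1 1 (is_derive_id s 1).
have E : (@id R) ^+ n = (fun s : R => s ^+ n).
  by apply/funext => x; elim: n {h} => [|n IH]; rewrite ?expr0// !exprS -IH.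
by rewrite E in h; apply: (is_derive_eq h); rewrite /GRing.scale /= mulr1.
Qed.

Lemma Cn_pow n k (A : set R) : open A -> Cn k A (fun s : R => s ^+ n).
Proof.
move=> oA; elim: n => [|n IH].
  by apply: (Cn_eq oA (f := fun _ : R => (1 : R))); [move=> x _; rewrite expr0|exact: Cn_cst].
apply: (Cn_eq oA (f := fun x : R => x * x ^+ n)); first by move=> x _; rewrite exprS.
by apply: (CnM oA) => //; exact: Cn_id.
Qed.

Section AverageRegularity.
Variables (b : bool) (e : R).

Let P : set (R * R) := snd @^-1` (`]-e, e[%classic : set R).
Let L (x : R * R) : R := x.1 ^+ 2 * x.2.
Let Om := P `&` L @^-1` (`]-e, e[%classic : set R).
Let oI : open (`]-e, e[%classic : set R). Proof. exact: interval_open. Qed.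

Let oP : open P. Proof. by apply: open_comp => // x _; exact: cvg_snd. Qed.

Let powC n k (A : set (R * R)) : open A -> Cn n A (fun x => x.1 ^+ k).
Proof.
move=> oA; apply: (@Cn_comp1 R _ n A setT (fun s => s ^+ k) (fun x : R * R => x.1) oA openT) => //.
  exact: Cn_fst.
exact: Cn_pow openT.
Qed.

Let LC n : Cn n P L.
Proof.
apply: (CnM oP); first exact: powC.
exact: (@Cn_comp_snd R n R R R (`]-e, e[%classic) (fun x : R => x) (Cn_id n _)).
Qed.

Let oOm : open Om.
Proof. by apply: (open_setI_preimage oP oI) => x Px; exact: (Cn_cont (LC 0%N) Px). Qed.

Let HC f n : Cn n `]-e, e[%classic f ->
  Cn n Om (fun x : R * R => 2 * x.1 ^+ b.+1 * f (x.1 ^+ 2 * x.2)).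
Proof.
move=> fC; apply: (CnM oOm); first by apply: (CnM oOm); [exact: Cn_cst|exact: powC].
by apply: (@Cn_comp1 R _ n Om _ f L oOm oI) => //; [move=> x []|apply: Cn_sub (LC n) => x []].
Qed.

Let OmP (s t : R) : s \in `[0, 1] -> (`]-e, e[%classic : set R) t -> Om (s, t).
Proof. by move=> s01 te; split => //; exact: scaled_in_itv. Qed.

Lemma Cn_average f n : Cn n `]-e, e[%classic f -> Cn n `]-e, e[%classic (average b f).
Proof. by move=> fC; exact: (Cn_Int01 oI OmP (HC fC)). Qed.

Lemma average_continuous01 f t : Cn 0 `]-e, e[%classic f -> t \in `]-e, e[ ->
  continuous01 (fun s => 2 * s ^+ b.+1 * f (s ^+ 2 * t)).
Proof.
move=> fC te.
apply: (@continuous01_section _ _ (fun x : R * R => 2 * x.1 ^+ b.+1 * f (x.1 ^+ 2 * x.2))).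
by move=> s s01; apply: (Cn_cont (HC fC)); exact: OmP.
Qed.

Lemma averageB f g t : Cn 0 `]-e, e[%classic f -> Cn 0 `]-e, e[%classic g ->
  t \in `]-e, e[ -> average b f t - average b g t = average b (fun t => f t - g t) t.
Proof.
move=> fC gC te; rewrite /average -Int01B; [|exact: average_continuous01..].
congr Int01; apply/funext => s; ring.
Qed.

Lemma average_norm f t c : Cn 0 `]-e, e[%classic f -> t \in `]-e, e[ ->
  (forall t, t \in `]-e, e[ -> `|f t| <= c) -> `|average b f t| <= 2 * c.
Proof.
move=> fC te fc; apply: Int01_norm; first exact: average_continuous01.
move=> s s01; have := fc _ (scaled_in_itv s01 te) => h.
rewrite -mulrA normrM ger0_norm// ler_wpM2l// normrM (le_trans _ h)// ler_piMl//.
by move: s01; rewrite in_itv /= => /andP[s0 s1]; rewrite normrX ger0_norm// exprn_ile1.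
Qed.

(* For [b = true] and [t > 0] this is the substitution [u = s^2 t], which gives
   [t^(3/2) average f t = \int_0^t u^(1/2) f u du]. *)
Lemma is_derive_average_pos f t : Cn 0 `]-e, e[%classic f -> t \in `]-e, e[ -> 0 < t ->
  is_derive t 1 (fun t => t * average b f t) (f t - b%:R / 2 * average b f t).
Proof.
move=> fC te t0.
(* [w t = t^(b/2)] treats the plain and the weighted mean together. *)
pose w (t : R) : R := if b then Num.sqrt t else 1.
pose dw (t : R) : R := if b then (2 * Num.sqrt t)^-1 else 0.
have wc : continuous w.
  by rewrite /w; case: (b) => x; [exact: sqrt_continuous|exact: cvg_cst].
have w0 (x : R) : 0 < x -> 0 < w x by rewrite /w; case: (b) => x0 //; rewrite sqrtr_gt0.
have wd (x : R) : 0 < x -> is_derive x 1 w (dw x).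
  by rewrite /w /dw; case: (b) => x0; [exact: is_derive1_sqrt|exact: is_derive_cst].
have wE (s x : R) : 0 <= s -> 0 <= x -> w (s ^+ 2 * x) = s ^+ b * w x.
  rewrite /w; case: (b) => s0 x0; last by rewrite expr0 mul1r.
  by rewrite sqrtrM ?sqr_ge0// sqrtr_sqr ger0_norm// expr1.
have dwE (x : R) : 0 < x -> dw x = b%:R / 2 * (w x / x).
  rewrite /w /dw; case: (b) => x0; last by rewrite mul0r mul0r.
  have sx : 0 < Num.sqrt x by rewrite sqrtr_gt0.
  have sn0 := lt0r_neq0 sx.
  by move: sn0 (sqr_sqrtr (ltW x0)); move: (Num.sqrt x) => y yn0 <- /=; field.
have ee : - e < e by move: te; rewrite in_itv /= => /andP[]; exact: lt_trans.
have [Ps PsP] : exists F, forall x, x \in `]-e, e[ -> is_derive x 1 F (w x * f x).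
  apply: (antiderivative_exists (f := fun x => w x * f x) ee) => x xe.
  by apply: continuousM; [exact: wc|exact: (Cn_cont fC)].
have avE (x : R) : 0 < x -> x \in `]-e, e[ -> x * average b f x = (Ps x - Ps 0) * (w x)^-1.
  move=> x0 xe; have wx0 := lt0r_neq0 (w0 x x0).
  apply: (mulIf wx0); rewrite divfK// [average b f x]/Int01 -/(Int01 _) /average.
  rewrite mulrC mulrA -(Int01Z (w x * x)); last exact: average_continuous01.
  rewrite (@Int01E _ _ (fun s : R => Ps (s ^+ 2 * x))); last first.
    move=> s s01; have sx : is_derive s 1 (fun s : R => s ^+ 2 * x) (2 * s * x).
      have := is_deriveM (is_derive_pow 2 s) (is_derive_cst x s 1).
      by move=> h; apply: (is_derive_eq h); rewrite /GRing.scale /cst /= expr1; ring.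
    have := is_derive_chain1 sx (PsP _ (scaled_in_itv s01 xe)).
    move=> h; apply: (is_derive_eq h); rewrite /GRing.scale /= wE ?(ltW x0)//; last first.
      by move: s01; rewrite in_itv /= => /andP[].
    by rewrite [s ^+ b.+1]exprS; ring.
  by rewrite expr1n mul1r expr0n mul0r.
have d1 := is_deriveB (PsP t te) (is_derive_cst (Ps 0) t 1).
have d2 := is_deriveV (lt0r_neq0 (w0 t t0)) (wd t t0).
have d3 := is_deriveM d1 d2.
apply: (@near_eq_is_derive _ _ _ (fun x => (Ps x - Ps 0) * (w x)^-1) _ t 1 _ _ (is_derive_eq d3 _)).
  near=> x; apply/esym/avE; near: x; first exact: (lt_nbhsr t0).
  exact: near_in_itvoo.
have tn0 := lt0r_neq0 t0; have wn0 := lt0r_neq0 (w0 t t0).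
rewrite /GRing.scale /= fctE /= /cst dwE//.
have := avE t t0 te; move: (Ps t - Ps 0) (w t) wn0 => D v v0 h.
have -> : average b f t = D / v / t by rewrite -h mulrAC divff// mul1r.
by field; rewrite tn0.
Unshelve. all: by end_near. Qed.

(** At 0 the difference quotient of [t * average b f t] is [average b f t], so this is the
    differential equation there: the weight has mass [2 / (b + 2)], and
    [2 / (b + 2) * (1 + b / 2) = 1]. *)
Lemma average0 f : Cn 0 `]-e, e[%classic f -> 0 < e ->
  average b f 0 = f 0 - b%:R / 2 * average b f 0.
Proof.
move=> fC e0; have -> : average b f 0 = 2 / (b.+2)%:R * f 0.
  rewrite /average (@Int01E _ _ (fun s : R => 2 / (b.+2)%:R * f 0 * s ^+ b.+2)).
    by rewrite expr1n expr0n /= mulr0 mulr1 subr0.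
  move=> s s01; apply: (is_derive_eq (is_deriveZ _ (is_derive_pow b.+2 s))).
  rewrite mulr0 /GRing.scale /=; have : (b.+2)%:R != 0 :> R by rewrite pnatr_eq0.
  by move: (b.+2%:R) => N N0; field.
by case: (b) => /=; field.
Qed.

End AverageRegularity.

Lemma average_opp b f t : average b (fun t => f (- t)) t = average b f (- t).
Proof. by rewrite /average; congr Int01; apply/funext => s; rewrite mulrN. Qed.

(** Negative [t] reduces to positive [t] because averaging commutes with the reflection [t |-> - t];
    [t = 0] is [average0]. *)
Lemma is_derive_average b f e t : Cn 0 `]-e, e[%classic f -> t \in `]-e, e[ ->
  is_derive t 1 (fun t => t * average b f t) (f t - b%:R / 2 * average b f t).
Proof.
move=> fC te; have e0 : 0 < e.
  by move: te; rewrite in_itv /= => /andP[te0 te1]; lra.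
have [t0|t0|t0] := ltgtP 0 t; first exact: is_derive_average_pos te t0.
  have te' : - t \in `]-e, e[ by move: te; rewrite !in_itv /= ltrN2 ltrNl andbC.
  have fC' : Cn 0 `]-e, e[%classic (fun t => f (- t)).
    have oI : open (`]-e, e[%classic : set R) by exact: interval_open.
    apply: (@Cn_comp1 R R 0 `]-e, e[%classic `]-e, e[%classic f (fun x : R => - x) oI oI).
    - by move=> x; rewrite /= !in_itv /= ltrN2 ltrNl andbC.
    - exact: (CnN oI (Cn_id 0 _)).
    - exact: fC.
  have t0' : 0 < - t by rewrite oppr_gt0.
  have h := is_derive_average_pos b fC' te' t0'.
  have h2 := is_deriveN (is_derive_chain1 (is_deriveNid t 1) h).
  rewrite (_ : - (_ \o _) = fun t => t * average b f t) in h2.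
    apply: (is_derive_eq h2).
    by rewrite /GRing.scale /= average_opp !opprK; ring.
  by apply/funext => x; rewrite /= fctE /= average_opp opprK mulNr opprK.
subst t.
have gc : {for (0 : R), continuous (average b f)}.
  exact: (Cn_cont (Cn_average b fC) te).
rewrite -(average0 b fC e0).
suff dl : h^-1 *: (((fun t => t * average b f t) \o shift 0) (h *: 1) - 0 * average b f 0)
    @[h --> (0 : R)^'] --> average b f 0.
  by apply: DeriveDef; [apply/cvg_ex; eexists; exact: dl|apply/cvg_lim].
have gc' : average b f x @[x --> (0 : R)^'] --> average b f 0 by exact: cvg_within_filter gc.
apply: cvg_trans gc'; apply: near_eq_cvg; near=> h.
have h0 : h != 0 by near: h; exact: nbhs_dnbhs_neq.
by rewrite /= addr0 [h *: 1]mulr1 mul0r subr0 /GRing.scale /= mulKf.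
Unshelve. all: by end_near. Qed.

(** The derivative involves only [f] and its average, both of class [C^n]: one derivative is gained,
    which will make fixed points of the integral operator smooth. *)
Lemma Cn_t_average b f e n : Cn n `]-e, e[%classic f ->
  Cn n.+1 `]-e, e[%classic (fun t => t * average b f t).
Proof.
move=> fC; have oI : open (`]-e, e[%classic : set R) by exact: interval_open.
apply: (Cn_antiderivative oI (f := fun t => f t - b%:R / 2 * average b f t)).
  by move=> t te; apply: (@is_derive_average b f e) => //; exact: Cn_leq fC.
apply: (CnB oI fC); apply: (CnM oI); first exact: Cn_cst.
exact: Cn_average.
Qed.

End WeightedAverage.

Section LocallyLipschitz.
Context {R : realType} {d k : nat}.
Local Notation E := 'rV[R]_d.

Lemma locally_lipschitz (A : set E) (F : E -> 'rV[R]_k) (z0 : E) :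
  open A -> A z0 -> Cn 1 A F -> exists r L K : R, [/\ 0 < r, 0 <= L, 0 <= K &
    forall z, `|z - z0| <= r -> [/\ A z, `|F z| <= K &
      forall w, `|w - z0| <= r -> `|F z - F w| <= L * `|z - w|]].
Proof.
move=> oA Az0 FC.
have near1 (g : E -> 'rV[R]_k) : {for z0, continuous g} ->
    \forall z \near z0, `|g z0 - g z| <= 1.
  by move=> /cvgrPdist_le; exact.
have [r0 /= r00 rP] : exists2 r0, 0 < r0 & forall z, `|z0 - z| < r0 ->
    [/\ A z, `|F z0 - F z| <= 1 &
      forall i, `|'D_(delta_mx 0 i) F z0 - 'D_(delta_mx 0 i) F z| <= 1].
  have : \forall z \near z0, [/\ A z, `|F z0 - F z| <= 1 &
      forall i, `|'D_(delta_mx 0 i) F z0 - 'D_(delta_mx 0 i) F z| <= 1].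
    near=> z; split; near: z; first exact: open_nbhs_nbhs.
      exact: (near1 F (Cn_cont FC Az0)).
    apply: filter_forall => i; apply: (near1 ('D_(delta_mx 0 i) F)).
    exact: (Cn_cont (Cn_derive (delta_mx 0 i) FC)).
  by move=> /nbhs_ballP[r0 /= r00 rP]; exists r0 => // z zr; apply: rP; rewrite -ball_normE.
(* Near [z0] each partial derivative is bounded by its norm at [z0] plus 1; in the sup norm the sum
   of these bounds is a Lipschitz constant. *)
pose C : R := \sum_i (`|'D_(delta_mx 0 i) F z0| + 1).
have C0 : 0 <= C by apply: sumr_ge0 => i _; rewrite addr_ge0.
have lt_r0 z : `|z - z0| <= r0 / 2 -> `|z0 - z| < r0.
  by rewrite distrC => /le_lt_trans -> //; rewrite ltr_pdivrMr// ltr_pMr// ltrDl.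
exists (r0 / 2), C, (`|F z0| + 1); split; rewrite ?divr_gt0 ?addr_ge0// => z zr.
have [Az Fz _] := rP z (lt_r0 z zr); split => //.
  rewrite -[F z](subrK (F z0)) addrC (le_trans (ler_normD _ _))// lerD2l distrC//.
move=> w wr; apply: mx_norm_le => [|i j]; first by rewrite mulr_ge0.
rewrite ord1.
have seg (t : R) : t \in `[0, 1] -> `|z0 - (w + t *: (z - w))| < r0.
  rewrite in_itv /= => /andP[t0 t1]; apply: lt_r0.
  rewrite (_ : _ - z0 = (1 - t) *: (w - z0) + t *: (z - z0)); last first.
    by apply/rowP => l; rewrite !mxE; ring.
  rewrite (le_trans (ler_normD _ _))// !normrZ (ger0_norm t0) ger0_norm ?subr_ge0//.
  rewrite [X in _ <= X](_ : _ = (1 - t) * (r0 / 2) + t * (r0 / 2)); last by ring.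
  by apply: lerD; apply: ler_wpM2l => //; rewrite subr_ge0.
have fC : Cn 1 A (fun z => F z 0 j) by exact: Cn_entry.
have [t t01|t t01] := MVT_line (f := fun z => F z 0 j) (x := w) (v := z - w) _.
  by apply: (Cn_derivable _ fC); have [] := rP _ (seg t t01).
have [At _ Dt] := rP _ (seg t (subset_itv_oo_cc t01)).
rewrite [w + (z - w)]addrC subrK => E0.
have -> : (F z - F w) 0 j = F z 0 j - F w 0 j by rewrite !mxE.
rewrite E0 (derive_dirE_scalar _ oA At fC) (le_trans (ler_norm_sum _ _ _))//.
rewrite mulrC /C mulr_sumr; apply: ler_sum => l _; rewrite normrM ler_pM//.
  exact: (mx_norm_coord (z - w) 0 l).
rewrite -derive_mxE; last exact: (Cn_derivable _ FC).
rewrite (le_trans (mx_norm_coord _ 0 j))//.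
rewrite -['D__ F (w + _)](subrK ('D_(delta_mx 0 l) F z0)) addrC (le_trans (ler_normD _ _))//.
by rewrite lerD2l distrC.
Unshelve. all: by end_near. Qed.

End LocallyLipschitz.

Section GeometricLimit.
Context {R : realType}.

(** [u n - 2 C / 2^n] increases, [u n + 2 C / 2^n] decreases, and the first stays below the second:
    the supremum of the first is the limit, with its rate. *)
Lemma geometric_limit (u : nat -> R) (C : R) :
  (forall n, `|u n.+1 - u n| <= C * 2^-1 ^+ n) ->
  exists l, forall n, `|l - u n| <= 2 * C * 2^-1 ^+ n.
Proof.
move=> uC; have C0 : 0 <= C.
  by have := uC 0%N; rewrite expr0 mulr1; apply: le_trans.
pose v n := u n - 2 * C * 2^-1 ^+ n; pose w n := u n + 2 * C * 2^-1 ^+ n.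
have p0 n : 0 <= (2^-1 : R) ^+ n by rewrite exprn_ge0// invr_ge0.
have vS n : v n <= v n.+1.
  have := uC n; rewrite ler_norml /v exprS => /andP[h _].
  by move: h; move: (2^-1 ^+ n) => q h; lra.
have wS n : w n.+1 <= w n.
  have := uC n; rewrite ler_norml /w exprS => /andP[_ h].
  by move: h; move: (2^-1 ^+ n) => q h; lra.
have vm n j : v n <= v (j + n)%N.
  by elim: j => // j IH; rewrite addSn (le_trans IH).
have wm n j : w (j + n)%N <= w n.
  by elim: j => // j IH; rewrite addSn (le_trans _ IH).
have vw n j : v n <= w j.
  apply: (@le_trans _ _ (v (j + n)%N)) => //; apply: (@le_trans _ _ (w (j + n)%N)).
    by rewrite /v /w lerD2l; have := mulr_ge0 C0 (p0 (j + n)%N) => h; lra.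
  by rewrite addnC.
have hs : has_sup (range v).
  by split; [exists (v 0%N), 0%N|exists (w 0%N) => _ [n _ <-]].
exists (sup (range v)) => n.
have h1 : v n <= sup (range v) by apply: ub_le_sup; [exact: hs.2|exists n].
have h2 : sup (range v) <= w n by apply: ge_sup; [exact: hs.1|move=> _ [j _ <-]].
by move: h1 h2; rewrite ler_distl /v /w => -> ->.
Qed.

Lemma le0_of_geometric (x C : R) : (forall n : nat, x <= C * 2^-1 ^+ n) -> x <= 0.
Proof.
move=> xC; rewrite leNgt; apply/negP => x0.
have C0 : 0 < C by have := xC 0%N; rewrite expr0 mulr1; exact: lt_le_trans.
have h : `|2^-1 : R| < 1 by rewrite gtr0_norm ?invr_gt0// invf_lt1// ltrDl.
have /cvgrPdist_lt /(_ _ x0) := @cvg_geometric R C (2^-1) h.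
move=> [n _ /(_ n (leqnn n))] /=.
rewrite sub0r normrN /geometric /= ger0_norm; last first.
  by rewrite mulr_ge0 ?ltW// exprn_gt0// invr_gt0.
by rewrite ltNge xC.
Qed.

End GeometricLimit.

Lemma Cn_row {R : realType} (V : normedModType R) p n (A : set V) (f : V -> 'I_p -> R) :
  open A -> (forall i, Cn n A (fun x => f x i)) -> Cn n A (fun x => \row_i f x i).
Proof.
move=> oA fC; apply/(Cn_mxP _ _ oA) => i j.
by apply: (Cn_eq oA); last exact: (fC j); move=> x _; rewrite mxE.
Qed.

Section SingularODE.
Context {R : realType} {d : nat}.
Local Notation E := 'rV[R]_d.

(* The singular equation [z' = F z - (1/2t) Pi (z - z0)], where [Pi] is the
   coordinate projection given by [b], is turned into a fixed-point equation:
   the solution of [t u' + (1/2) u = t f] which is bounded at [0] is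
   [t * average true f]. *)
Theorem singular_ode (A : set E) (F : E -> E) (z0 : E) (b : 'I_d -> bool) :
  open A -> A z0 -> smooth_on A F ->
  exists (e : R) (z : R -> E), [/\ 0 < e, z 0 = z0, smooth_on `]-e, e[%classic z,
    forall t, t \in `]-e, e[ -> A (z t) &
    forall t, t \in `]-e, e[ -> t != 0 ->
      is_derive t 1 z (F (z t) - \row_i ((b i)%:R / 2 * ((z t 0 i - z0 0 i) / t)))].
Proof.
move=> oA Az0 FS.
have [r [L [K [r0 L0 K0 rP]]]] := locally_lipschitz oA Az0 (FS 1%N).
(* The factor 2 is the one in [average_norm]. The first condition keeps the iterates in the ball of
   radius [r], the second makes the operator a contraction of ratio 1/2. *)
have [e [e0 eK eL]] : exists e : R, [/\ 0 < e, e * (2 * K) <= r & e * (2 * L) <= 2^-1].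
  have K1 : 0 < 2 * K + 1 by rewrite ltr_wpDl// mulr_ge0.
  have L1 : 0 < 4 * L + 1 by rewrite ltr_wpDl// mulr_ge0.
  exists (Num.min (r / (2 * K + 1)) (4 * L + 1)^-1); split.
  - by rewrite lt_min divr_gt0// invr_gt0.
  - apply: (@le_trans _ _ (r / (2 * K + 1) * (2 * K))).
      by rewrite ler_wpM2r ?mulr_ge0// ge_min lexx.
    by rewrite mulrAC ler_pdivrMr// ler_pM2l// lerDl.
  - apply: (@le_trans _ _ ((4 * L + 1)^-1 * (2 * L))).
      by rewrite ler_wpM2r ?mulr_ge0// ge_min lexx orbT.
    by rewrite mulrC ler_pdivrMr//; lra.
pose I : set R := `]-e, e[%classic.
have oI : open I by exact: interval_open.
pose good (z : R -> E) := Cn 0 I z /\ forall t, t \in `]-e, e[ -> `|z t - z0| <= r.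
pose T (z : R -> E) : R -> E :=
  fun t => \row_i (z0 0 i + t * average (b i) (fun s => F (z s) 0 i) t).
have FzC n (z : R -> E) i : (forall t, t \in `]-e, e[ -> `|z t - z0| <= r) ->
    Cn n I z -> Cn n I (fun t => F (z t) 0 i).
  move=> zr zC; apply: (Cn_comp_scalar (f := fun y => F y 0 i) oI oA _ zC).
    by move=> t /zr /rP[].
  exact: (Cn_entry 0 i oA (FS n)).
have TC n (z : R -> E) : (forall t, t \in `]-e, e[ -> `|z t - z0| <= r) ->
    Cn n I z -> Cn n.+1 I (T z).
  move=> zr zC; apply: (Cn_row (f := fun (t : R) i =>
    z0 0 i + t * average (b i) (fun s => F (z s) 0 i) t) oI) => i.
  by apply: (CnD oI); [exact: Cn_cst|apply: Cn_t_average; exact: FzC].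
have tle t (x c : R) : t \in `]-e, e[ -> `|x| <= c -> `|t * x| <= e * c.
  by rewrite in_itv /= -ltr_norml => te xc; rewrite normrM ler_pM// ltW.
have Tgood z : good z -> good (T z).
  move=> [zC zr]; split; first exact: CnW (TC 0%N z zr zC).
  move=> t te; apply: mx_norm_le => [|i j]; first exact: ltW.
  rewrite ord1 !mxE addrAC subrr add0r (le_trans _ eK)//; apply: tle => //.
  apply: (@average_norm _ (b j) e) => //; first exact: FzC.
  move=> s se; rewrite (le_trans (mx_norm_coord _ 0 j))//.
  by have [] := rP _ (zr s se).
have Tdist z w c : good z -> good w ->
    (forall t, t \in `]-e, e[ -> `|z t - w t| <= c) ->
    forall t, t \in `]-e, e[ -> `|T z t - T w t| <= c / 2.
  move=> [zC zr] [wC wr] zwc t te.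
  have c0 : 0 <= c by exact: le_trans (zwc t te).
  apply: mx_norm_le => [|i j]; first by rewrite divr_ge0.
  rewrite ord1 !mxE opprD addrACA subrr add0r -mulrBr.
  rewrite (@averageB _ _ e _ _ t (FzC 0%N z j zr zC) (FzC 0%N w j wr wC) te).
  have aC : Cn 0 I (fun t => F (z t) 0 j - F (w t) 0 j) by apply: (CnB oI); exact: FzC.
  apply: (@le_trans _ _ (e * (2 * (L * c)))); last first.
    by rewrite [2 * _]mulrA mulrA [c / 2]mulrC ler_wpM2r.
  apply: tle => //; apply: (@average_norm _ (b j) e) => // s se.
  have -> : F (z s) 0 j - F (w s) 0 j = (F (z s) - F (w s)) 0 j by rewrite !mxE.
  rewrite (le_trans (mx_norm_coord _ 0 j))//.
  have [_ _ h] := rP _ (zr s se).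
  by rewrite (le_trans (h _ (wr s se)))// ler_wpM2l// zwc.
pose Z n := iter n T (fun=> z0).
have Zgood n : good (Z n).
  elim: n => [|n IH]; last exact: Tgood.
  by split; [exact: Cn_cst|move=> t _; rewrite subrr normr0 ltW].
have Zd n t : t \in `]-e, e[ -> `|Z n.+1 t - Z n t| <= r * 2^-1 ^+ n.
  elim: n t => [|n IH] t te.
    by rewrite expr0 mulr1; exact: (Zgood 1%N).2.
  by rewrite exprSr mulrA; exact: (Tdist _ _ _ (Zgood n.+1) (Zgood n) IH).
have /choice [z zP] : forall t, exists zt : E, t \in `]-e, e[ ->
    forall n, `|zt - Z n t| <= 2 * r * 2^-1 ^+ n.
  move=> t; have [te|te] := boolP (t \in `]-e, e[); last by exists 0.
  have /choice [l lP] : forall j : 'I_d, exists l, forall n,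
      `|l - Z n t 0 j| <= 2 * r * 2^-1 ^+ n.
    move=> j; apply: geometric_limit => n.
    rewrite (_ : _ - _ = (Z n.+1 t - Z n t) 0 j); last by rewrite !mxE.
    by rewrite (le_trans (mx_norm_coord _ 0 j))// Zd.
  exists (\row_j l j) => _ n; apply: mx_norm_le => [|i j].
    by rewrite !mulr_ge0 ?exprn_ge0 ?invr_ge0// ltW.
  by rewrite ord1 !mxE; exact: lP.
have zr t : t \in `]-e, e[ -> `|z t - z0| <= r.
  move=> te; rewrite -subr_le0; apply: (@le0_of_geometric _ _ (2 * r)) => n.
  rewrite lerBlDr; apply: (le_trans _ (lerD (zP t te n) ((Zgood n).2 t te))).
  by rewrite (le_trans _ (ler_normD _ _))// addrA subrK.
have zC : Cn 0 I z.
  split => // t te; apply/cvgrPdist_le => eps eps0.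
  have [n nP] : exists n, 2 * r * 2^-1 ^+ n <= eps / 3.
    apply: contrapT => /forallNP h; have e3 : 0 < eps / 3 by rewrite divr_gt0.
    suff : eps / 3 <= 0 by rewrite leNgt e3.
    by apply: (@le0_of_geometric _ _ (2 * r)) => n; have /negP := h n; rewrite -ltNge => /ltW.
  have eps3 : 0 < eps / 3 by rewrite divr_gt0.
  have /cvgrPdist_le /(_ _ eps3) Zc := Cn_cont (Zgood n).1 te.
  near=> s.
  have se : s \in `]-e, e[ by near: s; exact: (near_in_itvoo te).
  have h1 := le_trans (zP t te n) nP; have h2 := le_trans (zP s se n) nP.
  have h3 : `|Z n t - Z n s| <= eps / 3 by near: s.
  rewrite (_ : z t - z s = (z t - Z n t) + (Z n t - Z n s) - (z s - Z n s)); last first.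
    by apply/rowP => l; rewrite !mxE; ring.
  rewrite (le_trans (ler_normB _ _))// (le_trans (lerD (ler_normD _ _) (lexx _)))//.
  rewrite (_ : eps = eps / 3 + eps / 3 + eps / 3); last by field.
  by rewrite lerD// lerD.
have zgood : good z by [].
have Tz t : t \in `]-e, e[ -> T z t = z t.
  move=> te; apply/eqP; rewrite -subr_eq0 -normr_le0.
  apply: (@le0_of_geometric _ _ (2 * r)) => n.
  rewrite (_ : T z t - z t = (T z t - Z n.+1 t) - (z t - Z n.+1 t)); last first.
    by apply/rowP => l; rewrite !mxE; ring.
  rewrite (le_trans (ler_normB _ _))//.
  have h1 := Tdist z (Z n) _ zgood (Zgood n) (fun s se => zP s se n) t te.
  have h2 := zP t te n.+1; apply: (le_trans (lerD h1 h2)).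
  by rewrite exprS; move: (2^-1 ^+ n) => q; lra.
(* A fixed point of an operator that gains a derivative is smooth. *)
have zS n : Cn n I z.
  elim: n => [|n IH] //.
  by apply: (Cn_eq oI (f := T z)); [move=> t; exact: Tz|exact: TC].
have e0in : (0 : R) \in `]-e, e[ by rewrite in_itv /= oppr_lt0 e0.
exists e, z; split => //.
- by rewrite -(Tz 0 e0in); apply/rowP => i; rewrite !mxE mul0r addr0.
- by move=> t /zr /rP[].
- move=> t te t0; apply: (@near_eq_is_derive _ _ _ (T z)).
    by near=> s; apply: Tz; near: s; exact: (near_in_itvoo te).
  apply/is_derive_mxP => i j; rewrite ord1 !mxE.
  have h := @is_derive_average _ (b j) _ _ _ (FzC 0%N z j zr zC) te.
  have := is_deriveD (is_derive_cst (z0 0 j) t 1) h; rewrite add0r => h2.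
  rewrite (_ : (fun y => _) = cst (z0 0 j) + (fun t => t * average (b j) (fun s => F (z s) 0 j) t)).
    apply: (is_derive_eq h2); congr (_ - _ * _).
    have := congr1 (fun v : E => v 0 j) (Tz t te); rewrite mxE => <-.
    by rewrite addrAC subrr add0r mulrC mulKf.
  by apply/funext => s; rewrite mxE.
Unshelve. all: by end_near. Qed.

End SingularODE.

(** A non-zero cofactor is an invertible minor of size one less, so the rank drops by at most one
    and the left kernel is at most a line, spanned by [w]. *)
Lemma adj_neq0_kernel (F : fieldType) m (h : 'M[F]_m) (u w : 'rV[F]_m) :
  \adj h != 0 -> u *m h = 0 -> w *m h = 0 -> w != 0 -> exists c, u = c *: w.
Proof.
case: m h u w => [|m] h u w.
  by move=> _ _ _ /negP[]; apply/eqP/rowP => -[].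
move=> adj0 uh wh w0.
have [i [j hij]] : exists i j, \det (row' i (col' j h)) != 0.
  apply: contrapT => H; move/negP: adj0; apply; apply/eqP/matrixP => j i.
  rewrite !mxE /cofactor (_ : \det _ = 0) ?mulr0//; apply/eqP; apply: contrapT => H2.
  by apply: H; exists i, j; apply/negP => /H2.
have rk : (m <= \rank h)%N.
  have r1 : \rank (row' i (col' j h)) = m.
    by apply/eqP; rewrite -[_ == _]/(row_free _) row_free_unit unitmxE unitfE.
  rewrite -{1}r1; apply: (@leq_trans (\rank (col' j h))).
    by apply: mxrankS; exact: rowsub_sub.
  rewrite -mxrank_tr -(mxrank_tr h); apply: mxrankS.
  by rewrite tr_col'; exact: rowsub_sub.
have rker : (\rank (kermx h) <= 1)%N by rewrite mxrank_ker leq_subLR addn1.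
have wk : (w <= kermx h)%MS by apply/sub_kermxP.
have kw : (kermx h <= w)%MS.
  rewrite -(geq_leqif (mxrank_leqif_sup wk)) (leq_trans rker)// lt0n mxrank_eq0 //.
by apply/sub_rVP; apply: submx_trans kw; apply/sub_kermxP.
Qed.

(** * The dual metric near a polar point *)

Section Dot.
Context {R : realType} {m : nat}.
Local Notation E := 'rV[R]_m.

Definition dot (u v : E) : R := (u *m v^T) 0 0.

Lemma dotE u v : dot u v = \sum_i u 0 i * v 0 i.
Proof. by rewrite /dot mxE; apply: eq_bigr => i _; rewrite mxE. Qed.

Lemma dotC u v : dot u v = dot v u.
Proof. by rewrite !dotE; apply: eq_bigr => i _; rewrite mulrC. Qed.

Lemma dotDl u v w : dot (u + v) w = dot u w + dot v w.
Proof. by rewrite /dot mulmxDl mxE. Qed.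

Lemma dotZl a u v : dot (a *: u) v = a * dot u v.
Proof. by rewrite /dot -scalemxAl mxE. Qed.

Lemma dotDr u v w : dot u (v + w) = dot u v + dot u w.
Proof. by rewrite dotC dotDl !(dotC u). Qed.

Lemma dotZr a u v : dot u (a *: v) = a * dot u v.
Proof. by rewrite dotC dotZl dotC. Qed.

Lemma dotNl u v : dot (- u) v = - dot u v.
Proof. by rewrite -scaleN1r dotZl mulN1r. Qed.

Lemma dotNr u v : dot u (- v) = - dot u v.
Proof. by rewrite dotC dotNl dotC. Qed.

Lemma dot0l v : dot 0 v = 0.
Proof. by rewrite /dot mul0mx mxE. Qed.

Lemma dot0r v : dot v 0 = 0.
Proof. by rewrite dotC dot0l. Qed.

Lemma dot_mulmx u (A : 'M[R]_m) v : dot (u *m A) v = dot u (v *m A^T).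
Proof. by rewrite /dot trmx_mul trmxK mulmxA. Qed.

Lemma dot_sym u (A : 'M[R]_m) v : A^T = A -> dot (u *m A) v = dot (v *m A) u.
Proof. by move=> AT; rewrite dot_mulmx AT dotC. Qed.

Lemma dot_delta u i : dot u (delta_mx 0 i) = u 0 i.
Proof.
rewrite dotE (bigD1 i)//= big1 ?addr0 ?mxE ?eqxx ?mulr1// => j ji.
by rewrite mxE eqxx /= (negbTE ji) mulr0.
Qed.

Lemma dot_sumr u (v : 'I_m -> E) (a : 'I_m -> R) :
  dot u (\sum_i a i *: v i) = \sum_i a i * dot u (v i).
Proof.
elim/big_rec2: _ => [|i x y _ <-]; first by rewrite dot0r.
by rewrite dotDr dotZr.
Qed.

Lemma dot_eq0 u : (forall v, dot u v = 0) -> u = 0.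
Proof. by move=> h; apply/rowP => i; rewrite -(dot_delta u i) h mxE. Qed.

Lemma row_dyad (u v w : E) : u *m (v^T *m w) = dot u v *: w.
Proof. by rewrite mulmxA [u *m v^T]mx11_scalar mul_scalar_mx. Qed.

Lemma is_derive_dot (V : normedModType R) (f g : V -> E) x v df dg :
  is_derive x v f df -> is_derive x v g dg ->
  is_derive x v (fun y => dot (f y) (g y)) (dot df (g x) + dot (f x) dg).
Proof.
move=> fd gd; have := is_derive_mulmx fd (is_derive_tr gd).
by move=> /is_derive_mxP /(_ 0 0); rewrite mxE.
Qed.

Lemma Cn_dot (V : normedModType R) n (A : set V) (f g : V -> E) : open A ->
  Cn n A f -> Cn n A g -> Cn n A (fun y => dot (f y) (g y)).
Proof.
by move=> oA fC gC; apply: (Cn_entry 0 0 oA); apply: (Cn_mulmx oA fC); exact: Cn_tr.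
Qed.

Definition grad (f : E -> R) (y : E) : E := \row_l 'D_(delta_mx 0 l) f y.

Lemma derive_grad (A : set E) (f : E -> R) y v : open A -> A y -> Cn 1 A f ->
  'D_v f y = dot v (grad f y).
Proof.
move=> oA Ay fC; rewrite (derive_dirE_scalar _ oA Ay fC) dotE.
by apply: eq_bigr => i _; rewrite mxE.
Qed.

Lemma Cn_grad n (A : set E) (f : E -> R) : open A -> Cn n.+1 A f -> Cn n A (grad f).
Proof. by move=> oA fC; apply: (Cn_row oA) => i; exact: Cn_derive fC. Qed.

End Dot.

(** * Normal form of the dual metric at the polar end *)

Section PolarModel.
Context {R : realType} {m : nat}.
Local Notation E := 'rV[R]_m.

(* In a chart, [h] is the dual metric, [f] a
   defining function of the polar end normalized so that the field [n] with
   [df h = f n] satisfies [df(n) = 1] on [f = 0], and [B / f] the metric. *)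
Record polar_model (O : set E) (h B : E -> 'M[R]_m) (f k : E -> R) (n : E -> E) : Prop := {
  pm_open : open O;
  pm_h : smooth_on O h;
  pm_B : smooth_on O B;
  pm_f : smooth_on O f;
  pm_k : smooth_on O k;
  pm_n : smooth_on O n;
  pm_hsym : forall y, O y -> (h y)^T = h y;
  pm_Bsym : forall y, O y -> (B y)^T = B y;
  pm_grad : forall y, O y -> grad f y *m h y = f y *: n y;
  pm_norm : forall y, O y -> dot (n y) (grad f y) = 1 + f y * k y;
  pm_Bh : forall y, O y -> B y *m h y = (f y)%:M;
  pm_nB : forall y, O y -> n y *m B y = grad f y;
  pm_B0 : forall y, O y -> f y = 0 -> B y = (grad f y)^T *m grad f y;
  pm_ker : forall y, O y -> f y = 0 -> forall u, u *m h y = 0 -> exists c, u = c *: grad f y }.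

(** If [F y] were non-zero, [F] would be non-zero near [y], so [g] would vanish near [y] and all its
    derivatives at [y] would be 0. This is how identities known off the polar end are extended to
    it. *)
Lemma eq0_off_regular_zeros p q (O : set E) (g : E -> R) (F : E -> 'M[R]_(p, q)) :
  open O -> (forall y, O y -> g y = 0 -> exists v, 'D_v g y != 0) ->
  (forall y, O y -> {for y, continuous F}) ->
  (forall y, O y -> g y != 0 -> F y = 0) -> forall y, O y -> F y = 0.
Proof.
move=> oO greg Fc F0 y Oy; apply/eqP; apply: contrapT => /negP Fy.
have gy : g y = 0 by apply/eqP; apply: contrapT => /negP /(F0 y Oy) E0; rewrite E0 eqxx in Fy.
have [v] := greg y Oy gy; move/negP; apply; apply/eqP.
rewrite -[RHS](@derive_cst R E R 0 y v); apply: near_eq_derive.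
have [i [j Fij]] : exists i j, F y i j != 0.
  apply: contrapT => H; move/negP: Fy; apply; apply/eqP/matrixP => i j; rewrite mxE.
  by apply/eqP; apply: contrapT => /negP ?; apply: H; exists i, j.
have Fijc : {for y, continuous (fun y => F y i j)} by move/continuous_mxP: (Fc y Oy).
have nz : \forall z \near y, F z i j != 0.
  by apply: (Fijc [set t : R | t != 0]); apply: open_nbhs_nbhs; split => //; exact: open_neq.
near=> z; apply/eqP; apply: contrapT => /negP gz.
have : F z i j != 0 by near: z.
rewrite F0 ?mxE ?eqxx//; near: z; exact: open_nbhs_nbhs.
Unshelve. all: by end_near. Qed.

(** The starting point is [g = det h] with the adjugate [A], so that [A h = g], and the field [n0]
    with [dg h = g n0]. Rescaling by [b0 = dg(n0)] gives the normalization: [f = g / b0] and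
    [B = A / b0]. The crux is that [b0] does not vanish on the zeros of [g]. *)
Theorem polar_model_exists (O : set E) (h : E -> 'M[R]_m) (p : E) :
  open O -> O p -> smooth_on O h -> (forall y, O y -> (h y)^T = h y) ->
  \det (h p) = 0 ->
  (forall y, O y -> \det (h y) = 0 -> exists v, 'D_v (fun y => \det (h y)) y != 0) ->
  (forall y, O y -> \det (h y) = 0 -> grad (fun y => \det (h y)) y *m h y = 0) ->
  exists (U : set E) B f k n, [/\ U p, U `<=` O, polar_model U h B f k n,
    forall y, U y -> f y = 0 <-> \det (h y) = 0 & forall y, U y -> f y = 0 -> n y != 0 ].
Proof.
move=> oO Op hS hsym gp greg gker.
set g := (fun y => \det (h y)) in greg gker *.
have gS : smooth_on O g by move=> i; exact: Cn_det.
have [e ge] := greg p Op gp.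
have [U [oU Up UO div]] := smooth_division_mx 1 m oO gS Op gp ge.
have ghS : smooth_on O (fun y => grad g y *m h y).
  by move=> i; apply: (Cn_mulmx oO) => //; exact: Cn_grad.
have [n0 n0S n0E] := div _ ghS gker.
pose A y := \adj (h y).
have AS : smooth_on O A by move=> i; exact: Cn_adj.
have gregU y : U y -> g y = 0 -> exists v, 'D_v g y != 0 by move=> Uy; apply: greg; exact: UO.
(* Off the zeros of [g], multiply [dg h = g n0] by [A] and cancel [g]. On the zeros the identity
   shows that [A] is still non-zero. *)
have n0A y : U y -> n0 y *m A y = grad g y.
  move=> Uy; apply/eqP; rewrite -subr_eq0; apply/eqP.
  have FC : Cn 0 U (fun y => n0 y *m A y - grad g y).
    apply: (Cn_subm oU (Cn_mulmx oU (n0S 0%N) (Cn_sub UO (AS 0%N)))).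
    exact: Cn_sub (Cn_grad oO (gS 1%N)).
  apply: (eq0_off_regular_zeros oU gregU (fun z => Cn_cont FC (x := z)) _ Uy).
  move=> z Uz gz; apply/eqP; rewrite subr_eq0; apply/eqP.
  by apply: (scalerI gz); rewrite scalemxAl -n0E// -mulmxA mul_mx_adj mul_mx_scalar.
have grad0 y : U y -> g y = 0 -> grad g y != 0.
  move=> Uy gy; have [v] := gregU y Uy gy; rewrite (derive_grad v oO (UO _ Uy) (gS 1%N)).
  by apply: contraNN => /eqP ->; rewrite dot0r.
have A0 y : U y -> g y = 0 -> A y != 0.
  move=> Uy gy; have := grad0 y Uy gy; rewrite -n0A//.
  by apply: contraNN => /eqP ->; rewrite mulmx0.
have kerE y : U y -> g y = 0 -> forall u, u *m h y = 0 -> exists c, u = c *: grad g y.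
  move=> Uy gy u uh; apply: (adj_neq0_kernel (A0 y Uy gy) uh).
    exact: gker (UO _ Uy) gy.
  exact: grad0.
have Asym y : U y -> (A y)^T = A y.
  by move=> /UO Oy; rewrite /A trmx_adj hsym.
pose b0 y := dot (n0 y) (grad g y).
have b0S : smooth_on U b0.
  by move=> i; apply: (Cn_dot oU (n0S i)); exact: Cn_sub (Cn_grad oO (gS i.+1)).
(* On [g = 0] the rows of [A] lie in the kernel of [h], which is spanned by [dg], so [A = cc^T dg];
   symmetry of [A] and [n0 A = dg] then give [b0 cc = dg], hence [b0 != 0]. *)
have AE y : U y -> g y = 0 -> b0 y != 0 /\ A y = (b0 y)^-1 *: ((grad g y)^T *m grad g y).
  move=> Uy gy; have Oy := UO _ Uy.
  have /choice [c cE] : forall i, exists ci, row i (A y) = ci *: grad g y.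
    move=> i; apply: kerE => //; rewrite -row_mul mul_adj_mx.
    by rewrite -/(g y) gy raddf0 row0.
  pose cc : E := \row_i c i.
  have AC : A y = cc^T *m grad g y.
    apply/row_matrixP => i; rewrite cE row_mul; apply/rowP => j.
    by rewrite !mxE big_ord1 !mxE.
  have bc : b0 y *: cc = grad g y.
    by rewrite -[RHS]n0A// -(Asym _ Uy) AC trmx_mul trmxK row_dyad.
  have b00 : b0 y != 0.
    by have := grad0 y Uy gy; rewrite -bc; apply: contraNN => /eqP ->; rewrite scale0r.
  split => //; rewrite AC; have -> : cc = (b0 y)^-1 *: grad g y.
    by rewrite -bc scalerA mulVf// scale1r.
  by rewrite linearZ /= -scalemxAl.
pose W := U `&` b0 @^-1` [set t | t != 0].
have oW : open W.
  apply: (@open_setI_preimage E R U [set t | t != 0] b0 oU); first exact: open_neq.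
  by move=> y Uy; exact: (Cn_cont (b0S 0%N)).
have WU : W `<=` U by move=> y [].
have WO : W `<=` O by move=> y /WU /UO.
pose u y := (b0 y)^-1.
have uS : smooth_on W u.
  by move=> i; apply: (CnV oW); [move=> y []|exact: Cn_sub (b0S i)].
pose f y := g y * u y.
have gSW : smooth_on W g by move=> i; exact: Cn_sub (gS i).
have n0SW : smooth_on W n0 by move=> i; exact: Cn_sub (n0S i).
have hSW : smooth_on W h by move=> i; exact: Cn_sub (hS i).
have b0SW : smooth_on W b0 by move=> i; exact: Cn_sub (b0S i).
have ASW : smooth_on W A by move=> i; exact: Cn_sub (AS i).
have guS : smooth_on W (grad u) by move=> i; exact: Cn_grad.
have fS : smooth_on W f by move=> i; exact: CnM.
(* Forced by the product rule: [df = u dg + g du] gives [df h = g u (n0 + b0 du h)]. The function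
   [k] below collects what remains when [n] is paired with [df]. *)
pose n y := n0 y + b0 y *: (grad u y *m h y).
pose k y := b0 y * (2 * dot (n0 y) (grad u y) + b0 y * dot (grad u y *m h y) (grad u y)).
have ub y : W y -> u y * b0 y = 1 by move=> [_ /= b00]; rewrite /u mulVf.
have gradf y : W y -> grad f y = u y *: grad g y + g y *: grad u y.
  move=> Wy; apply/rowP => i; rewrite !mxE.
  have := is_deriveM (Cn_is_derive (delta_mx 0 i) (gSW 1%N) Wy)
    (Cn_is_derive (delta_mx 0 i) (uS 1%N) Wy).
  by move=> [_ ->]; rewrite /GRing.scale /= addrC.
have f0E y : W y -> f y = 0 <-> g y = 0.
  move=> Wy; split=> [/eqP|gy]; last by rewrite /f gy mul0r.
  rewrite mulf_eq0 => /orP[/eqP//|/eqP u0].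
  by have /eqP := ub y Wy; rewrite u0 mul0r eq_sym oner_eq0.
have nS : smooth_on W n.
  move=> i; apply: (CnD oW (n0SW i)); apply: (Cn_scale oW (b0SW i)).
  exact: (Cn_mulmx oW (guS i) (hSW i)).
have nE y : W y -> grad f y *m h y = f y *: n y.
  move=> Wy; rewrite gradf// mulmxDl -!scalemxAl (n0E y (WU _ Wy)) /n /f scalerDr !scalerA.
  by rewrite -[g y * u y * b0 y]mulrA ub// mulr1 [u y * g y]mulrC.
have hB y : W y -> h y *m (u y *: A y) = (f y)%:M.
  move=> Wy; rewrite -scalemxAr mul_mx_adj -/(g y) /f.
  by rewrite scale_scalar_mx mulrC.
have nBE y : W y -> n y *m (u y *: A y) = grad f y.
  move=> Wy; apply/eqP; rewrite -subr_eq0; apply/eqP.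
  have FC : Cn 0 W (fun y => n y *m (u y *: A y) - grad f y).
    apply: (Cn_subm oW (Cn_mulmx oW (nS 0%N) (Cn_scale oW (uS 0%N) (ASW 0%N)))).
    exact: (Cn_grad oW (fS 1%N)).
  apply: (eq0_off_regular_zeros oW _ (fun z => Cn_cont FC (x := z)) _ Wy).
  - by move=> z /WU; exact: gregU.
  - move=> z Wz gz; apply/eqP; rewrite subr_eq0; apply/eqP.
    have fz : f z != 0 by apply: contra_neq gz => /(f0E z Wz).
    by apply: (scalerI fz); rewrite scalemxAl -nE// -mulmxA hB// mul_mx_scalar.
exists W, (fun y => u y *: A y), f, k, n; split => //.
- split => //.
    by have [] := AE p Up gp.
- have nsym y : W y -> (h y)^T = h y by move=> /WO; exact: hsym.
  split => //.
  + by move=> i; exact: (Cn_scale oW).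
  + move=> i; apply: (CnM oW (b0SW i)); apply: (CnD oW).
      by apply: (CnM oW); [exact: Cn_cst|exact: Cn_dot].
    by apply: (CnM oW (b0SW i)); apply: (Cn_dot oW) => //; exact: (Cn_mulmx oW).
  + by move=> y Wy; rewrite linearZ /= Asym//; exact: WU.
  + move=> y Wy; rewrite gradf// /n /k !(dotDl, dotDr, dotZl, dotZr) -/(b0 y).
    have -> : dot (grad u y *m h y) (grad g y) = g y * dot (n0 y) (grad u y).
      by rewrite dot_sym ?nsym// (n0E y (WU _ Wy)) dotZl.
    have := ub y Wy; rewrite /f.
    move: (dot (grad u y *m h y) (grad u y)) (dot (n0 y) (grad u y)) => d a.
    move: (u y) (b0 y) (g y) => x z w xz.
    rewrite [LHS](_ : _ = x * z + w * a + (x * z * (w * a) + z * (w * d))); last by ring.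
    rewrite (_ : w * x * _ = x * z * w * (2 * a + z * d)); last by ring.
    by rewrite xz; ring.
  + move=> y Wy; rewrite -scalemxAl mul_adj_mx -/(g y) /f.
    by rewrite scale_scalar_mx mulrC.
  + move=> y Wy fy; have gy := (f0E y Wy).1 fy.
    rewrite gradf// gy scale0r addr0 (AE y (WU _ Wy) gy).2 -/(u y) scalerA.
    by rewrite [(_ *: _)^T]linearZ /= -scalemxAl -scalemxAr scalerA.
  + move=> y Wy fy v vh; have gy := (f0E y Wy).1 fy.
    have [c ->] := kerE y (WU _ Wy) gy v vh; exists (c * b0 y).
    by rewrite gradf// gy scale0r addr0 scalerA -mulrA [b0 y * _]mulrC ub// mulr1.
- move=> y Wy fy; have gy := (f0E y Wy).1 fy.
  apply: contraNneq (grad0 y (WU _ Wy) gy) => n0'.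
  have := nBE y Wy; rewrite n0' mul0mx gradf// gy scale0r addr0 => /esym/eqP.
  rewrite scaler_eq0 => /orP[/eqP u0|//].
  by have /eqP := ub y Wy; rewrite u0 mul0r eq_sym oner_eq0.
Qed.

End PolarModel.

(** * Uniqueness for the singular equation *)

Section SingularODEUniqueness.
Context {R : realType} {d : nat}.
Local Notation E := 'rV[R]_d.

(* The singular term only helps for [t > 0], since it contributes
   [- |Pi (z1 - z2)|^2 / t] to the derivative of [|z1 - z2|^2]. *)
Lemma singular_ode_unique_pos (A : set E) (F : E -> E) (z0 : E) (b : 'I_d -> bool)
    (e : R) (z1 z2 : R -> E) : open A -> A z0 -> Cn 1 A F -> 0 < e ->
  z1 0 = z0 -> z2 0 = z0 -> {for 0, continuous z1} -> {for 0, continuous z2} ->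
  (forall t, t \in `]0, e[ ->
    is_derive t 1 z1 (F (z1 t) - \row_i ((b i)%:R / 2 * ((z1 t 0 i - z0 0 i) / t)))) ->
  (forall t, t \in `]0, e[ ->
    is_derive t 1 z2 (F (z2 t) - \row_i ((b i)%:R / 2 * ((z2 t 0 i - z0 0 i) / t)))) ->
  exists2 a : R, 0 < a & forall t, 0 <= t < a -> z1 t = z2 t.
Proof.
move=> oA Az0 FC e0 z10 z20 z1c z2c z1d z2d.
have [r [L [K [r0 L0 K0 rP]]]] := locally_lipschitz oA Az0 FC.
have [a0 /= a00 aP] : exists2 a0, 0 < a0 & forall t : R, `|t| < a0 ->
    `|z1 t - z0| <= r /\ `|z2 t - z0| <= r.
  have : \forall t \near (0 : R), `|z1 t - z0| <= r /\ `|z2 t - z0| <= r.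
    near=> t; rewrite -[in X in X /\ _]z10 -[in X in _ /\ X]z20; split; rewrite distrC; near: t.
      by move/cvgrPdist_le : z1c; exact.
    by move/cvgrPdist_le : z2c; exact.
  move=> /nbhs_ballP[a0 /= a00 aP]; exists a0 => // t ta; apply: aP.
  by rewrite -ball_normE /= sub0r normrN.
exists (Num.min a0 e); first by rewrite lt_min a00 e0.
move=> t /andP[t0 ta]; have := t0; rewrite le_eqVlt => /orP[/eqP <-|{}t0].
  by rewrite z10 z20.
have [ta0 te] : t < a0 /\ t < e by move: ta; rewrite lt_min => /andP[].
have in_e s : s \in `]0, t] -> s \in `]0, e[.
  by rewrite !in_itv /= => /andP[-> st]; exact: le_lt_trans st te.
have in_r s : s \in `[0, t] -> `|z1 s - z0| <= r /\ `|z2 s - z0| <= r.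
  rewrite in_itv /= => /andP[s0 st]; apply: aP.
  by rewrite ger0_norm// (le_lt_trans st).
pose D s i := z1 s 0 i - z2 s 0 i.
(* The Euclidean square replaces the sup norm, which is not differentiable; [normG] brings the sup
   norm back. *)
pose G s := \sum_i D s i ^+ 2.
pose C : R := 2 * (d%:R * L).
have C0 : 0 <= C by rewrite !mulr_ge0.
pose dD s i := (F (z1 s) - F (z2 s)) 0 i - (b i)%:R / 2 * (D s i / s).
have Dd s i : s \in `]0, t] -> is_derive s 1 (fun s => D s i) (dD s i).
  move=> /in_e se; have /is_derive_mxP /(_ 0 i) h1 := z1d s se.
  have /is_derive_mxP /(_ 0 i) h2 := z2d s se.
  by apply: (is_derive_eq (is_deriveB h1 h2)); rewrite !mxE /dD /D !mxE; ring.
have Gd s : s \in `]0, t] -> is_derive s 1 G (\sum_i (2 * (D s i * dD s i))).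
  move=> st; have -> : G = \sum_(i < d) (fun s => D s i * D s i).
    by apply/funext => x; rewrite fct_sumE.
  apply: is_derive_sum => i; apply: (is_derive_eq (is_deriveM (Dd s i st) (Dd s i st))).
  by rewrite /GRing.scale /=; ring.
have G0 : G 0 = 0 by rewrite /G big1// => i _; rewrite /D z10 z20 subrr expr0n.
have Gge s : 0 <= G s by apply: sumr_ge0 => i _; rewrite sqr_ge0.
have normG s : `|z1 s - z2 s| ^+ 2 <= G s.
  have [->|nz] := eqVneq `|z1 s - z2 s| 0; first by rewrite expr0n.
  have [[i j] /= ->] : exists ij, `|z1 s - z2 s| = `|(z1 s - z2 s) ij.1 ij.2|.
    by apply: mx_norm_neq0.
  rewrite ord1 real_normK ?num_real// !mxE /G (bigD1 j)//= lerDl.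
  by apply: sumr_ge0 => l _; rewrite sqr_ge0.
have Gd_le s : s \in `]0, t] -> \sum_i (2 * (D s i * dD s i)) <= C * G s.
  move=> st; have s0 : 0 < s by move: st; rewrite in_itv /= => /andP[].
  have [r1 r2] : `|z1 s - z0| <= r /\ `|z2 s - z0| <= r.
    by apply: in_r; move: st; rewrite !in_itv /= => /andP[/ltW -> ->].
  have FL : `|F (z1 s) - F (z2 s)| <= L * `|z1 s - z2 s|.
    by have [_ _] := rP _ r1; exact.
  apply: (@le_trans _ _ (\sum_(i < d) 2 * (L * G s))).
    apply: ler_sum => i _; rewrite ler_pM2l// /dD mulrBr.
    apply: (@le_trans _ _ (D s i * (F (z1 s) - F (z2 s)) 0 i)).
      rewrite gerBl [X in 0 <= X](_ : _ = (b i)%:R / 2 * (D s i ^+ 2 / s)); last by ring.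
      by rewrite mulr_ge0 ?divr_ge0 ?sqr_ge0// ltW.
    rewrite (le_trans (ler_norm _))// normrM.
    apply: (@le_trans _ _ (`|z1 s - z2 s| * (L * `|z1 s - z2 s|))).
      apply: ler_pM => //.
        by have := mx_norm_coord (z1 s - z2 s) 0 i; rewrite !mxE.
      exact: le_trans (mx_norm_coord _ _ _) FL.
    by rewrite mulrCA -expr2 ler_wpM2l.
  by rewrite sumr_const card_ord -mulr_natl /C le_eqVlt; apply/orP; left; apply/eqP; ring.
have Gc0 : {for 0, continuous G}.
  have -> : G = \sum_(i < d) (fun s => D s i * D s i).
    by apply/funext => x; rewrite fct_sumE.
  have Dc i : {for 0, continuous (fun s => D s i)}.
    by apply: continuousB; [move/continuous_mxP: z1c|move/continuous_mxP: z2c].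
  elim/big_ind: _ => [|g h gc hc|i _]; first exact: cst_continuous.
    exact: (cvgD gc hc).
  exact: (continuousM (Dc i) (Dc i)).
(* Gronwall: [H] is non-negative, non-increasing on [[0, t]], and [H 0 = 0]. *)
pose H s := G s * expR (- C * s).
have Hd s : s \in `]0, t] -> is_derive s 1 H
    (G s * (- C * expR (- C * s)) + expR (- C * s) * \sum_i (2 * (D s i * dD s i))).
  move=> st; have dl : is_derive s 1 (fun s : R => - C * s) (- C).
    by have := is_deriveZ (- C) (is_derive_id s 1); rewrite /GRing.scale /= mulr1.
  have de := is_derive_chain1 dl (is_derive_expR (- C * s)).
  exact: (is_deriveM (Gd s st) de).
have Hle : H t <= H 0.
  have Hwc : {within `[0, t], continuous H}.
    apply/continuous_within_itvP => //; split.
    - move=> s st; have [/derivable1_diffP ? _] := Hd s (subset_itv_oo_oc st).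
      exact: differentiable_continuous.
    - apply: cvg_at_right_filter; apply: continuousM => //.
      apply: (continuous_comp (f := fun s : R => - C * s)); last exact: continuous_expR.
      by apply: cvgMl_tmp; exact: cvg_id.
    - have tt : t \in `]0, t] by rewrite in_itv /= t0 lexx.
      apply: cvg_at_left_filter.
      have [/derivable1_diffP ? _] := Hd t tt; exact: differentiable_continuous.
  apply: (@ler0_derive1_le_cc R H 0 t) => //.
  - by move=> s st; have [] := Hd s (subset_itv_oo_oc st).
  - move=> s st; have st' := subset_itv_oo_oc st.
    rewrite derive1E; have [_ ->] := Hd s st'.
    have := expR_gt0 (- C * s); have := Gd_le s st'; move: (\sum_i _) (expR _) => S x Sle x0.
    by rewrite [G s * _]mulrCA mulrA [x * S]mulrC -mulrDl mulr_le0_ge0 ?(ltW x0)//; lra.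
  - by rewrite in_itv /= lexx ltW.
  - by rewrite in_itv /= lexx ltW.
  - exact: ltW.
have Gt : G t = 0.
  apply/eqP; rewrite eq_le Gge andbT -(pmulr_lle0 _ (expR_gt0 (- C * t))).
  by move: Hle; rewrite /H G0 mul0r.
by apply/eqP; rewrite -subr_eq0 -normr_eq0 -sqrf_eq0 eq_le sqr_ge0 andbT -Gt normG.
Unshelve. all: by end_near. Qed.

(** Under [t |-> - t] the equation keeps its shape with [F] replaced by [- F], because the singular
    term changes sign twice. *)
Lemma singular_ode_unique (A : set E) (F : E -> E) (z0 : E) (b : 'I_d -> bool)
    (e : R) (z1 z2 : R -> E) : open A -> A z0 -> Cn 1 A F -> 0 < e ->
  z1 0 = z0 -> z2 0 = z0 -> {for 0, continuous z1} -> {for 0, continuous z2} ->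
  (forall t, t \in `]-e, e[ -> t != 0 ->
    is_derive t 1 z1 (F (z1 t) - \row_i ((b i)%:R / 2 * ((z1 t 0 i - z0 0 i) / t)))) ->
  (forall t, t \in `]-e, e[ -> t != 0 ->
    is_derive t 1 z2 (F (z2 t) - \row_i ((b i)%:R / 2 * ((z2 t 0 i - z0 0 i) / t)))) ->
  exists2 a : R, 0 < a & forall t, t \in `]-a, a[ -> z1 t = z2 t.
Proof.
move=> oA Az0 FC e0 z10 z20 z1c z2c z1d z2d.
have pos t : t \in `]0, e[ -> (t \in `]-e, e[) /\ t != 0.
  by rewrite !in_itv /= => /andP[t0 te]; rewrite te gt_eqF// andbT (lt_trans _ t0)// oppr_lt0.
have neg t : t \in `]0, e[ -> (- t \in `]-e, e[) /\ - t != 0.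
  move=> /pos[te t0]; rewrite oppr_eq0; split => //.
  by move: te; rewrite !in_itv /= ltrN2 ltrNl andbC.
have [a1 a10 h1] := @singular_ode_unique_pos A F z0 b e z1 z2 oA Az0 FC e0 z10 z20 z1c z2c
  (fun t te => z1d t (pos t te).1 (pos t te).2) (fun t te => z2d t (pos t te).1 (pos t te).2).
have refl (z : R -> E) : {for 0, continuous z} -> {for 0, continuous (fun t => z (- t))}.
  move=> zc; apply: (continuous_comp (f := -%R) (g := z)); last by rewrite oppr0.
  exact: opp_continuous.
have refld (z : R -> E) t : t \in `]0, e[ ->
    is_derive (- t) 1 z (F (z (- t)) - \row_i ((b i)%:R / 2 * ((z (- t) 0 i - z0 0 i) / - t))) ->
    is_derive t 1 (fun t => z (- t))
      ((fun x => - F x) (z (- t)) - \row_i ((b i)%:R / 2 * ((z (- t) 0 i - z0 0 i) / t))).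
  move=> te h; have := is_derive_chain1 (is_deriveNid t 1) h.
  move=> h2; apply: (is_derive_eq h2); apply/rowP => i; rewrite !mxE invrN.
  by ring.
have FC' : Cn 1 A (fun x => - F x) by exact: Cn_oppmx.
have z10' : (fun t => z1 (- t)) 0 = z0 by rewrite oppr0.
have z20' : (fun t => z2 (- t)) 0 = z0 by rewrite oppr0.
have [a2 a20 h2] := @singular_ode_unique_pos A (fun x => - F x) z0 b e (fun t => z1 (- t))
  (fun t => z2 (- t)) oA Az0 FC' e0 z10' z20' (refl _ z1c) (refl _ z2c)
  (fun t te => refld _ t te (z1d _ (neg t te).1 (neg t te).2))
  (fun t te => refld _ t te (z2d _ (neg t te).1 (neg t te).2)).
exists (Num.min a1 a2); first by rewrite lt_min a10 a20.
move=> t; rewrite in_itv /= -ltr_norml lt_min => /andP[ta1 ta2].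
have [t0|t0] := leP 0 t; first by apply: h1; rewrite t0 -(ger0_norm t0).
rewrite -[t]opprK; apply: h2; rewrite oppr_ge0 (ltW t0) /=.
by rewrite -(ltr0_norm t0).
Qed.

End SingularODEUniqueness.

(** * Pregeodesics in the local model *)

Section DerivativeTools.
Context {R : realType}.

(** The device by which identities holding on an open set are differentiated throughout. *)
Lemma is_derive_unique_on (V W : normedModType R) (A : set V) (F G : V -> W) x v dF dG :
  open A -> A x -> (forall y, A y -> F y = G y) ->
  is_derive x v F dF -> is_derive x v G dG -> dF = dG.
Proof.
move=> oA Ax FG [_ <-] [_ <-]; apply: near_eq_derive.
by near=> y; apply: FG; near: y; exact: open_nbhs_nbhs.
Unshelve. all: by end_near. Qed.

Lemma Cn_derive_along m p q (V : normedModType R) n (A : set V) (B : set 'rV[R]_m)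
    (F : 'rV[R]_m -> 'M[R]_(p, q)) (y v : V -> 'rV[R]_m) :
  open A -> open B -> (forall x, A x -> B (y x)) -> Cn n A y -> Cn n A v ->
  Cn n.+1 B F -> Cn n A (fun x => 'D_(v x) F (y x)).
Proof.
move=> oA oB yB yC vC FC; apply/(Cn_mxP _ _ oA) => i j.
apply: (Cn_eq oA (f := fun x => \sum_l v x 0 l * 'D_(delta_mx 0 l) F (y x) i j)).
  move=> x Ax; have F1 : Cn 1 B F by exact: Cn_leq FC.
  rewrite (derive_dirE _ oB (yB x Ax) F1) summxE.
  by apply: eq_bigr => l _; rewrite mxE.
apply: (Cn_sum _ oA) => l _; apply: (CnM oA); first exact: (Cn_entry 0 l oA vC).
apply: (Cn_entry i j oA); apply: (Cn_comp (f := 'D_(delta_mx 0 l) F) oA oB yB yC).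
exact: (Cn_derive (delta_mx 0 l) FC).
Qed.

Lemma hessian_sym m (A : set 'rV[R]_m) (f : 'rV[R]_m -> R) y v l :
  open A -> A y -> Cn 2 A f ->
  ('D_v (grad f) y) 0 l = dot v ('D_(delta_mx 0 l) (grad f) y).
Proof.
move=> oA Ay fC; have gC := Cn_grad oA fC.
have gE (j : 'I_m) : (fun z => grad f z 0 j) = 'D_(delta_mx 0 j) f.
  by apply/funext => z; rewrite mxE.
rewrite derive_mxE ?gE; last exact: (Cn_derivable _ gC).
rewrite (derive_dirE_scalar _ oA Ay (Cn_derive (delta_mx 0 l) fC)) dotE.
apply: eq_bigr => j _; rewrite derive_mxE ?gE; last exact: (Cn_derivable _ gC).
by rewrite (schwarz _ _ oA Ay fC).
Qed.

(** Carries to the crossing time 0 the identities whose derivation divides by [t]. *)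
Lemma continuous_punctured_eq0 m n (F : R -> 'M[R]_(m, n)) : {for 0, continuous F} ->
  (\forall t \near (0 : R)^', F t = 0) -> F 0 = 0.
Proof.
move=> Fc F0; apply/matrixP => i j; rewrite mxE.
have Fijc : {for (0 : R), continuous (fun t => F t i j)} by move/continuous_mxP: Fc.
have h1 : F t i j @[t --> (0 : R)^'] --> F 0 i j by exact: cvg_within_filter Fijc.
have h2 : F t i j @[t --> (0 : R)^'] --> (0 : R).
  apply/cvgrPdist_le => e e0; near=> t.
  have -> : F t = 0 by near: t.
  by rewrite mxE subrr normr0 ltW.
exact: (cvg_unique _ h1 h2).
Unshelve. all: by end_near. Qed.

Lemma is_derive0_cst (f : R -> R) (e : R) :
  (forall t, t \in `]-e, e[ -> is_derive t 1 f 0) ->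
  forall t, t \in `]-e, e[ -> f t = f 0.
Proof.
move=> fd t te; have seg (s : R) : s \in `[0, 1] -> 0 + s *: t \in `]-e, e[.
  move: te; rewrite !in_itv /= -!ltr_norml add0r => te /andP[s0 s1].
  by rewrite (le_lt_trans _ te)// normrM ler_piMl// ger0_norm.
have fdt (s : R) : s \in `[0, 1] -> is_derive (0 + s *: t) t f 0.
  move=> s01; have [d1 d2] := fd _ (seg s s01).
  by have := derive_dir1 t d1; rewrite d2 scaler0.
have [s s01|s s01] := MVT_line (f := f) (x := 0) (v := t) _.
  by have [] := fdt s s01.
by have [_ ->] := fdt s (subset_itv_oo_cc s01); rewrite add0r => /eqP; rewrite subr_eq0 => /eqP.
Qed.

Lemma Cn_lsubmx p q n (V : normedModType R) (A : set V) (z : V -> 'rV[R]_(p + q)) :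
  open A -> Cn n A z -> Cn n A (fun x => lsubmx (z x)).
Proof.
move=> oA zC; apply/(Cn_mxP _ _ oA) => i j.
by apply: (Cn_eq oA); last exact: (Cn_entry i (lshift q j) oA zC); move=> x _; rewrite mxE.
Qed.

Lemma Cn_rsubmx p q n (V : normedModType R) (A : set V) (z : V -> 'rV[R]_(p + q)) :
  open A -> Cn n A z -> Cn n A (fun x => rsubmx (z x)).
Proof.
move=> oA zC; apply/(Cn_mxP _ _ oA) => i j.
by apply: (Cn_eq oA); last exact: (Cn_entry i (rshift p j) oA zC); move=> x _; rewrite mxE.
Qed.

Lemma Cn_row_mx p q n (V : normedModType R) (A : set V) (u : V -> 'rV[R]_p) (v : V -> 'rV[R]_q) :
  open A -> Cn n A u -> Cn n A v -> Cn n A (fun x => row_mx (u x) (v x)).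
Proof.
move=> oA uC vC; apply/(Cn_mxP _ _ oA) => i j.
case: (split_ordP j) => l ->.
  by apply: (Cn_eq oA); last exact: (Cn_entry i l oA uC); move=> x _; rewrite row_mxEl.
by apply: (Cn_eq oA); last exact: (Cn_entry i l oA vC); move=> x _; rewrite row_mxEr.
Qed.

End DerivativeTools.

(** * Hamilton's equations for the dual metric *)

Section Hamiltonian.
Context {R : realType} {m : nat}.
Local Notation E := 'rV[R]_m.
Local Notation e_ l := (delta_mx 0 l : E).

(** The gradient in [y] of the quadratic form of [h] at a fixed covector: Hamilton's equation for
    [h / 2] reads [x' = - quad / 2]. *)
Definition quad (h : E -> 'M[R]_m) (x y : E) : E := \row_l dot (x *m 'D_(e_ l) h y) x.

Lemma quadZ h a x y : quad h (a *: x) y = a ^+ 2 *: quad h x y.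
Proof.
by apply/rowP => l; rewrite !mxE -scalemxAl dotZl dotZr mulrA expr2.
Qed.

Variables (O : set E) (h B : E -> 'M[R]_m) (f k : E -> R) (n : E -> E).
Hypothesis PM : polar_model O h B f k n.
Let oO : open O := pm_open PM.

Lemma derive_sym y v : O y -> ('D_v h y)^T = 'D_v h y.
Proof.
move=> Oy; have hd := Cn_is_derive v (pm_h PM 1%N) Oy.
by apply: (is_derive_unique_on oO Oy (pm_hsym PM) (is_derive_tr hd) hd).
Qed.

Lemma derive_pm_grad y v : O y ->
  'D_v (grad f) y *m h y + grad f y *m 'D_v h y = 'D_v f y *: n y + f y *: 'D_v n y.
Proof.
move=> Oy; have gd := Cn_is_derive v (Cn_grad oO (pm_f PM 2%N)) Oy.
have hd := Cn_is_derive v (pm_h PM 1%N) Oy.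
have fd := Cn_is_derive v (pm_f PM 1%N) Oy.
have nd := Cn_is_derive v (pm_n PM 1%N) Oy.
exact: (is_derive_unique_on oO Oy (pm_grad PM) (is_derive_mulmx gd hd)
  (is_derive_scalemx fd nd)).
Qed.

Lemma derive_pm_norm y v : O y ->
  dot ('D_v n y) (grad f y) + dot (n y) ('D_v (grad f) y) = 'D_v f y * k y + f y * 'D_v k y.
Proof.
move=> Oy; have gd := Cn_is_derive v (Cn_grad oO (pm_f PM 2%N)) Oy.
have fd := Cn_is_derive v (pm_f PM 1%N) Oy.
have nd := Cn_is_derive v (pm_n PM 1%N) Oy.
have kd := Cn_is_derive v (pm_k PM 1%N) Oy.
have := is_deriveD (is_derive_cst (1 : R) y v) (is_deriveM fd kd).
move=> h1; rewrite (is_derive_unique_on oO Oy (pm_norm PM) (is_derive_dot nd gd) h1).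
by rewrite /GRing.scale /=; ring.
Qed.

(* The regular part of [quad / 2] for the covector [df / f + w]. *)
Definition source (y w : E) : E :=
  2^-1 *: grad k y + \row_l dot ('D_(e_ l) n y) w + 2^-1 *: quad h w y.

(* The Hessian of [f] appears only through the derivative of [df] in the
   direction of the velocity: this is what makes the system for [w] regular. *)
Lemma quad_split y w : O y -> f y != 0 ->
  2^-1 *: quad h ((f y)^-1 *: grad f y + w) y =
  (2^-1 / f y ^+ 2 + (k y + dot (n y) w) / f y) *: grad f y
  - (f y)^-1 *: 'D_(n y + w *m h y) (grad f) y + source y w.
Proof.
move=> Oy f0; apply/rowP => l.
have hs := hessian_sym (n y + w *m h y) l oO Oy (pm_f PM 2%N).
move: ('D_(n y + w *m h y) (grad f) y) hs => H hs; rewrite /source /quad !mxE hs.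
set M := 'D_(e_ l) h y; set Dd := 'D_(e_ l) (grad f) y; set Dn := 'D_(e_ l) n y.
have MT : M^T = M by exact: derive_sym.
(* The derivative of [h] meets the pole only through [df]; differentiating [df h = f n] replaces it
   by the derivative of [n] and the Hessian of [f]. *)
have gM : grad f y *m M = 'D_(e_ l) f y *: n y + f y *: Dn - Dd *m h y.
  by rewrite -derive_pm_grad// addrAC subrr add0r.
have nrm := derive_pm_norm (e_ l) Oy; rewrite -/Dn -/Dd in nrm.
have hT := pm_hsym PM Oy.
rewrite mulmxDl -scalemxAl !(dotDl, dotDr, dotZl, dotZr).
rewrite (dot_sym w (grad f y) MT) gM !(dotDl, dotDr, dotZl, dotZr, dotNl, dotNr).
rewrite (dot_sym Dd _ hT) (dot_sym Dd w hT) (pm_grad PM Oy) !dotZl (pm_norm PM Oy).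
have -> : dot Dn (grad f y) = 'D_(e_ l) f y * k y + f y * 'D_(e_ l) k y - dot (n y) Dd.
  by rewrite -nrm addrK.
move: (f y) f0 => F F0; field; exact: F0.
Qed.

End Hamiltonian.

Section LocalExistence.
Context {R : realType} {m : nat}.
Local Notation E := 'rV[R]_m.
Local Notation e_ l := (delta_mx 0 l : E).
Variables (O : set E) (h B : E -> 'M[R]_m) (f k : E -> R) (n : E -> E).
Hypothesis PM : polar_model O h B f k n.
Let oO : open O := pm_open PM.

Lemma Cn_source (V : normedModType R) i (A : set V) (y w : V -> E) : open A ->
  (forall x, A x -> O (y x)) -> Cn i A y -> Cn i A w ->
  Cn i A (fun x => source h k n (y x) (w x)).
Proof.
move=> oA yO yC wC; apply: (CnD oA); first apply: (CnD oA).
- apply: (Cn_scale oA); first exact: Cn_cst.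
  exact: (Cn_comp oA oO yO yC (Cn_grad oO (pm_k PM i.+1))).
- apply: (Cn_row oA) => l; apply: (Cn_dot oA) => //.
  exact: (Cn_comp (f := 'D_(e_ l) n) oA oO yO yC (Cn_derive (e_ l) (pm_n PM i.+1))).
- apply: (Cn_scale oA); first exact: Cn_cst.
  apply: (Cn_row oA) => l; apply: (Cn_dot oA) => //; apply: (Cn_mulmx oA) => //.
  exact: (Cn_comp (f := 'D_(e_ l) h) oA oO yO yC (Cn_derive (e_ l) (pm_h PM i.+1))).
Qed.

(** The coordinates are position, then covector; only the second block carries the singular term. *)
Let sing (i : 'I_(m + m)) : bool := (m <= i)%N.

Lemma singl j : sing (lshift m j) = false.
Proof. by apply/negbTE; rewrite -ltnNge /= ltn_ord. Qed.

Lemma singr j : sing (rshift m j) = true.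
Proof. by rewrite /sing /= leq_addr. Qed.

Lemma is_derive_blocks (z : R -> 'rV[R]_(m + m)) (p : E) (t : R) (u v : E) :
  is_derive t 1 z (row_mx u v -
    \row_i ((sing i)%:R / 2 * ((z t 0 i - row_mx p 0 0 i) / t))) <->
  is_derive t 1 (fun s => lsubmx (z s)) u /\
  is_derive t 1 (fun s => rsubmx (z s)) (v - (2 * t)^-1 *: rsubmx (z t)).
Proof.
have El j : (row_mx u v - \row_i ((sing i)%:R / 2 * ((z t 0 i - row_mx p 0 0 i) / t)))
    0 (lshift m j) = u 0 j.
  by rewrite mxE row_mxEl !mxE singl !mul0r subr0.
have Er j : (row_mx u v - \row_i ((sing i)%:R / 2 * ((z t 0 i - row_mx p 0 0 i) / t)))
    0 (rshift m j) = (v - (2 * t)^-1 *: rsubmx (z t)) 0 j.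
  rewrite [LHS]mxE row_mxEr [RHS]mxE; congr (_ + _); rewrite [LHS]mxE [RHS]mxE; congr (- _).
  rewrite [LHS]mxE [RHS]mxE singr row_mxEr [rsubmx _ _ _]mxE mxE subr0 invfM.
  by rewrite -[true%:R]/(1 : R); ring.
split=> [/is_derive_mxP zd|[/is_derive_mxP ld /is_derive_mxP rd]].
  split; apply/is_derive_mxP => i j; rewrite ord1.
    have := zd 0 (lshift m j); rewrite El.
    by rewrite (_ : (fun y => lsubmx _ _ _) = fun y => z y 0 (lshift m j)) //;
      apply/funext => s; rewrite mxE.
  have := zd 0 (rshift m j); rewrite Er.
  by rewrite (_ : (fun y => rsubmx _ _ _) = fun y => z y 0 (rshift m j)) //;
    apply/funext => s; rewrite mxE.
apply/is_derive_mxP => i j; rewrite ord1; case: (split_ordP j) => l ->.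
  have := ld 0 l; rewrite El.
  by rewrite (_ : (fun y => lsubmx _ _ _) = fun y => z y 0 (lshift m l)) //;
    apply/funext => s; rewrite mxE.
have := rd 0 l; rewrite Er.
by rewrite (_ : (fun y => rsubmx _ _ _) = fun y => z y 0 (rshift m l)) //;
  apply/funext => s; rewrite mxE.
Qed.

(* A curve [Y], with covector [X] along it, satisfying the geodesic equations of
   the Hamiltonian [h / 2] up to the reparametrization term [lam X]. *)
Definition pregeodesic_pair (Y X : R -> E) (lam t : R) : Prop :=
  is_derive t 1 Y (X t *m h (Y t)) /\
  is_derive t 1 X (lam *: X t - 2^-1 *: quad h (X t) (Y t)).

(* We look for [X = (df / f + w) / r] with [f (Y t) = t]; the scalar [r] is
   chosen so that [df(Y') = 1]. *)
Theorem local_existence (p : E) : O p -> f p = 0 ->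
  exists (e : R) (Y X : R -> E) (lam : R -> R),
    [/\ 0 < e, Y 0 = p, smooth_on `]-e, e[%classic Y,
      forall t, t \in `]-e, e[ -> O (Y t) /\ f (Y t) = t &
      smooth_on (`]-e, e[%classic `&` [set t | t != 0]) lam /\
      forall t, t \in `]-e, e[ -> t != 0 -> pregeodesic_pair Y X (lam t) t].
Proof.
move=> Op fp.
pose y (z : 'rV[R]_(m + m)) : E := lsubmx z; pose w (z : 'rV[R]_(m + m)) : E := rsubmx z.
pose c z := k (y z) + dot (n (y z)) (w z).
pose r z := 1 + f (y z) * c z.
pose A0 := y @^-1` O.
have yC i : Cn i setT y by apply: (Cn_lsubmx openT); exact: Cn_id.
have wC i : Cn i setT w by apply: (Cn_rsubmx openT); exact: Cn_id.
have oA0 : open A0.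
  by apply: open_comp => // z _; exact: (Cn_cont (yC 0%N)).
have yC0 i : Cn i A0 y by apply: Cn_sub (yC i).
have wC0 i : Cn i A0 w by apply: Cn_sub (wC i).
have nC0 i : Cn i A0 (fun z => n (y z)).
  exact: (Cn_comp oA0 oO (fun _ => id) (yC0 i) (pm_n PM i)).
have cC0 i : Cn i A0 c.
  apply: (CnD oA0); last exact: Cn_dot.
  exact: (Cn_comp_scalar oA0 oO (fun _ => id) (yC0 i) (pm_k PM i)).
have rC0 i : Cn i A0 r.
  apply: (CnD oA0); first exact: Cn_cst; apply: (CnM oA0) => //.
  exact: (Cn_comp_scalar oA0 oO (fun _ => id) (yC0 i) (pm_f PM i)).
pose A := A0 `&` r @^-1` [set t : R | t != 0].
have oA : open A.
  apply: (@open_setI_preimage _ R A0 [set t : R | t != 0] r oA0); first exact: open_neq.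
  by move=> z Az; exact: (Cn_cont (rC0 0%N)).
have AA0 : A `<=` A0 by move=> z [].
have Ar z : A z -> r z != 0 by move=> [].
have yO z : A z -> O (y z) by move=> [].
have rVC i : Cn i A (fun z => (r z)^-1) by apply: (CnV oA Ar); exact: Cn_sub (rC0 i).
have cC i : Cn i A c by exact: Cn_sub (cC0 i).
have yCA i : Cn i A y by exact: Cn_sub (yC0 i).
have wCA i : Cn i A w by exact: Cn_sub (wC0 i).
have nCA i : Cn i A (fun z => n (y z)) by exact: Cn_sub (nC0 i).
(* Dividing by [r] makes [df(P) = 1] at every [z], so that [f] can serve as time along solutions. *)
pose P z := (r z)^-1 *: (n (y z) + w z *m h (y z)).
pose Q z := (r z)^-1 *: ((c z / 2) *: w z - source h k n (y z) (w z)).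
have FS : smooth_on A (fun z => row_mx (P z) (Q z)).
  move=> i; apply: (Cn_row_mx oA).
    apply: (Cn_scale oA (rVC i)); apply: (CnD oA (nCA i)).
    apply: (Cn_mulmx oA (wCA i)).
    exact: (Cn_comp oA oO yO (yCA i) (pm_h PM i)).
  apply: (Cn_scale oA (rVC i)); apply: (Cn_subm oA).
    apply: (Cn_scale oA) => //; apply: (CnM oA (cC i)); exact: Cn_cst.
  exact: Cn_source.
have Az0 : A (row_mx p 0).
  by split; rewrite /A0 /= /r /y row_mxKl// fp mul0r addr0 oner_neq0.
have [e [z [e0 z0 zS zA zd]]] := singular_ode sing oA Az0 FS.
have oI : open (`]-e, e[%classic : set R) by exact: interval_open.
pose Y t := y (z t); pose W t := w (z t).
have YS : smooth_on `]-e, e[%classic Y by move=> i; exact: (Cn_lsubmx oI (zS i)).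
have WS : smooth_on `]-e, e[%classic W by move=> i; exact: (Cn_rsubmx oI (zS i)).
have YWd t : t \in `]-e, e[ -> t != 0 ->
    is_derive t 1 Y (P (z t)) /\ is_derive t 1 W (Q (z t) - (2 * t)^-1 *: W t).
  by move=> te t0; apply/(is_derive_blocks z p t); exact: zd.
have e0in : (0 : R) \in `]-e, e[ by rewrite in_itv /= oppr_lt0 e0.
have fPE t : t \in `]-e, e[ -> dot (P (z t)) (grad f (Y t)) = 1.
  move=> te; have Az := zA t te; have Oy := yO _ Az.
  rewrite dotZl dotDl (pm_norm PM Oy) (dot_sym (W t) _ (pm_hsym PM Oy)) (pm_grad PM Oy) dotZl.
  by rewrite -addrA -mulrDr -/(c _) -/(r _) mulVf// Ar.
have Y0 : Y 0 = p by rewrite /Y z0 /y row_mxKl.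
(* The derivative of [f o Y] is 1 for [t != 0] by the choice of [P]; the equation says nothing at 0,
   where continuity of the derivative takes over. *)
have YE t : t \in `]-e, e[ -> f (Y t) = t.
  move=> te; have phd s : s \in `]-e, e[ -> is_derive s 1 (fun s => f (Y s) - s) 0.
    move=> se; have Os := yO _ (zA s se).
    have Yd := Cn_is_derive (1 : R) (YS 1%N) se.
    have fYd := is_derive_comp_scalar (g := Y) oO Os (pm_f PM 1%N) Yd.
    have := is_deriveB fYd (is_derive_id s 1) => h1; apply: (is_derive_eq h1).
    rewrite (derive_grad _ oO Os (pm_f PM 1%N)).
    have DC : Cn 0 `]-e, e[%classic (fun s => const_mx (dot ('D_1 Y s) (grad f (Y s)) - 1) : 'M[R]_1).
      apply/(Cn_mxP _ _ oI) => i j.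
      apply: (Cn_eq oI (f := fun s : R => dot ('D_1 Y s) (grad f (Y s)) - 1)).
        by move=> x _; rewrite mxE.
      apply: (CnB oI); last exact: Cn_cst.
      apply: (Cn_dot oI (Cn_derive (1 : R) (YS 1%N))).
      by apply: (Cn_comp oI oO _ (YS 0%N) (Cn_grad oO (pm_f PM 1%N))) => x /zA/yO.
    have D1 s' : s' \in `]-e, e[ -> s' != 0 -> dot ('D_1 Y s') (grad f (Y s')) = 1.
      by move=> s'e s'0; have [[_ ->] _] := YWd s' s'e s'0; exact: fPE.
    have [->|s0] := eqVneq s 0; last by rewrite D1// subrr.
    have nD : \forall t \near (0 : R)^',
        const_mx (dot ('D_1 Y t) (grad f (Y t)) - 1) = 0 :> 'M[R]_1.
      near=> x; apply/matrixP => i j; rewrite !mxE D1 ?subrr//; near: x.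
        by apply: cvg_within; exact: (near_in_itvoo e0in).
      exact: nbhs_dnbhs_neq.
    by have /matrixP/(_ 0 0) := continuous_punctured_eq0 (Cn_cont DC e0in) nD; rewrite !mxE.
  have := is_derive0_cst phd te; rewrite Y0 fp subr0.
  by move/eqP; rewrite subr_eq0 => /eqP.
pose rt t := r (z t).
have zA' t : (`]-e, e[%classic : set R) t -> A0 (z t) by move=> te; exact: (zA t te).1.
have rtS : smooth_on `]-e, e[%classic rt.
  by move=> i; exact: (Cn_comp_scalar oI oA0 zA' (zS i) (rC0 i)).
have rt0 t : t \in `]-e, e[ -> rt t != 0 by move=> te; exact: Ar (zA t te).
pose xi t := t^-1 *: grad f (Y t) + W t.
(* [lam] is tuned to the poles of [quad_split]. With [r = 1 + t c], the coefficients of [df] add up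
   to [- (1 + t c) / (r t^2) = - 1 / t^2], the derivative of [1 / t], and the Hessian terms cancel.
   On [W] there remains [- 1 / (2 t r)], that is [- 1 / (2 t)] plus the regular term [c / (2 r)]. *)
exists e, Y, (fun t => (rt t)^-1 *: xi t),
  (fun t => - ((2 * t)^-1 + 'D_1 rt t) / rt t).
split => //.
  by move=> t te; split; [exact: yO (zA t te)|exact: YE].
have oI0 : open (`]-e, e[%classic `&` [set t : R | t != 0]).
  by apply: openI => //; exact: open_neq.
have sI0 : `]-e, e[%classic `&` [set t : R | t != 0] `<=` (`]-e, e[%classic : set R).
  by move=> t [].
split=> [i|t te t0].
  apply: (CnM oI0).
    apply: (CnN oI0); apply: (CnD oI0); last exact: Cn_sub (Cn_derive (1 : R) (rtS i.+1)).
    apply: (CnV oI0) => [t [_ /= t0]|]; first by rewrite mulf_neq0.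
    by apply: (CnM oI0); [exact: Cn_cst|exact: Cn_id].
  by apply: (CnV oI0) => [t [te _]|]; [exact: rt0|exact: Cn_sub (rtS i)].
have [Yd Wd] := YWd t te t0.
have Oy := yO _ (zA t te); have ft := YE t te; have r0 := rt0 t te.
have f0 : f (Y t) != 0 by rewrite ft.
split.
  rewrite -scalemxAl mulmxDl -scalemxAl (pm_grad PM Oy) ft scalerA mulVf// scale1r.
  exact: Yd.
have gd := is_derive_comp (g := Y) oO Oy (Cn_grad oO (pm_f PM 2%N)) Yd.
have td : is_derive t 1 (fun t : R => t^-1) (- t ^- 2 *: 1) := is_deriveV t0 (is_derive_id t 1).
have xid : is_derive t 1 xi _ := is_deriveD (is_derive_scalemx td gd) Wd.
have rd := is_deriveV r0 (Cn_is_derive (1 : R) (rtS 1%N) te).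
have Xd := is_derive_scalemx rd xid.
apply: (is_derive_eq Xd) => {Xd rd xid td}.
have Hlin : 'D_(P (z t)) (grad f) (Y t) =
    (rt t)^-1 *: 'D_(n (Y t) + W t *m h (Y t)) (grad f) (Y t).
  have [_] := is_derive_scale_dir (rt t)^-1
    (Cn_derivable (n (Y t) + W t *m h (Y t)) (Cn_grad oO (pm_f PM 2%N)) Oy).
  by move=> <-.
have key := quad_split PM (W t) Oy f0; rewrite ft -/(xi t) -/(c _) in key.
rewrite quadZ [2^-1 *: _]scalerA [2^-1 * _]mulrC -[_ *: quad _ _ _]scalerA key Hlin {key}.
have rE : rt t = 1 + t * c (z t) by rewrite /rt /r -/(Y t) ft.
rewrite /Q -/(rt t) -/(Y t) -/(W t) /xi; move: r0; rewrite rE.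
move: ('D_(n (Y t) + W t *m h (Y t)) (grad f) (Y t)) ('D_1 rt t) (source _ _ _ _ _) => H r' S.
move: (grad f (Y t)) (W t) (c (z t)) => g v cc r0.
apply/rowP => j; rewrite !mxE /GRing.scale /=.
by field; rewrite r0 t0.
Unshelve. all: by end_near. Qed.

End LocalExistence.

(** * Uniqueness of the crossing curve parametrized by [f] *)

Section LocalUniqueness.
Context {R : realType} {m : nat}.
Local Notation E := 'rV[R]_m.
Local Notation e_ l := (delta_mx 0 l : E).
Variables (O : set E) (h B : E -> 'M[R]_m) (f k : E -> R) (n : E -> E).
Hypothesis PM : polar_model O h B f k n.
Let oO : open O := pm_open PM.

(* Since [B / f] is the metric and [f (Y t) = t], [X] is the covector [g(Y', .)]. *)
Record crossing_curve (p : E) (e : R) (Y X : R -> E) (lam : R -> R) : Prop := {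
  cc_e : 0 < e;
  cc_0 : Y 0 = p;
  cc_S : smooth_on `]-e, e[%classic Y;
  cc_O : forall t, t \in `]-e, e[ -> O (Y t);
  cc_f : forall t, t \in `]-e, e[ -> f (Y t) = t;
  cc_X : forall t, t \in `]-e, e[ -> t != 0 -> X t = t^-1 *: ('D_1 Y t *m B (Y t));
  cc_eq : forall t, t \in `]-e, e[ -> t != 0 ->
    is_derive t 1 X (lam t *: X t - 2^-1 *: quad h (X t) (Y t)) }.

Let y (z : 'rV[R]_(m + m)) : E := lsubmx z.

(* In the gauge [X = df / f + w] the multiplier [lam] is eliminated by
   differentiating the constraint [n(w) + k = 0]; then [w + k df] satisfies a
   singular equation of the same shape as in [local_existence]. *)
Let w z : E := rsubmx z - k (y z) *: grad f (y z).
Let v z : E := n (y z) + w z *m h (y z).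
Let S z : E := source h k n (y z) (w z).
(** Read off from the differentiated constraint, which gives [lam = - 1/(2t) - k/2 + t T]. *)
Let T z : R := dot (n (y z)) (S z) - dot ('D_(v z) n (y z)) (w z) - dot (v z) (grad k (y z)).
Let Q z : E := (T z + dot (v z) (grad k (y z))) *: grad f (y z)
  + (f (y z) * T z - k (y z) / 2) *: w z + k (y z) *: 'D_(v z) (grad f) (y z) - S z.
Let A : set 'rV[R]_(m + m) := y @^-1` O.
Let F z : 'rV[R]_(m + m) := row_mx (v z) (Q z).
Let sing (i : 'I_(m + m)) : bool := (m <= i)%N.

Let oA : open A.
Proof.
apply: open_comp => // z _.
exact: (Cn_cont (Cn_lsubmx openT (Cn_id 0 setT))).
Qed.

Let FS : smooth_on A F.
Proof.
move=> i; have AO z : A z -> O (y z) by [].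
have yC : Cn i A y by exact: (Cn_lsubmx oA (Cn_id i A)).
have gC : Cn i A (fun z => grad f (y z)).
  exact: (Cn_comp oA oO AO yC (Cn_grad oO (pm_f PM i.+1))).
have kC : Cn i A (fun z => k (y z)) by exact: (Cn_comp_scalar oA oO AO yC (pm_k PM i)).
have gkC : Cn i A (fun z => grad k (y z)).
  exact: (Cn_comp oA oO AO yC (Cn_grad oO (pm_k PM i.+1))).
have nC : Cn i A (fun z => n (y z)) by exact: (Cn_comp oA oO AO yC (pm_n PM i)).
have fC : Cn i A (fun z => f (y z)) by exact: (Cn_comp_scalar oA oO AO yC (pm_f PM i)).
have wC : Cn i A w.
  by apply: (Cn_subm oA (Cn_rsubmx oA (Cn_id i A))); exact: (Cn_scale oA kC gC).
have vC : Cn i A v.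
  apply: (CnD oA nC); apply: (Cn_mulmx oA wC).
  exact: (Cn_comp oA oO AO yC (pm_h PM i)).
have SC : Cn i A S by exact: (Cn_source PM oA AO yC wC).
have vkC : Cn i A (fun z => dot (v z) (grad k (y z))) by exact: (Cn_dot oA vC gkC).
have TC : Cn i A T.
  apply: (CnB oA (CnB oA (Cn_dot oA nC SC) _) vkC).
  exact: (Cn_dot oA (Cn_derive_along oA oO AO yC vC (pm_n PM i.+1)) wC).
have QC : Cn i A Q.
  apply: (Cn_subm oA _ SC); apply: (CnD oA); first apply: (CnD oA).
  - exact: (Cn_scale oA (CnD oA TC vkC) gC).
  - apply: (Cn_scale oA _ wC); apply: (CnB oA (CnM oA fC TC)).
    exact: (CnM oA kC (Cn_cst i A _)).
  - exact: (Cn_scale oA kC (Cn_derive_along oA oO AO yC vC (Cn_grad oO (pm_f PM i.+2)))).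
exact: (Cn_row_mx oA vC QC).
Qed.

(** [lam] is not controlled at 0, so the regular part of the covector is read off from the smooth
    curve [Y] alone; the equation off 0 then identifies it, up to [k df], as the bounded solution of
    a singular system. *)
Lemma crossing_curve_normal_form p e Y X lam : f p = 0 -> crossing_curve p e Y X lam ->
  'D_1 Y 0 = n p /\ exists z : R -> 'rV[R]_(m + m),
   [/\ forall t, y (z t) = Y t, z 0 = row_mx p 0, {for 0, continuous z} &
    forall t, t \in `]-e, e[ -> t != 0 -> is_derive t 1 z (F (z t) -
      \row_i ((sing i)%:R / 2 * ((z t 0 i - row_mx p 0 0 i) / t)))].
Proof.
move=> fp CC; have e0 := cc_e CC; have YS := cc_S CC; have YO := cc_O CC; have Yf := cc_f CC.
have oI : open (`]-e, e[%classic : set R) by exact: interval_open.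
have e0in : (0 : R) \in `]-e, e[ by rewrite in_itv /= oppr_lt0 e0.
have YO' t : (`]-e, e[%classic : set R) t -> O (Y t) by exact: YO.
have Yd t : t \in `]-e, e[ -> is_derive t 1 Y ('D_1 Y t).
  by move=> te; exact: (Cn_is_derive (1 : R) (YS 1%N) te).
have gd t : t \in `]-e, e[ -> is_derive t 1 (fun t => grad f (Y t)) ('D_('D_1 Y t) (grad f) (Y t)).
  by move=> te; exact: (is_derive_comp (g := Y) oO (YO t te) (Cn_grad oO (pm_f PM 2%N)) (Yd t te)).
have Y1 t : t \in `]-e, e[ -> dot ('D_1 Y t) (grad f (Y t)) = 1.
  move=> te; rewrite -(derive_grad _ oO (YO t te) (pm_f PM 1%N)).
  have fYd := is_derive_comp_scalar (g := Y) oO (YO t te) (pm_f PM 1%N) (Yd t te).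
  exact: (is_derive_unique_on oI te Yf fYd (is_derive_id t 1)).
(* [N] is [t X - df] for [t != 0]. It vanishes at 0, where [B] is the square of [df] and
   [df(Y') = 1]; hence [N / t] is smooth. *)
pose N t : E := 'D_1 Y t *m B (Y t) - grad f (Y t).
have gYS i : Cn i `]-e, e[%classic (fun t => grad f (Y t)).
  exact: (Cn_comp oI oO YO' (YS i) (Cn_grad oO (pm_f PM i.+1))).
have Y'S i : Cn i `]-e, e[%classic ('D_1 Y) by exact: (Cn_derive (1 : R) (YS i.+1)).
have NS : smooth_on `]-e, e[%classic N.
  move=> i; apply: (Cn_subm oI _ (gYS i)); apply: (Cn_mulmx oI (Y'S i)).
  exact: (Cn_comp oI oO YO' (YS i) (pm_B PM i)).
have N0 : N 0 = 0.
  rewrite /N; have fY0 := Yf 0 e0in; rewrite (pm_B0 PM (YO 0 e0in) fY0) row_dyad Y1//.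
  by rewrite scale1r subrr.
(* The Hadamard quotient [N / t], written as the mean of [N'] between 0 and [t]. *)
pose om t : E := \row_j average false (fun s => 'D_1 N s 0 j) t.
have DNS i j : Cn i `]-e, e[%classic (fun s => 'D_1 N s 0 j).
  exact: (Cn_entry 0 j oI (Cn_derive (1 : R) (NS i.+1))).
have omS i : Cn i `]-e, e[%classic om.
  by apply: (Cn_row oI) => j; exact: Cn_average.
have omE t : t \in `]-e, e[ -> t *: om t = N t.
  move=> te; apply/rowP => j; rewrite !mxE.
  pose ph s := s * average false (fun s => 'D_1 N s 0 j) s - N s 0 j.
  have phd s : s \in `]-e, e[ -> is_derive s 1 ph 0.
    move=> se; have Nd := Cn_is_derive (1 : R) (NS 1%N) se.
    have /is_derive_mxP /(_ 0 j) Njd := Nd.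
    have ad := is_derive_average false (DNS 0%N j) se.
    by apply: (is_derive_eq (is_deriveB ad Njd)); rewrite mul0r mul0r subr0 subrr.
  have N0j : N 0 0 j = 0 by rewrite N0 mxE.
  have := is_derive0_cst phd te; rewrite /ph mul0r N0j subr0 => /eqP.
  by rewrite subr_eq0 => /eqP ->; rewrite /N !mxE.
have XE t : t \in `]-e, e[ -> t != 0 -> X t = t^-1 *: grad f (Y t) + om t.
  move=> te t0; apply: (scalerI t0); rewrite (cc_X CC te t0) scalerDr !scalerA divff// !scale1r.
  by rewrite omE// /N addrC subrK.
have Y'E t : t \in `]-e, e[ -> t != 0 -> 'D_1 Y t = n (Y t) + om t *m h (Y t).
  move=> te t0; have Oy := YO t te; apply: (scalerI t0).
  rewrite scalerDr scalemxAl omE// /N mulmxBl -mulmxA (pm_Bh PM Oy) (pm_grad PM Oy) Yf//.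
  by rewrite mul_mx_scalar addrC subrK.
(* With [Y' = n + om h], the relation [df(Y') = 1] reads [1 + t (k + n . om) = 1]. *)
have con t : t \in `]-e, e[ -> t != 0 -> dot (n (Y t)) (om t) + k (Y t) = 0.
  move=> te t0; have Oy := YO t te; have := Y1 t te; rewrite Y'E// dotDl (pm_norm PM Oy).
  rewrite (dot_sym _ _ (pm_hsym PM Oy)) (pm_grad PM Oy) dotZl Yf// -addrA -mulrDr.
  move=> /eqP; rewrite -subr_eq0 addrAC subrr add0r mulf_eq0 (negbTE t0) /= => /eqP <-.
  by rewrite addrC.
(* The equation for [om] alone keeps a pole [- k / (2 t)] along [df]; adding [k df] absorbs it. *)
pose z t := row_mx (Y t) (om t + k (Y t) *: grad f (Y t)).
have yz t : y (z t) = Y t by rewrite /y /z row_mxKl.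
have wz t : w (z t) = om t by rewrite /w yz /z row_mxKr addrK.
have zS i : Cn i `]-e, e[%classic z.
  apply: (Cn_row_mx oI (YS i)); apply: (CnD oI (omS i)); apply: (Cn_scale oI _ (gYS i)).
  exact: (Cn_comp_scalar oI oO YO' (YS i) (pm_k PM i)).
have vz t : t \in `]-e, e[ -> t != 0 -> v (z t) = 'D_1 Y t.
  by move=> te t0; rewrite /v wz yz -Y'E.
pose omt t := om t + k (Y t) *: grad f (Y t).
have omtd t : t \in `]-e, e[ -> t != 0 -> is_derive t 1 omt (Q (z t) - (2 * t)^-1 *: omt t).
  move=> te t0; have Oy := YO t te; have ft := Yf t te.
  have omd := Cn_is_derive (1 : R) (omS 1%N) te.
  have kd := is_derive_comp_scalar (g := Y) oO Oy (pm_k PM 1%N) (Yd t te).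
  have nd := is_derive_comp (g := Y) oO Oy (pm_n PM 1%N) (Yd t te).
  apply: (is_derive_eq (is_deriveD omd (is_derive_scalemx kd (gd t te)))).
  have oI0 : open (`]-e, e[%classic `&` [set t : R | t != 0]).
    by apply: openI => //; exact: open_neq.
  have td : is_derive t 1 (fun t : R => t^-1) (- t ^- 2 *: 1) := is_deriveV t0 (is_derive_id t 1).
  have X'E := is_derive_unique_on oI0 (conj te t0) (fun s ss => XE s ss.1 ss.2)
    (cc_eq CC te t0) (is_deriveD (is_derive_scalemx td (gd t te)) omd).
  have con' := is_derive_unique_on oI0 (conj te t0) (fun s ss => con s ss.1 ss.2)
    (is_deriveD (is_derive_dot nd omd) kd) (is_derive_cst (0 : R) t 1).
  have f0 : f (Y t) != 0 by rewrite ft.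
  have key := quad_split PM (om t) Oy f0; rewrite ft -XE// -Y'E// in key.
  have dnX : dot (n (Y t)) (X t) = t^-1.
    rewrite XE// dotDr dotZr (pm_norm PM Oy) ft -[RHS]addr0 -(con t te t0).
    by rewrite mulrDr mulr1 mulrA mulVf// mul1r addrAC addrA.
  have dnom : dot (n (Y t)) (om t) = - k (Y t) by apply/eqP; rewrite -addr_eq0 con.
  rewrite /Q /T /S vz// wz yz ft.
  rewrite (derive_grad _ oO Oy (pm_k PM 1%N)) in con' *.
  set sc := source h k n (Y t) (om t) in key *.
  (* Compares two derivatives of [X], from its equation and from [X = df / t + om]; the Hessian
     terms cancel. *)
  have omD : 'D_1 om t = lam t *: X t + (2^-1 / t ^+ 2) *: grad f (Y t) - sc.
    move: X'E; rewrite key dnom subrr mul0r addr0 => {key}.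
    move: sc => s.
    move: ('D_('D_1 Y t) (grad f) (Y t)) ('D_1 om t) (lam t *: X t) (grad f (Y t)) => H o x g.
    move=> E0; apply/rowP => j; move/rowP/(_ j): E0; rewrite !mxE /GRing.scale /=.
    rewrite mulr1 => E0; rewrite -[LHS](addKr (- t ^- 2 * g 0 j + t^-1 * H 0 j)) -E0.
    by field.
  (* The pairing of [n] with [X] is [1 / t], so the differentiated constraint can be solved for
     [lam]. *)
  have lamE : lam t = - (2 * t)^-1 - k (Y t) / 2 + t * (dot (n (Y t)) sc
      - dot ('D_('D_1 Y t) n (Y t)) (om t) - dot ('D_1 Y t) (grad k (Y t))).
    move: con'; rewrite omD !(dotDr, dotNr, dotZr) dnX (pm_norm PM Oy) ft.
    move: (dot ('D_('D_1 Y t) n (Y t)) _) (dot (n (Y t)) sc) (dot ('D_1 Y t) _) => a b c E0.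
    apply: (mulIf (invr_neq0 t0)); apply/eqP; rewrite -subr_eq0 -E0; apply/eqP.
    by field.
  rewrite omD lamE XE// /omt => {key X'E con' omD lamE}.
  move: (dot ('D_('D_1 Y t) n (Y t)) _) (dot (n (Y t)) sc) (dot ('D_1 Y t) _) => a b c.
  move: ('D_('D_1 Y t) (grad f) (Y t)) (om t) (grad f (Y t)) sc (k (Y t)) => H o g s kk.
  by apply/rowP => j; rewrite !mxE; field.
(* Multiplying the equation by [t] and letting [t] tend to 0 leaves [omt 0 / 2 = 0]: smoothness of
   the curve fixes the initial value. *)
have omt0 : omt 0 = 0.
  pose D t := t *: 'D_1 omt t + 2^-1 *: omt t - t *: Q (z t).
  have omtS i : Cn i `]-e, e[%classic omt.
    apply: (CnD oI (omS i)); apply: (Cn_scale oI _ (gYS i)).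
    exact: (Cn_comp_scalar oI oO YO' (YS i) (pm_k PM i)).
  have QS : Cn 0 `]-e, e[%classic (fun t => Q (z t)).
    have FzS : Cn 0 `]-e, e[%classic (fun t => rsubmx (F (z t))).
      apply: (Cn_rsubmx oI); apply: (Cn_comp (f := F) oI oA _ (zS 0%N) (FS 0%N)).
      by move=> t te; rewrite /A /= yz; exact: YO.
    by apply: (Cn_eq oI) FzS => t _; rewrite row_mxKr.
  have DS : Cn 0 `]-e, e[%classic D.
    apply: (Cn_subm oI); first apply: (CnD oI).
    - exact: (Cn_scale oI (Cn_id 0 _) (Cn_derive (1 : R) (omtS 1%N))).
    - exact: (Cn_scale oI (Cn_cst 0 _ _) (omtS 0%N)).
    - exact: (Cn_scale oI (Cn_id 0 _) QS).
  have nD : \forall t \near (0 : R)^', D t = 0.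
    near=> t; have te : t \in `]-e, e[.
      by near: t; apply: cvg_within; exact: (near_in_itvoo e0in).
    have t0 : t != 0 by near: t; exact: nbhs_dnbhs_neq.
    rewrite /D; have [_ ->] := omtd t te t0.
    move: (Q (z t)) (omt t) => q o; apply/rowP => j; rewrite !mxE; field; exact: t0.
  have := continuous_punctured_eq0 (Cn_cont DS e0in) nD.
  rewrite /D !scale0r add0r subr0 => /eqP; rewrite scaler_eq0 invr_eq0 => /orP[|/eqP//].
  by rewrite pnatr_eq0.
have z0 : z 0 = row_mx p 0 by rewrite /z -/(omt 0) omt0 (cc_0 CC).
split; last first.
  exists z; split => // [|t te t0]; first exact: (Cn_cont (zS 0%N)).
  apply/is_derive_blocks; split.
    rewrite (_ : (fun s => lsubmx (z s)) = Y); last by apply/funext => s; rewrite row_mxKl.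
    by rewrite vz//; exact: Yd.
  rewrite (_ : (fun s => rsubmx (z s)) = omt); last by apply/funext => s; rewrite row_mxKr.
  by rewrite row_mxKr; exact: omtd.
(* At 0, [om = - k df] and [df h = f n = 0], so only [n] is left in the velocity. *)
pose D t := 'D_1 Y t - (n (Y t) + om t *m h (Y t)).
have DS : Cn 0 `]-e, e[%classic D.
  apply: (Cn_subm oI (Y'S 0%N)); apply: (CnD oI).
    exact: (Cn_comp oI oO YO' (YS 0%N) (pm_n PM 0%N)).
  apply: (Cn_mulmx oI (omS 0%N)).
  exact: (Cn_comp oI oO YO' (YS 0%N) (pm_h PM 0%N)).
have nD : \forall t \near (0 : R)^', D t = 0.
  near=> t; rewrite /D -Y'E ?subrr//; near: t.
    by apply: cvg_within; exact: (near_in_itvoo e0in).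
  exact: nbhs_dnbhs_neq.
have := continuous_punctured_eq0 (Cn_cont DS e0in) nD.
rewrite /D => /eqP; rewrite subr_eq0 => /eqP ->.
have -> : om 0 = - (k (Y 0) *: grad f (Y 0)).
  by apply/eqP; rewrite -addr_eq0 -/(omt 0) omt0.
rewrite mulNmx -scalemxAl (pm_grad PM (YO 0 e0in)) Yf// scale0r scaler0 subr0.
by rewrite (cc_0 CC).
Unshelve. all: by end_near. Qed.

Theorem crossing_curve_unique p e1 e2 Y1 X1 lam1 Y2 X2 lam2 : f p = 0 ->
  crossing_curve p e1 Y1 X1 lam1 -> crossing_curve p e2 Y2 X2 lam2 ->
  exists2 a : R, 0 < a & forall t, t \in `]-a, a[ -> Y1 t = Y2 t.
Proof.
move=> fp C1 C2.
have [_ [z1 [yz1 z10 z1c z1d]]] := crossing_curve_normal_form fp C1.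
have [_ [z2 [yz2 z20 z2c z2d]]] := crossing_curve_normal_form fp C2.
pose e := Num.min e1 e2.
have e0 : 0 < e by rewrite lt_min (cc_e C1) (cc_e C2).
have sub t : t \in `]-e, e[ -> (t \in `]-e1, e1[) /\ (t \in `]-e2, e2[).
  by rewrite !in_itv /= -!ltr_norml lt_min => /andP[].
have Ap : A (row_mx p 0).
  rewrite /A /= /y row_mxKl -(cc_0 C1); apply: (cc_O C1).
  by rewrite in_itv /= oppr_lt0 (cc_e C1).
have [a a0 aP] := @singular_ode_unique _ _ A F (row_mx p 0) sing e z1 z2 oA Ap (FS 1%N) e0
  z10 z20 z1c z2c (fun t te => z1d t (sub t te).1) (fun t te => z2d t (sub t te).2).
by exists a => // t ta; rewrite -yz1 -yz2 aP.
Qed.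

End LocalUniqueness.

(** * Connections and changes of charts *)

Section Christoffel.
Context {R : realType} {m : nat}.
Local Notation E := 'rV[R]_m.
Local Notation e_ l := (delta_mx 0 l : E).

Lemma schwarz_mx p q (A : set E) (F : E -> 'M[R]_(p, q)) x u v :
  open A -> A x -> Cn 2 A F -> 'D_u ('D_v F) x = 'D_v ('D_u F) x.
Proof.
move=> oA Ax FC; apply/matrixP => i j.
have FCij : Cn 2 A (fun y => F y i j) by exact: (Cn_entry i j oA FC).
have dE a b : 'D_a ('D_b F) x i j = 'D_a ('D_b (fun y => F y i j)) x.
  rewrite derive_mxE; last exact: (Cn_derivable a (Cn_derive b FC) Ax).
  apply: near_eq_derive; near=> y; rewrite derive_mxE//.
  by apply: (Cn_derivable b FC); near: y; exact: open_nbhs_nbhs.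
have S := schwarz u v oA Ax FCij.
have d1 := dE u v; have d2 := dE v u.
exact: (etrans d1 (etrans S (esym d2))).
Unshelve. all: by end_near. Qed.

Lemma derive_jacobian (A : set E) (F : E -> E) x v :
  open A -> A x -> Cn 1 A F -> 'D_v F x = v *m jacobian F x.
Proof. by move=> oA Ax FC; apply: deriveEjacobian; exact: Cn1_differentiable FC. Qed.

Lemma Cn_jacobian i (A : set E) (F : E -> E) : open A -> Cn i.+1 A F -> Cn i A (jacobian F).
Proof.
move=> oA FC; apply/(Cn_mxP _ _ oA) => a b.
apply: (Cn_eq oA (f := fun x => 'D_(e_ a) F x 0 b)); last first.
  exact: (Cn_entry 0 b oA (Cn_derive (e_ a) FC)).
move=> x Ax; rewrite (derive_jacobian _ oA Ax (Cn_leq _ FC))//.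
by rewrite -rowE mxE.
Qed.

Lemma derive_jacobian2 (A : set E) (F : E -> E) x u v :
  open A -> A x -> Cn 2 A F -> v *m 'D_u (jacobian F) x = 'D_u ('D_v F) x.
Proof.
move=> oA Ax FC; have Jd := Cn_is_derive u (Cn_jacobian oA FC) Ax.
have h1 := is_derive_mulmx (is_derive_cst v x u) Jd; rewrite mul0mx add0r in h1.
apply: (is_derive_unique_on oA Ax _ h1 (Cn_is_derive u (Cn_derive v FC) Ax)).
by move=> y Ay; rewrite (derive_jacobian _ oA Ay (CnW FC)).
Qed.

Lemma ev02E (G : 'M[R]_m) u v : ev02 G u v = dot (u *m G) v.
Proof. by []. Qed.

Definition lowered_christoffel (G : E -> 'M[R]_m) (y v w : E) : E :=
  2^-1 *: (w *m 'D_v G y + v *m 'D_w G y - \row_l ev02 ('D_(e_ l) G y) v w).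

Lemma christoffel_lowered (G : E -> 'M[R]_m) (y v w : E) : G y \in unitmx ->
  christoffel G y v w *m G y = lowered_christoffel G y v w.
Proof. by move=> Gu; rewrite /christoffel mulmxKV. Qed.

Lemma lowered_christoffel_dot (A : set E) (G : E -> 'M[R]_m) (y v w z : E) :
  open A -> A y -> Cn 1 A G ->
  dot (lowered_christoffel G y v w) z =
  2^-1 * (ev02 ('D_v G y) w z + ev02 ('D_w G y) v z - ev02 ('D_z G y) v w).
Proof.
move=> oA Ay GC; rewrite /lowered_christoffel dotZl.
rewrite dotDl.
rewrite dotNl.
rewrite dotDl.
congr (_ * (_ - _)); rewrite (derive_dirE z oA Ay GC) ev02E mulmx_sumr dotC.
have -> : dot (\sum_i v *m (z 0 i *: 'D_(e_ i) G y)) w =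
    \sum_i z 0 i * dot (v *m 'D_(e_ i) G y) w.
  rewrite dotC (eq_bigr (fun i => z 0 i *: (v *m 'D_(e_ i) G y))).
    by rewrite dot_sumr; apply: eq_bigr => i _; rewrite dotC.
  by move=> i _; rewrite scalemxAr.
by rewrite dotE; apply: eq_bigr => i _; rewrite mxE ev02E.
Qed.

Section ChangeOfCoordinates.
Variables (A A' : set E) (ph : E -> E) (G G' : E -> 'M[R]_m).
Hypotheses (oA : open A) (oA' : open A') (phA : forall y, A y -> A' (ph y)).
Hypotheses (phC : Cn 2 A ph) (GC : Cn 1 A G) (GC' : Cn 1 A' G').
Hypothesis GE : forall y, A y -> G y = jacobian ph y *m G' (ph y) *m (jacobian ph y)^T.
Hypothesis Gsym : forall y, A' y -> (G' y)^T = G' y.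
Hypothesis Gunit : forall y, A y -> G y \in unitmx.

Lemma jacobian_unit y : A y -> jacobian ph y \in unitmx.
Proof.
by move=> Ay; move: (Gunit Ay); rewrite GE// !unitmx_mul => /andP[/andP[]].
Qed.

Lemma metric_unit' y : A y -> G' (ph y) \in unitmx.
Proof.
by move=> Ay; move: (Gunit Ay); rewrite GE// !unitmx_mul => /andP[/andP[]].
Qed.

Lemma derive_pullback y u a b : A y ->
  ev02 ('D_u G y) a b =
  ev02 ('D_('D_u ph y) G' (ph y)) ('D_a ph y) ('D_b ph y)
  + ev02 (G' (ph y)) ('D_u ('D_a ph) y) ('D_b ph y)
  + ev02 (G' (ph y)) ('D_a ph y) ('D_u ('D_b ph) y).
Proof.
move=> Ay.
have Gd := Cn_is_derive u GC Ay.
have phd := Cn_is_derive u (CnW phC) Ay.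
have G'd := is_derive_comp (f := G') oA' (phA Ay) GC' phd.
have ad := Cn_is_derive u (Cn_derive a phC) Ay.
have bd := Cn_is_derive u (Cn_derive b phC) Ay.
have h1 := is_derive_dot (is_derive_mulmx (is_derive_cst a y u) Gd) (is_derive_cst b y u).
have h2 := is_derive_dot (is_derive_mulmx ad G'd) bd.
have EE : forall x, A x -> dot (a *m G x) b = dot ('D_a ph x *m G' (ph x)) ('D_b ph x).
  move=> x Ax; rewrite GE// !(derive_jacobian _ oA Ax (CnW phC)).
  by rewrite !mulmxA [LHS]dot_mulmx trmxK.
have := is_derive_unique_on oA Ay EE h1 h2.
rewrite mul0mx add0r dot0r addr0 !ev02E => ->; rewrite dotDl.
by move: (dot _ _) (dot _ _) (dot _ _) => r1 r2 r3; ring.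
Qed.

(** Checked after lowering the index and pairing with an arbitrary [z], which avoids the inverse
    metric. Among the three pulled-back derivatives of the metric, the second derivatives of [ph]
    cancel by symmetry, except for ['D_v ('D_w ph)]. *)
Lemma christoffel_change y v w : A y ->
  christoffel G y v w *m jacobian ph y =
  christoffel G' (ph y) ('D_v ph y) ('D_w ph y) + 'D_v ('D_w ph) y.
Proof.
move=> Ay; have Ju := jacobian_unit Ay; have Gu' := metric_unit' Ay.
have JTu : (jacobian ph y)^T \in unitmx by rewrite unitmx_tr.
apply: (can_inj (mulmxK Gu')); apply: (can_inj (mulmxK JTu)).
rewrite -(mulmxA _ _ (G' (ph y))) -(mulmxA _ (_ *m _)) -GE// christoffel_lowered ?Gunit//.
rewrite mulmxDl christoffel_lowered// mulmxDl.
apply/eqP; rewrite -subr_eq0; apply/eqP; apply: dot_eq0 => z.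
rewrite dotDl dotNl dotDl !(dot_mulmx _ _^T) trmxK -(derive_jacobian z oA Ay (CnW phC)).
have [D DE] : exists D : E -> E, D = fun a => 'D_a ph y by eexists.
have [H HE] : exists H : E -> E -> E, H = fun a b => 'D_a ('D_b ph) y by eexists.
have [B BE] : exists B : E -> E -> R, B = ev02 (G' (ph y)) by eexists.
have [K KE] : exists K : E -> E -> E -> R,
  K = fun a b c => ev02 ('D_('D_a ph y) G' (ph y)) ('D_b ph y) ('D_c ph y) by eexists.
have P a b c : ev02 ('D_a G y) b c = K a b c + B (H a b) (D c) + B (D b) (H a c).
  by rewrite KE BE HE DE; exact: derive_pullback.
have Bsym a b : B a b = B b a.
  by rewrite BE !ev02E (dot_sym a b (Gsym (phA Ay))).
have Hsym a b : H a b = H b a by rewrite HE; exact: (schwarz_mx a b oA Ay phC).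
have -> : dot (lowered_christoffel G y v w) z =
    2^-1 * (ev02 ('D_v G y) w z + ev02 ('D_w G y) v z - ev02 ('D_z G y) v w).
  exact: lowered_christoffel_dot oA Ay GC.
have -> : dot (lowered_christoffel G' (ph y) ('D_v ph y) ('D_w ph y)) ('D_z ph y) =
    2^-1 * (K v w z + K w v z - K z v w).
  by rewrite KE; exact: lowered_christoffel_dot oA' (phA Ay) GC'.
have -> : dot ('D_v ('D_w ph) y *m G' (ph y)) ('D_z ph y) = B (H v w) (D z).
  by rewrite BE HE DE.
rewrite (P v w z) (P w v z) (P z v w) (Hsym z v) (Hsym z w) (Hsym w v) (Bsym (D v) (H w z)) (Bsym (D w) (H v z)).
by field.
Qed.

End ChangeOfCoordinates.

Definition chart_acc (G : E -> 'M[R]_m) (Y : R -> E) (t : R) : E :=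
  'D_1 ('D_1 Y) t + christoffel G (Y t) ('D_1 Y t) ('D_1 Y t).

Lemma christoffelZ (A : set E) (G : E -> 'M[R]_m) y (a : R) v : open A -> A y -> Cn 1 A G ->
  christoffel G y (a *: v) (a *: v) = a ^+ 2 *: christoffel G y v v.
Proof.
move=> oA Ay GC; rewrite /christoffel.
have -> : 'D_(a *: v) G y = a *: 'D_v G y.
  by have [_] := is_derive_scale_dir a (Cn_derivable v GC Ay).
have -> : \row_l ev02 ('D_(e_ l) G y) (a *: v) (a *: v) =
    a ^+ 2 *: \row_l ev02 ('D_(e_ l) G y) v v.
  by apply/rowP => l; rewrite !mxE !ev02E -scalemxAl dotZl dotZr mulrA expr2.
rewrite -!scalemxAl -!scalemxAr scalerA -expr2 -scalerDr -scalerBr.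
by rewrite -scalemxAl scalerA mulrC -scalerA.
Qed.

Lemma derive1_comp_curve (A : set E) (ph : E -> E) (I : set R) (Y : R -> E) t :
  open A -> open I -> (forall s, I s -> A (Y s)) -> I t -> Cn 2 A ph -> Cn 2 I Y ->
  'D_1 (fun s => ph (Y s)) t = 'D_1 Y t *m jacobian ph (Y t) /\
  'D_1 ('D_1 (fun s => ph (Y s))) t =
    'D_1 ('D_1 Y) t *m jacobian ph (Y t) + 'D_('D_1 Y t) ('D_('D_1 Y t) ph) (Y t).
Proof.
move=> oA oI IA It phC YC.
have d1 s : I s -> is_derive s 1 (fun s => ph (Y s)) ('D_1 Y s *m jacobian ph (Y s)).
  move=> Is; rewrite -(derive_jacobian _ oA (IA s Is) (CnW phC)).
  by apply: (is_derive_comp oA (IA s Is) (CnW phC)); exact: (Cn_is_derive (1 : R) (CnW YC)).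
split; first by have [] := d1 t It.
have Yd := Cn_is_derive (1 : R) (CnW YC) It.
have Y2d := Cn_is_derive (1 : R) (Cn_derive (1 : R) YC) It.
have Jd := is_derive_comp (g := Y) oA (IA t It) (Cn_jacobian oA phC) Yd.
have [h1 h2] := is_derive_mulmx Y2d Jd.
rewrite (derive_jacobian2 _ _ oA (IA t It) phC) in h2; rewrite -h2.
apply: near_eq_derive; near=> s.
have Is : I s by near: s; exact: open_nbhs_nbhs.
by have [] := d1 s Is.
Unshelve. all: by end_near. Qed.

Lemma chart_acc_reparam (A : set E) (G : E -> 'M[R]_m) (I J : set R) (Y : R -> E) (s : R -> R) t :
  open A -> open I -> open J -> (forall u, J u -> A (Y u)) -> (forall u, I u -> J (s u)) ->
  I t -> Cn 1 A G -> Cn 2 J Y -> Cn 2 I s ->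
  'D_1 (fun u => Y (s u)) t = 'D_1 s t *: 'D_1 Y (s t) /\
  chart_acc G (fun u => Y (s u)) t =
    'D_1 s t ^+ 2 *: chart_acc G Y (s t) + 'D_1 ('D_1 s) t *: 'D_1 Y (s t).
Proof.
move=> oA oI oJ JA IJ It GC YC sC.
have d1 u : I u -> is_derive u 1 (fun u => Y (s u)) ('D_1 s u *: 'D_1 Y (s u)).
  move=> Iu; apply: (is_derive_chain1 (g := s) (f := Y)).
    exact: (Cn_is_derive (1 : R) (CnW sC)).
  exact: (Cn_is_derive (1 : R) (CnW YC) (IJ u Iu)).
have D1 : 'D_1 (fun u => Y (s u)) t = 'D_1 s t *: 'D_1 Y (s t) by have [] := d1 t It.
split=> //; rewrite /chart_acc D1.
rewrite (christoffelZ _ _ oA (JA _ (IJ t It)) GC) scalerDr addrAC; congr (_ + _).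
have sd := Cn_is_derive (1 : R) (CnW sC) It.
have s2d := Cn_is_derive (1 : R) (Cn_derive (1 : R) sC) It.
have Y2d := is_derive_chain1 sd (Cn_is_derive (1 : R) (Cn_derive (1 : R) YC) (IJ t It)).
have [_] := is_derive_scalemx s2d Y2d.
rewrite /= scalerA -expr2 addrC => <-; apply: near_eq_derive; near=> u.
have Iu : I u by near: u; exact: open_nbhs_nbhs.
by have [] := d1 u Iu.
Unshelve. all: by end_near. Qed.

(** Legendre transform of the geodesic equation: the terms with the derivative of [G] along the
    velocity cancel, and differentiating [G h = 1] turns the remaining derivatives of [G] into those
    of [h]. *)
Lemma is_derive_covelocity (A : set E) (G h : E -> 'M[R]_m) (I : set R) (Y : R -> E) t :
  open A -> open I -> (forall s, I s -> A (Y s)) -> I t ->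
  Cn 1 A G -> Cn 1 A h -> Cn 2 I Y ->
  (forall y, A y -> G y *m h y = 1%:M) -> (forall y, A y -> (G y)^T = G y) ->
  is_derive t 1 (fun s => 'D_1 Y s *m G (Y s))
    (chart_acc G Y t *m G (Y t) - 2^-1 *: quad h ('D_1 Y t *m G (Y t)) (Y t)).
Proof.
move=> oA oI IA It GC hC YC Gh Gsym; have Ay := IA t It.
have [Gu hu] : G (Y t) \in unitmx /\ h (Y t) \in unitmx by exact: (mulmx1_unit (Gh _ Ay)).
have hG : h (Y t) *m G (Y t) = 1%:M by exact: (mulmx1C (Gh _ Ay)).
have Y2d := Cn_is_derive (1 : R) (Cn_derive (1 : R) YC) It.
have Gd := is_derive_comp (g := Y) oA Ay GC (Cn_is_derive (1 : R) (CnW YC) It).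
apply: (is_derive_eq (is_derive_mulmx Y2d Gd)).
rewrite /chart_acc mulmxDl christoffel_lowered// -addrA; congr (_ + _).
set v := 'D_1 Y t.
have -> : quad h (v *m G (Y t)) (Y t) = - \row_l ev02 ('D_(e_ l) G (Y t)) v v.
  apply/rowP => l; rewrite [LHS]mxE [RHS]mxE [X in - X]mxE ev02E.
  have GEd := is_derive_mulmx (Cn_is_derive (e_ l) GC Ay) (Cn_is_derive (e_ l) hC Ay).
  have := is_derive_unique_on oA Ay Gh GEd (is_derive_cst 1%:M (Y t) (e_ l)).
  move=> /eqP; rewrite addrC addr_eq0 => /eqP GD.
  have -> : v *m G (Y t) *m 'D_(e_ l) h (Y t) = - (v *m 'D_(e_ l) G (Y t) *m h (Y t)).
    by rewrite -mulmxA GD mulmxN mulmxA.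
  rewrite dotNl; congr (- _).
  rewrite [LHS]dotC [LHS]dot_mulmx (Gsym _ Ay) -(mulmxA (v *m _)) hG. by rewrite mulmx1 [LHS]dotC.
rewrite /lowered_christoffel; move: (v *m _) (\row_l _) => a b.
by apply/rowP => j; rewrite !mxE; field.
Qed.

End Christoffel.

Lemma mulmx_inj (R : pzRingType) (m n : nat) (A B : 'M[R]_(m, n)) :
  (forall v : 'rV[R]_m, v *m A = v *m B) -> A = B.
Proof. by move=> AB; apply/row_matrixP => i; rewrite !rowE AB. Qed.

(** * Vectors, tensors and curves in charts *)

Section Charts.
Context {R : realType} {m : nat} {M : smoothManifold R m}.
Local Notation E := 'rV[R]_m.
Implicit Types (c : chart R m M) (x : M) (W : set M).

Lemma chart_imageE c W : c @` (W `&` cdom c) = c @` cdom c `&` cinv c @^-1` W.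
Proof.
apply/seteqP; split=> [_ [x [Wx cx] <-]|_ [[x cx <-]]] /=.
  by split; [exists x|rewrite cmapK].
by rewrite cmapK// => Wx; exists x.
Qed.

Lemma open_chart_image c W : open W -> open (c @` (W `&` cdom c)).
Proof.
move=> oW; rewrite chart_imageE; apply: open_setI_preimage => //.
  exact: cimg_open.
exact: cinv_cont.
Qed.

Lemma open_chart_domI c c' : open (c @` (cdom c `&` cdom c')).
Proof. by rewrite setIC; apply: open_chart_image; exact: cdom_open. Qed.

Lemma cmapK_im c y : (c @` cdom c) y -> c (cinv c y) = y.
Proof. by move=> [x cx <-]; rewrite cmapK. Qed.

Lemma cinv_dom c y : (c @` cdom c) y -> cdom c (cinv c y).
Proof. by move=> [x cx <-]; rewrite cmapK. Qed.

Lemma Cn_transition k c c' : atlas c -> atlas c' ->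
  Cn k (c @` (cdom c `&` cdom c')) (c' \o cinv c).
Proof. by move=> ca c'a; exact: (atlas_compat ca c'a). Qed.

Lemma coord_jacE c c' x v : atlas c -> atlas c' -> cdom c x -> cdom c' x ->
  'D_v (c' \o cinv c) (c x) = v *m coord_jac c c' x.
Proof.
move=> ca c'a cx c'x.
apply: (derive_jacobian v (@open_chart_domI c c') _ (Cn_transition 1 ca c'a)).
by exists x.
Qed.

Lemma Cn_coord_jac k c c' : atlas c -> atlas c' ->
  Cn k (c @` (cdom c `&` cdom c')) (fun y => coord_jac c c' (cinv c y)).
Proof.
move=> ca c'a; have oA := @open_chart_domI c c'.
apply: (Cn_eq oA); last exact: (Cn_jacobian oA (Cn_transition k.+1 ca c'a)).
by move=> _ [x [cx c'x] <-]; rewrite /coord_jac cmapK.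
Qed.

Lemma coord_jac_id c x : atlas c -> cdom c x -> coord_jac c c x = 1%:M.
Proof.
move=> ca cx; apply: mulmx_inj => v; rewrite -(coord_jacE v ca ca cx cx) mulmx1.
have Ax : (c @` (cdom c `&` cdom c)) (c x) by exists x.
apply: (is_derive_unique_on (@open_chart_domI c c) Ax (F := c \o cinv c) (G := id)).
- by move=> _ [z [cz _] <-] /=; rewrite cmapK.
- exact: (Cn_is_derive v (Cn_transition 1 ca ca) Ax).
- exact: is_derive_id.
Qed.

Lemma coord_jac_comp c c' c'' x : atlas c -> atlas c' -> atlas c'' ->
  cdom c x -> cdom c' x -> cdom c'' x ->
  coord_jac c c' x *m coord_jac c' c'' x = coord_jac c c'' x.
Proof.
move=> ca c'a c''a cx c'x c''x; apply: mulmx_inj => v.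
have e1 := coord_jacE v ca c'a cx c'x.
have e2 := coord_jacE v ca c''a cx c''x.
have e3 := coord_jacE ('D_v (c' \o cinv c) (c x)) c'a c''a c'x c''x.
move: e1 e2 e3; move: (coord_jac c c' x) (coord_jac c' c'' x) (coord_jac c c'' x) => J1 J2 J3 e1 e2 e3.
rewrite mulmxA; rewrite -e1 -e2 -e3 {J1 J2 J3 e1 e2 e3}.
pose W := cdom c' `&` cdom c''.
have oW : open W by apply: openI; exact: cdom_open.
have oA := @open_chart_image c W oW.
have Ax : (c @` (W `&` cdom c)) (c x) by exists x.
have Ax1 : (c @` (cdom c `&` cdom c')) (c x) by exists x.
have Ax2 : (c @` (cdom c `&` cdom c'')) (c x) by exists x.
have Bx : (c' @` (cdom c' `&` cdom c'')) (c' x) by exists x.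
have d1 := Cn_is_derive v (Cn_transition 1 ca c'a) Ax1.
have Bx' : (c' @` (cdom c' `&` cdom c'')) ((c' \o cinv c) (c x)) by rewrite /= cmapK.
have d2 := is_derive_comp (@open_chart_domI c' c'') Bx' (Cn_transition 1 c'a c''a) d1.
have := Cn_is_derive v (Cn_transition 1 ca c''a) Ax2.
move/(is_derive_unique_on oA Ax _ d2) => h; rewrite -h//=; first by rewrite cmapK.
by move=> _ [z [[c'z c''z] cz] <-] /=; rewrite !cmapK.
Qed.

Lemma coord_jacV c c' x : atlas c -> atlas c' -> cdom c x -> cdom c' x ->
  coord_jac c c' x *m coord_jac c' c x = 1%:M.
Proof. by move=> *; rewrite coord_jac_comp// coord_jac_id. Qed.

Lemma coord_jac_unit c c' x : atlas c -> atlas c' -> cdom c x -> cdom c' x ->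
  coord_jac c c' x \in unitmx.
Proof. by move=> ca c'a cx c'x; exact: (mulmx1_unit (coord_jacV ca c'a cx c'x)).1. Qed.

Lemma vec_coordE c (X : M -> E) x : cdom c x ->
  vec_coord c X (c x) = X x *m coord_jac (chart_at x) c x.
Proof. by move=> cx; rewrite /vec_coord cmapK. Qed.

Lemma vec_coord_chart_at (X : M -> E) x : vec_coord (chart_at x) X (chart_at x x) = X x.
Proof.
have xa := chart_at_atlas x; have xx := chart_at_dom x.
by rewrite (vec_coordE X xx) (coord_jac_id xa xx) mulmx1.
Qed.

Lemma tens02_coordE c g x : cdom c x -> tens02_coord c g (c x) =
  coord_jac c (chart_at x) x *m g x *m (coord_jac c (chart_at x) x)^T.
Proof. by move=> cx; rewrite /tens02_coord cmapK. Qed.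

Lemma tens20_coordE c h x : cdom c x -> tens20_coord c h (c x) =
  (coord_jac (chart_at x) c x)^T *m h x *m coord_jac (chart_at x) c x.
Proof. by move=> cx; rewrite /tens20_coord cmapK. Qed.

Lemma vec_coord_change c c' (X : M -> E) x : atlas c -> atlas c' -> cdom c x -> cdom c' x ->
  vec_coord c' X (c' x) = vec_coord c X (c x) *m coord_jac c c' x.
Proof.
move=> ca c'a cx c'x; have xa := chart_at_atlas x; have xx := chart_at_dom x.
rewrite (vec_coordE X cx) (vec_coordE X c'x) -(coord_jac_comp xa ca c'a xx cx c'x).
exact: mulmxA.
Qed.

Lemma tens02_coord_change c c' g x : atlas c -> atlas c' -> cdom c x -> cdom c' x ->
  tens02_coord c g (c x) =
    coord_jac c c' x *m tens02_coord c' g (c' x) *m (coord_jac c c' x)^T.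
Proof.
move=> ca c'a cx c'x; have xa := chart_at_atlas x; have xx := chart_at_dom x.
rewrite (tens02_coordE g cx) (tens02_coordE g c'x) -(coord_jac_comp ca c'a xa cx c'x xx).
move: (coord_jac _ _ _) (coord_jac _ _ _) => J1 J2.
by rewrite trmx_mul !mulmxA.
Qed.

Lemma ev02_coord c g x v w : atlas c -> cdom c x ->
  ev02 (g x) v w =
  ev02 (tens02_coord c g (c x)) (v *m coord_jac (chart_at x) c x)
    (w *m coord_jac (chart_at x) c x).
Proof.
move=> ca cx; have xa := chart_at_atlas x; have xx := chart_at_dom x.
rewrite (tens02_coordE g cx); have := coord_jacV xa ca xx cx.
move: (coord_jac _ _ _) (coord_jac _ _ _) => J2 J1 J12.
have vJ (u : E) : u *m J1 *m J2 = u by rewrite -mulmxA J12 mulmx1.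
rewrite /ev02 !mulmxA vJ [(w *m J1)^T]trmx_mul -(mulmxA (v *m g x)) (mulmxA J2^T) -trmx_mul.
by rewrite J12 trmx1 mul1mx.
Qed.

Section Curves.
Variables (I : set R) (gamma : R -> M).
Hypotheses (oI : open I) (gS : smooth_curve I gamma).

Lemma open_curve_dom c : open (I `&` gamma @^-1` cdom c).
Proof. by apply: open_setI_preimage => //; [exact: cdom_open|exact: gS.1]. Qed.

Lemma velocity_chart c t : atlas c -> I t -> cdom c (gamma t) ->
  'D_1 (c \o gamma) t = velocity gamma t *m coord_jac (chart_at (gamma t)) c (gamma t).
Proof.
move=> ca It cgt; pose c0 := chart_at (gamma t).
have c0a : atlas c0 by exact: chart_at_atlas.
have c0gt : cdom c0 (gamma t) by exact: chart_at_dom.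
have d0 : is_derive t 1 (c0 \o gamma) (velocity gamma t).
  rewrite /velocity derive1E; apply: (Cn_is_derive (1 : R) (gS.2 _ c0a 1%N)).
  by split.
have Ax : (c0 @` (cdom c0 `&` cdom c)) ((c0 \o gamma) t) by exists (gamma t).
have d1 := is_derive_comp (@open_chart_domI c0 c) Ax (Cn_transition 1 c0a ca) d0.
rewrite -(coord_jacE _ c0a ca c0gt cgt).
have oT : open (I `&` gamma @^-1` cdom c `&` (I `&` gamma @^-1` cdom c0)).
  by apply: openI; exact: open_curve_dom.
apply: (is_derive_unique_on oT _ _ _ d1 (F := c \o gamma)).
- by split; split.
- by move=> s [_ [_ c0s]] /=; rewrite cmapK.
- by apply: (Cn_is_derive (1 : R) (gS.2 _ ca 1%N)); split.
Qed.

End Curves.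

End Charts.

Lemma delta_mulmx_delta (R : pzRingType) (m n : nat) (A : 'M[R]_(m, n)) i j :
  (delta_mx (0 : 'I_1) i *m A *m delta_mx j (0 : 'I_1)) 0 0 = A i j.
Proof. by rewrite -rowE -colE !mxE. Qed.

(** * The polar end in a chart *)

Section PolarChart.
Context {R : realType} {m : nat} {M : riemannLorentz R m}.
Local Notation E := 'rV[R]_m.
Local Notation G := (metric M).
Local Notation h := (dual_metric M).
Implicit Types (c : chart R m M) (x : M).

Lemma metric_tr x : ~ polar M x -> (G x)^T = G x.
Proof.
move=> nx; apply: mulmx_inj => v; apply/eqP; rewrite -subr_eq0; apply/eqP.
apply: dot_eq0 => w; rewrite dotDl dotNl dot_mulmx trmxK.
by rewrite dotC -!ev02E (metric_symmetric nx) subrr.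
Qed.

Lemma metric_unit x : ~ polar M x -> G x \in unitmx.
Proof.
move=> nx; rewrite -row_free_unit; apply/inj_row_free => v vG.
by apply: (metric_nondegenerate nx) => w; rewrite ev02E vG dot0l.
Qed.

(** The vector representing a covector [a] is [a^T G^-1]; testing [dual_metricE] on the dual basis
    identifies [h] with the inverse of [G]. *)
Lemma metric_dual x : ~ polar M x -> G x *m h x = 1%:M.
Proof.
move=> nx; have Gu := metric_unit nx; have Gs := metric_tr nx.
suff -> : h x = invmx (G x) by rewrite mulmxV.
have rep (a : 'cV[R]_m) u : ev02 (G x) (a^T *m invmx (G x)) u = covec_app a u.
  by rewrite /ev02 /covec_app mulmxKV// -trmx_mul mxE.
apply/matrixP => i j.
have := dual_metricE nx (rep (delta_mx i 0)) (rep (delta_mx j 0)).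
rewrite /ev20 /ev02 mulmxKV// trmx_delta trmx_mul trmxK trmx_inv Gs.
by rewrite mulmxA !delta_mulmx_delta.
Qed.

Lemma dual_tr x : ~ polar M x -> (h x)^T = h x.
Proof.
move=> nx; have Gu := metric_unit nx.
apply: (can_inj (mulKmx Gu)); rewrite metric_dual// -{1}(metric_tr nx) -trmx_mul.
by rewrite (mulmx1C (metric_dual nx)) trmx1.
Qed.

Variable c : chart R m M.
Hypothesis ca : atlas c.
Local Notation O := (c @` cdom c).
Let oO : open O := @cimg_open _ _ _ c.
Let oU : open (cdom c) := @cdom_open _ _ _ c.
Local Notation Gc := (tens02_coord c G).
Local Notation hc := (tens20_coord c h).
Local Notation delta := (fun y => \det (hc y)).

Lemma dual_chart_smooth : smooth_on O hc.
Proof. by have := @dual_metric_smooth _ _ M c ca; rewrite setTI. Qed.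

Lemma metric_chart_smooth : smooth_on (c @` (~` polar M `&` cdom c)) Gc.
Proof. exact: (@metric_smooth _ _ M c ca). Qed.

Lemma chart_metric_dual x : cdom c x -> ~ polar M x -> Gc (c x) *m hc (c x) = 1%:M.
Proof.
move=> cx nx; rewrite (tens02_coordE _ cx) (tens20_coordE _ cx).
have xa := chart_at_atlas x; have xx := chart_at_dom x.
have Gh := metric_dual nx; have := coord_jacV ca xa cx xx; have := coord_jacV xa ca xx cx.
move: (coord_jac _ _ _) (coord_jac _ _ _) => J K KJ JK.
rewrite !mulmxA -(mulmxA (_ *m _) J^T) -trmx_mul KJ trmx1 mulmx1.
by rewrite -(mulmxA J) Gh mulmx1.
Qed.

Lemma chart_metric_tr x : cdom c x -> ~ polar M x -> (Gc (c x))^T = Gc (c x).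
Proof.
move=> cx nx; rewrite (tens02_coordE _ cx); move: (coord_jac _ _ _) => J.
by rewrite !trmx_mul trmxK metric_tr// mulmxA.
Qed.

Lemma chart_dual_tr_off x : cdom c x -> ~ polar M x -> (hc (c x))^T = hc (c x).
Proof.
move=> cx nx; rewrite (tens20_coordE _ cx); move: (coord_jac _ _ _) => J.
by rewrite !trmx_mul trmxK dual_tr// mulmxA.
Qed.

(** The coordinate differentials of [c], expressed in the chart at [x]. The Gram matrix of this
    coframe is [hc], so [polar_det] becomes a statement on [delta]. *)
Let theta (i : 'I_m) x : 'cV[R]_m := coord_jac (chart_at x) c x *m delta_mx i 0.

Let coframe_theta : coframe (cdom c) theta.
Proof.
split=> [i c' c'a|x cx].
  rewrite setIC => k.
  apply: (Cn_eq (@open_chart_domI _ _ _ c' c) (f := fun y => coord_jac c' c (cinv c' y) *m delta_mx i 0)).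
    move=> _ [x [c'x cx] <-]; rewrite /covec_coord cmapK// /theta.
    have xa := chart_at_atlas x; have xx := chart_at_dom x.
    by rewrite -(coord_jac_comp c'a xa ca c'x xx cx) mulmxA.
  apply: (Cn_mulmx (@open_chart_domI _ _ _ c' c)); last exact: Cn_cst.
  exact: (Cn_coord_jac k c'a ca).
have xa := chart_at_atlas x; have xx := chart_at_dom x.
suff -> : \matrix_(i, a) theta a x i 0 = coord_jac (chart_at x) c x.
  exact: (coord_jac_unit xa ca xx cx).
by apply/matrixP => i a; rewrite [LHS]mxE /theta -colE mxE.
Qed.

Let det_theta x : cdom c x ->
  \det (\matrix_(a, b) ev20 (h x) (theta a x) (theta b x)) = delta (c x).
Proof.
move=> cx; congr (\det _); rewrite (tens20_coordE _ cx).
apply/matrixP => a b; rewrite [LHS]mxE /ev20 /theta.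
move: (coord_jac _ _ _) => J; rewrite trmx_mul trmx_delta.
by rewrite -(delta_mulmx_delta (J^T *m h x *m J) a b) !mulmxA.
Qed.

Lemma polar_det0 x : cdom c x -> polar M x <-> delta (c x) = 0.
Proof.
move=> cx; split=> [px|d0].
  have [h1 _] := polar_det oU (ex_intro _ x (conj cx px)) coframe_theta.
  have : (cdom c `&` polar M) x by [].
  by rewrite h1 /= det_theta// => -[].
apply: contrapT => nx; have /mulmx1_unit[_] := chart_metric_dual cx nx.
by rewrite unitmxE d0 unitr0.
Qed.

Lemma delta_smooth k : Cn k O delta.
Proof. exact: (Cn_det (f := hc) oO (dual_chart_smooth k)). Qed.

Lemma polar_regular x : cdom c x -> polar M x -> exists v, 'D_v delta (c x) != 0.
Proof.
move=> cx px.
have [_ /(_ x (conj cx px))[v]] := polar_det oU (ex_intro _ x (conj cx px)) coframe_theta.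
have xa := chart_at_atlas x; have xx := chart_at_dom x.
rewrite /diff_fun => dv; exists ('D_v (c \o cinv (chart_at x)) (chart_at x x)).
have Ax : (chart_at x @` (cdom (chart_at x) `&` cdom c)) (chart_at x x) by exists x.
have d1 := Cn_is_derive v (Cn_transition 1 xa ca) Ax.
have Bx : O ((c \o cinv (chart_at x)) (chart_at x x)) by exists x => //=; rewrite cmapK.
have [_ d2] := is_derive_comp_scalar oO Bx (delta_smooth 1) d1.
have e1 : (c \o cinv (chart_at x)) (chart_at x x) = c x by rewrite /= cmapK.
rewrite -[X in 'D_ _ _ X]e1 -d2; move: dv; congr (_ != 0).
apply: near_eq_derive; near=> y.
have : (chart_at x @` (cdom (chart_at x) `&` cdom c)) y.
  by near: y; exact: (open_nbhs_nbhs (conj (@open_chart_domI _ _ _ (chart_at x) c) Ax)).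
move=> [z [xz cz] <-]; have e := cmapK xz.
by rewrite /comp e; exact: det_theta.
Unshelve. all: by end_near. Qed.

(** Tangent vectors are velocities of curves inside the polar end, along which [F] is constantly
    0. *)
Lemma tangent_derive x v (O' : set E) (F : E -> R) : cdom c x -> O' (c x) -> open O' ->
  Cn 1 O' F -> (forall y, cdom c y -> O' (c y) -> polar M y -> F (c y) = 0) ->
  tangent (polar M) x v -> 'D_(v *m coord_jac (chart_at x) c x) F (c x) = 0.
Proof.
move=> cx O'x oO' FC F0 [e [s [e0 sS sp s0 sv]]].
have oI : open (`]-e, e[%classic : set R) by exact: interval_open.
have e0in : (`]-e, e[%classic : set R) 0 by rewrite /= in_itv /= oppr_lt0 e0.
have cs0 : cdom c (s 0) by rewrite s0.
have := velocity_chart oI sS ca e0in cs0; rewrite sv s0 => <-.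
have oT := open_curve_dom (c := c) oI sS.
have T0 : (`]-e, e[%classic `&` s @^-1` cdom c) 0 by [].
have csC := sS.2 c ca.
have d1 := Cn_is_derive (1 : R) (csC 1%N) T0.
have O'0 : O' ((c \o s) 0) by rewrite /= s0.
have d2 := is_derive_comp_scalar oO' O'0 FC d1.
rewrite -[in 'D_ _ _ _](_ : (c \o s) 0 = c x); last by rewrite /= s0.
have oT' : open ((`]-e, e[%classic `&` s @^-1` cdom c) `&` (c \o s) @^-1` O').
  exact: (open_setI_preimage oT oO' (fun t Tt => Cn_cont (csC 0%N) Tt)).
apply: (is_derive_unique_on oT' _ _ d2 (is_derive_cst (0 : R) (0 : R) (1 : R))) => //.
by move=> t [[It cst] O't]; apply: F0 => //; exact: sp.
Qed.

Let chart_pos x : cdom c x -> O (c x).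
Proof. by exists x. Qed.

(** A vector in the image of the transpose of [h] is annihilated by the radical, hence tangent by
    [polar_tangent]; the differential of [delta] vanishes on tangent vectors and so kills this
    image. *)
Lemma polar_null x : cdom c x -> polar M x -> grad delta (c x) *m hc (c x) = 0.
Proof.
move=> cx px; apply: dot_eq0 => u; rewrite dot_mulmx dotC.
rewrite -(derive_grad _ oO (chart_pos cx) (delta_smooth 1)).
have xa := chart_at_atlas x; have xx := chart_at_dom x.
have JK := coord_jacV ca xa cx xx; have KJ := coord_jacV xa ca xx cx.
set u' := u *m _; rewrite -(mulmx1 u') -JK mulmxA.
apply: (tangent_derive cx (chart_pos cx) oO (delta_smooth 1)).
  by move=> y cy _ py; apply/polar_det0.
rewrite -(polar_tangent px) /= => mu muR; rewrite /covec_app {}/u'.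
have {muR} mh : mu^T *m h x = 0.
  apply: dot_eq0 => a; rewrite /dot; have := muR a^T.
  by rewrite /ev20.
rewrite (tens20_coordE _ cx); move: KJ; move: (coord_jac _ _ _) (coord_jac _ _ _) => J K KJ.
rewrite !trmx_mul trmxK !mulmxA -(mulmxA _ K J) KJ mulmx1 -mulmxA.
have -> : (h x)^T *m mu = 0 by rewrite -[LHS]trmxK trmx_mul trmxK mh trmx0.
by rewrite mulmx0 mxE.
Qed.

(** The extended dual metric inherits its symmetry from the complement of the polar end by
    continuity. *)
Lemma chart_dual_tr y : O y -> (hc y)^T = hc y.
Proof.
move=> Oy; apply/eqP; rewrite -subr_eq0; apply/eqP; move: y Oy.
apply: (eq0_off_regular_zeros (g := delta) oO).
- by move=> _ [x cx <-] /(polar_det0 cx) px; exact: polar_regular.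
- move=> y Oy; apply: (Cn_cont (n := 0) (A := O)) Oy.
  apply: (Cn_subm oO); last exact: dual_chart_smooth.
  by apply: (Cn_tr oO); exact: dual_chart_smooth.
- move=> _ [x cx <-] d0; rewrite chart_dual_tr_off ?subrr// => /(polar_det0 cx) d.
  by rewrite d eqxx in d0.
Qed.

Lemma chart_polar_model p : cdom c p -> polar M p ->
  exists (U : set E) B f k n, [/\ U (c p), U `<=` O, polar_model U hc B f k n,
    forall x, cdom c x -> U (c x) -> polar M x <-> f (c x) = 0 &
    forall y, U y -> f y = 0 -> n y != 0].
Proof.
move=> cp pp; have := polar_model_exists oO (chart_pos cp) dual_chart_smooth chart_dual_tr.
case.
- exact/polar_det0.
- by move=> _ [x cx <-] /(polar_det0 cx) px; exact: polar_regular.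
- by move=> _ [x cx <-] /(polar_det0 cx) px; exact: polar_null.
- move=> U [B [f [k [n [Up UO PM fd fn]]]]]; exists U, B, f, k, n; split=> //.
  by move=> x cx Ux; split=> [/(polar_det0 cx)/fd -> //|/fd h1]; apply/polar_det0 => //; exact: h1.
Qed.

Section Tangent.
Variables (U : set E) (B : E -> 'M[R]_m) (f k : E -> R) (n : E -> E).
Hypotheses (PM : polar_model U hc B f k n) (UO : U `<=` O).
Hypothesis fP : forall x, cdom c x -> U (c x) -> polar M x <-> f (c x) = 0.

Lemma tangent_grad x v : cdom c x -> U (c x) -> polar M x ->
  tangent (polar M) x v -> dot (v *m coord_jac (chart_at x) c x) (grad f (c x)) = 0.
Proof.
move=> cx Ux px tv.
rewrite -(derive_grad _ (pm_open PM) Ux (pm_f PM 1%N)).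
apply: (tangent_derive cx Ux (pm_open PM) (pm_f PM 1%N) _ tv).
by move=> y cy Uy /fP -/(_ cy Uy).
Qed.

(** On the polar end the radical lies in the line spanned by [df] ([pm_ker]), so a vector killed by
    [df] is killed by the radical and [polar_tangent] applies. *)
Lemma grad_tangent x v : cdom c x -> U (c x) -> polar M x ->
  dot v (grad f (c x)) = 0 -> tangent (polar M) x (v *m coord_jac c (chart_at x) x).
Proof.
move=> cx Ux px dv; rewrite -(polar_tangent px) /= => mu muR.
have {muR} mh : mu^T *m h x = 0.
  by apply: dot_eq0 => a; rewrite /dot; have := muR a^T; rewrite /ev20.
have xa := chart_at_atlas x; have xx := chart_at_dom x.
have JK := coord_jacV ca xa cx xx; have KJ := coord_jacV xa ca xx cx.
have := pm_ker PM Ux (iffLR (fP cx Ux) px) (u := mu^T *m (coord_jac c (chart_at x) x)^T).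
rewrite (tens20_coordE _ cx) /covec_app.
move: KJ JK; move: (coord_jac _ _ _) (coord_jac _ _ _) => J K KJ JK.
rewrite !mulmxA -(mulmxA _ J^T) -trmx_mul KJ trmx1 mulmx1 mh mul0mx => /(_ erefl)[a aE].
rewrite -mulmxA -[J *m mu]trmxK trmx_mul aE -/(dot _ _) dotZr dv mulr0//.
Qed.

End Tangent.

End PolarChart.

(** * Existence of the crossing pregeodesic *)

Section SmoothCurves.
Context {R : realType} {m : nat} {M : smoothManifold R m}.
Local Notation E := 'rV[R]_m.

Lemma smooth_curve_cinv (c : chart R m M) (I : set R) (Y : R -> E) : atlas c -> open I ->
  (forall t, I t -> (c @` cdom c) (Y t)) -> smooth_on I Y -> smooth_curve I (cinv c \o Y).
Proof.
move=> ca oI YO YS.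
have gc t : I t -> {for t, continuous (cinv c \o Y)}.
  move=> It; apply: continuous_comp; first exact: (Cn_cont (YS 0%N)).
  exact: (cinv_cont (YO t It)).
split=> // c' c'a k.
have oT : open (I `&` (cinv c \o Y) @^-1` cdom c').
  by apply: open_setI_preimage => //; exact: cdom_open.
apply: (Cn_comp (f := c' \o cinv c) (g := Y) oT (@open_chart_domI _ _ _ c c')).
- by move=> t [It /= c't]; exists (cinv c (Y t)); [split=> //; apply: cinv_dom; exact: YO|apply: cmapK_im; exact: YO].
- by apply: (Cn_sub _ (YS k)) => t [].
- exact: Cn_transition.
Qed.

Lemma smooth_curve_comp (I J : set R) (gamma : R -> M) (g : R -> R) : open I -> open J ->
  (forall u, J u -> I (g u)) -> smooth_on J g -> smooth_curve I gamma ->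
  smooth_curve J (gamma \o g).
Proof.
move=> oI oJ JI gS [gc gaS].
have cg u : J u -> {for u, continuous (gamma \o g)}.
  move=> Ju; apply: continuous_comp; first exact: (Cn_cont (gS 0%N)).
  exact: (gc _ (JI u Ju)).
split=> // c ca k.
have oT : open (J `&` (gamma \o g) @^-1` cdom c).
  by apply: open_setI_preimage => //; exact: cdom_open.
have oS : open (I `&` gamma @^-1` cdom c).
  by apply: open_setI_preimage => //; exact: cdom_open.
apply: (Cn_comp1_mx (f := c \o gamma) (g := g) oT oS).
- by move=> u [Ju cu]; split=> //; exact: JI.
- by apply: (Cn_sub _ (gS k)) => u [].
- exact: gaS.
Qed.

Lemma smooth_curve_sub (I J : set R) (gamma : R -> M) : J `<=` I ->
  smooth_curve I gamma -> smooth_curve J gamma.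
Proof.
move=> JI [gc gaS]; split=> [t /JI|c ca k]; first exact: gc.
by apply: (Cn_sub _ (gaS c ca k)) => t [/JI].
Qed.

End SmoothCurves.

(** * Geodesics and pregeodesics in charts *)

Section Geodesics.
Context {R : realType} {m : nat} {M : riemannLorentz R m}.
Local Notation E := 'rV[R]_m.
Local Notation G := (metric M).
Local Notation h := (dual_metric M).

Lemma near_eq_chart_acc (F : E -> 'M[R]_m) (Y Z : R -> E) t :
  (\forall s \near t, Y s = Z s) -> chart_acc F Y t = chart_acc F Z t.
Proof.
move=> YZ; have d1 : \forall s \near t, 'D_1 Y s = 'D_1 Z s.
  have := near_join YZ; apply: filterS => s YZs; exact: near_eq_derive.
rewrite /chart_acc (near_eq_derive (1 : R) d1).
by rewrite (nbhs_singleton d1) (nbhs_singleton YZ).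
Qed.

Lemma christoffel_chart (c0 c : chart R m M) x v w : atlas c0 -> atlas c ->
  cdom c0 x -> cdom c x -> ~ polar M x ->
  christoffel (tens02_coord c0 G) (c0 x) v w *m coord_jac c0 c x =
  christoffel (tens02_coord c G) (c x) (v *m coord_jac c0 c x) (w *m coord_jac c0 c x)
  + 'D_v ('D_w (c \o cinv c0)) (c0 x).
Proof.
move=> xa ca xx cx nx.
pose W := ~` polar M `&` (cdom c0 `&` cdom c).
have oN : open (~` polar M) by apply: closed_openC; exact: polar_closed.
have oW : open W by apply: openI => //; apply: openI; exact: cdom_open.
have oA : open (c0 @` (W `&` cdom c0)) by exact: open_chart_image.
have oA' : open (c @` (~` polar M `&` cdom c)) by exact: open_chart_image.
have AA' y : (c0 @` (W `&` cdom c0)) y -> (c @` (~` polar M `&` cdom c)) ((c \o cinv c0) y).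
  by move=> [z [[nz [_ cz]] c0z] <-]; exists z => //=; rewrite cmapK.
have sub1 : c0 @` (W `&` cdom c0) `<=` c0 @` (cdom c0 `&` cdom c).
  by move=> _ [z [[nz [_ cz]] c0z] <-]; exists z.
have sub2 : c0 @` (W `&` cdom c0) `<=` c0 @` (~` polar M `&` cdom c0).
  by move=> _ [z [[nz [_ cz]] c0z] <-]; exists z.
have phC : Cn 2 (c0 @` (W `&` cdom c0)) (c \o cinv c0).
  exact: (Cn_sub sub1 (Cn_transition 2 xa ca)).
have GC0 := Cn_sub sub2 (metric_chart_smooth xa 1%N).
have GC := metric_chart_smooth ca 1%N.
have GE y : (c0 @` (W `&` cdom c0)) y -> tens02_coord c0 G y =
    jacobian (c \o cinv c0) y *m tens02_coord c G ((c \o cinv c0) y) *m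
    (jacobian (c \o cinv c0) y)^T.
  move=> [z [[nz [_ cz]] c0z] <-].
  have -> : (c \o cinv c0) (c0 z) = c z by rewrite /comp (cmapK c0z).
  exact: (tens02_coord_change G xa ca c0z cz).
have Gs y : (c @` (~` polar M `&` cdom c)) y -> (tens02_coord c G y)^T = tens02_coord c G y.
  by move=> [z [nz cz] <-]; exact: chart_metric_tr.
have Gu y : (c0 @` (W `&` cdom c0)) y -> tens02_coord c0 G y \in unitmx.
  by move=> [z [[nz _] c0z] <-]; exact: (mulmx1_unit (chart_metric_dual xa c0z nz)).1.
have Ax : (c0 @` (W `&` cdom c0)) (c0 x) by exists x.
have := christoffel_change oA oA' AA' phC GC0 GC GE Gs Gu v w Ax.
rewrite (coord_jacE v xa ca xx cx) (coord_jacE w xa ca xx cx).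
have -> : (c \o cinv c0) (c0 x) = c x by rewrite /comp (cmapK xx).
by [].
Qed.

(** [acceleration] uses the distinguished chart of the current point, which varies along the curve.
    The second derivatives of the change of charts coming from the curve and from the Christoffel
    symbols cancel, so one fixed chart suffices. *)
Lemma acceleration_chart (c : chart R m M) (I : set R) (gamma : R -> M) t : atlas c ->
  open I -> smooth_curve I gamma -> I t -> cdom c (gamma t) -> ~ polar M (gamma t) ->
  chart_acc (tens02_coord c G) (c \o gamma) t =
  acceleration G gamma t *m coord_jac (chart_at (gamma t)) c (gamma t).
Proof.
move=> ca oI gS It cgt nt; pose x := gamma t; pose c0 := chart_at x.
have xa : atlas c0 := chart_at_atlas x; have xx : cdom c0 x := chart_at_dom x.
pose T := (I `&` gamma @^-1` cdom c) `&` (I `&` gamma @^-1` cdom c0).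
have oT : open T by apply: openI; exact: open_curve_dom.
have Tt : T t by [].
have TA s : T s -> (c0 @` (cdom c0 `&` cdom c)) ((c0 \o gamma) s).
  by move=> [[_ cs] [_ c0s]]; exists (gamma s).
have YC : Cn 2 T (c0 \o gamma) by apply: (Cn_sub _ (gS.2 c0 xa 2%N)) => s [].
have [D1 D2] := derive1_comp_curve (@open_chart_domI _ _ _ c0 c) oT TA Tt
  (Cn_transition 2 xa ca) YC.
pose Y s := (c \o cinv c0) ((c0 \o gamma) s).
have e s : cdom c0 (gamma s) -> Y s = c (gamma s).
  by move=> c0s; rewrite /Y /comp (cmapK c0s).
have -> : chart_acc (tens02_coord c G) (c \o gamma) t = chart_acc (tens02_coord c G) Y t.
  apply: near_eq_chart_acc; near=> s.
  have [_ [_ c0s]] : T s by near: s; exact: (open_nbhs_nbhs (conj oT Tt)).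
  by rewrite e.
have accE : acceleration G gamma t = chart_acc (tens02_coord c0 G) (c0 \o gamma) t.
  have dE : derive1 (c0 \o gamma) = 'D_1 (c0 \o gamma) by apply/funext => s; rewrite derive1E.
  by rewrite /acceleration /velocity -/x -/c0 dE derive1E.
have chr := christoffel_chart ('D_1 (c0 \o gamma) t) ('D_1 (c0 \o gamma) t) xa ca xx cgt nt.
rewrite accE /chart_acc mulmxDl.
rewrite [X in _ = _ + X]chr (e t xx) [X in X + _]D2 [X in christoffel _ _ X]D1 [X in christoffel _ _ _ X]D1.
by rewrite -addrA [in RHS](addrC (christoffel _ _ _ _)).
Unshelve. all: by end_near. Qed.

Lemma acceleration_eq0 (c : chart R m M) (I : set R) (gamma : R -> M) t : atlas c ->
  open I -> smooth_curve I gamma -> I t -> cdom c (gamma t) -> ~ polar M (gamma t) ->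
  acceleration G gamma t = 0 <-> chart_acc (tens02_coord c G) (c \o gamma) t = 0.
Proof.
move=> ca oI gS It cgt nt; rewrite (acceleration_chart ca oI gS It cgt nt).
have xa := chart_at_atlas (gamma t); have xx := chart_at_dom (gamma t).
split=> [->|]; first by rewrite mul0mx.
move=> /(congr1 (mulmxr (invmx (coord_jac (chart_at (gamma t)) c (gamma t))))).
by rewrite /= mul0mx mulmxK//; exact: coord_jac_unit.
Qed.

(** The affine parameter [s] is found from [s' = exp L] with [L' = lam]: its inverse [g] satisfies
    [g'' + lam g'^2 = 0], which removes the tangential acceleration. *)
Lemma chart_pregeodesic (c : chart R m M) (a b : R) (gamma : R -> M) (lam : R -> R) :
  atlas c -> a < b -> smooth_curve `]a, b[%classic gamma -> smooth_on `]a, b[%classic lam ->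
  (forall t, t \in `]a, b[ -> [/\ cdom c (gamma t), ~ polar M (gamma t) &
    chart_acc (tens02_coord c G) (c \o gamma) t = lam t *: 'D_1 (c \o gamma) t]) ->
  pregeodesic `]a, b[%classic gamma.
Proof.
move=> ca ab gS lS H.
have oI : open (`]a, b[%classic : set R) by exact: interval_open.
have [L Ld] : exists L : R -> R, forall t, t \in `]a, b[ -> is_derive t 1 L (lam t).
  by apply: antiderivative_exists => // t It; exact: (Cn_cont (lS 0%N)).
have LS : smooth_on `]a, b[%classic L.
  by move=> k; apply: CnW; apply: (Cn_antiderivative oI) (lS k) => t It; exact: Ld.
have eS : smooth_on `]a, b[%classic (fun t => expR (L t)).
  by move=> k; exact: Cn_expR.
have [s sd] : exists s : R -> R, forall t, t \in `]a, b[ -> is_derive t 1 s (expR (L t)).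
  by apply: antiderivative_exists => // t It; exact: (Cn_cont (eS 0%N)).
have sS : smooth_on `]a, b[%classic s.
  by move=> k; apply: CnW; apply: (Cn_antiderivative oI) (eS k) => t It; exact: sd.
have [g [gs oJ gSm gd]] := inverse_function1 sd (fun t _ => expR_gt0 (L t)) eS.
set J := s @` `]a, b[%classic in oJ gSm.
have JI u : J u -> `]a, b[%classic (g u) by move=> [t It <-]; rewrite gs.
exists J, (gamma \o g); split.
  have sgS := smooth_curve_comp oI oJ JI gSm gS.
  split=> // u Ju; have [cg ng acc] := H _ (JI u Ju).
  split=> //; apply/(acceleration_eq0 ca oJ sgS Ju cg ng).
  have oT : open (`]a, b[%classic `&` gamma @^-1` (~` polar M `&` cdom c)).
    apply: open_setI_preimage => //; last exact: gS.1.
    by apply: openI; [apply: closed_openC; exact: polar_closed|exact: cdom_open].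
  have oA : open (c @` (~` polar M `&` cdom c)).
    by apply: open_chart_image; apply: closed_openC; exact: polar_closed.
  have IA v : `]a, b[%classic v -> (c @` (~` polar M `&` cdom c)) ((c \o gamma) v).
    by move=> Iv; have [cv nv _] := H v Iv; exists (gamma v).
  have YC : Cn 2 `]a, b[%classic (c \o gamma).
    by apply: (Cn_sub _ (gS.2 c ca 2%N)) => v Iv; have [cv _ _] := H v Iv.
  have [_ ->] := chart_acc_reparam oA oJ oI IA JI Ju (metric_chart_smooth ca 1%N) YC (gSm 2%N).
  rewrite acc scalerA -scalerDl.
  suff -> : 'D_1 g u ^+ 2 * lam (g u) + 'D_1 ('D_1 g) u = 0 by rewrite scale0r.
  have dg v : J v -> is_derive v 1 g (expR (L (g v)))^-1.
    by move=> [t It <-]; rewrite gs//; exact: gd.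
  have [_ dgu] := dg u Ju.
  have Lg := is_derive_chain1 (dg u Ju) (Ld _ (JI u Ju)).
  have eL := is_derive_chain1 Lg (is_derive_expR (L (g u))).
  have e0 : (expR \o (L \o g)) u != 0 by rewrite /= gt_eqF// expR_gt0.
  have dV := is_deriveV e0 eL.
  have <- : 'D_1 (fun y : R => ((expR \o (L \o g)) y)^-1) u = 'D_1 ('D_1 g) u.
    apply: near_eq_derive; near=> v.
    have Jv : J v by near: v; exact: (open_nbhs_nbhs (conj oJ Ju)).
    by have [_ ->] := dg v Jv.
  have [_ ->] := dV; rewrite dgu /= /GRing.scale /=.
  have e0' : expR (L (g u)) != 0 by exact: e0.
  by field.
exists s; split=> //.
  by move=> t It; rewrite derive1E; have [_ ->] := sd t It; rewrite gt_eqF// expR_gt0.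
by move=> t It /=; rewrite gs.
Unshelve. all: by end_near. Qed.

End Geodesics.

Section Existence.
Context {R : realType} {m : nat} {M : riemannLorentz R m}.
Local Notation E := 'rV[R]_m.
Local Notation G := (metric M).
Local Notation h := (dual_metric M).

Theorem crossing_pregeodesic_exists (p : M) : polar M p ->
  exists (e : R) (gamma : R -> M), crossing_pregeodesic p e gamma.
Proof.
move=> pp; pose c := chart_at p.
have ca : atlas c by exact: chart_at_atlas.
have cp : cdom c p by exact: chart_at_dom.
have [U [B [f [k [n [Up UO PM fP _]]]]]] := chart_polar_model ca cp pp.
have fp : f (c p) = 0 by apply/fP.
have [e [Y [X [lam [e0 Y0 YS YU [lS PP]]]]]] := local_existence PM Up fp.
have oI : open (`]-e, e[%classic : set R) by exact: interval_open.
have e0in : (0 : R) \in `]-e, e[ by rewrite in_itv /= oppr_lt0 e0.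
have YO t : `]-e, e[%classic t -> (c @` cdom c) (Y t) by move=> It; apply: UO; exact: (YU t It).1.
pose gamma := cinv c \o Y.
have gS : smooth_curve `]-e, e[%classic gamma by exact: smooth_curve_cinv.
have cg t : t \in `]-e, e[ -> cdom c (gamma t) by move=> It; apply: cinv_dom; exact: YO.
have cgY t : t \in `]-e, e[ -> c (gamma t) = Y t by move=> It; apply: cmapK_im; exact: YO.
have dY t : t \in `]-e, e[ -> 'D_1 (c \o gamma) t = 'D_1 Y t.
  move=> It; apply: near_eq_derive; near=> s; apply: cgY.
  by near: s; exact: (open_nbhs_nbhs (conj oI It)).
(* The value of [df] on the velocity being 1 gives at once a non-zero velocity and transversality at
   [p]. *)
have grad1 t : t \in `]-e, e[ ->
    dot (velocity gamma t *m coord_jac (chart_at (gamma t)) c (gamma t)) (grad f (c (gamma t))) = 1.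
  move=> It; rewrite -(velocity_chart oI gS ca It (cg t It)) (dY t It) (cgY t It).
  have YUt := (YU t It).1.
  rewrite -(derive_grad _ (pm_open PM) YUt (pm_f PM 1%N)).
  have Yd := Cn_is_derive (1 : R) (YS 1%N) It.
  have d1 := is_derive_comp_scalar (pm_open PM) YUt (pm_f PM 1%N) Yd.
  by apply: (is_derive_unique_on oI It _ d1 (is_derive_id t (1 : R))) => s /YU[].
have g0 : gamma 0 = p by rewrite /gamma /= Y0 cmapK.
have gpol t : t \in `]-e, e[ -> t != 0 -> ~ polar M (gamma t).
  move=> It t0 pt; have := fP _ (cg t It); rewrite (cgY t It) => /(_ (YU t It).1)[/(_ pt)].
  by rewrite (YU t It).2 => /eqP; rewrite (negbTE t0).
have acc t : t \in `]-e, e[ -> t != 0 ->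
    chart_acc (tens02_coord c G) (c \o gamma) t = lam t *: 'D_1 (c \o gamma) t.
  move=> It t0; rewrite (dY t It).
  have <- : chart_acc (tens02_coord c G) Y t = chart_acc (tens02_coord c G) (c \o gamma) t.
    apply: near_eq_chart_acc; near=> s; rewrite /= cgY//.
    by near: s; exact: (open_nbhs_nbhs (conj oI It)).
  pose A := c @` (~` polar M `&` cdom c).
  have oA : open A by apply: open_chart_image; apply: closed_openC; exact: polar_closed.
  pose I' : set R := `]-e, e[%classic `&` [set t | t != 0].
  have oI' : open I'.
    by apply: openI => //; exact: open_neq.
  have I't : I' t by [].
  have cgA s : I' s -> A (Y s).
    move=> [Is s0]; rewrite -(cgY s Is); exists (gamma s) => //; split; last exact: cg.
    exact: gpol.
  have Gh y : A y -> tens02_coord c G y *m tens20_coord c h y = 1%:M.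
    by move=> [x [nx cx] <-]; exact: chart_metric_dual.
  have Gs y : A y -> (tens02_coord c G y)^T = tens02_coord c G y.
    by move=> [x [nx cx] <-]; exact: chart_metric_tr.
  have hC : Cn 1 A (tens20_coord c h).
    by apply: (Cn_sub _ (dual_chart_smooth ca 1%N)) => _ [x [_ cx] <-]; exists x.
  have YC : Cn 2 I' Y by apply: (Cn_sub _ (YS 2%N)) => s [].
  (* Off the polar end [h] is the inverse of the metric, so [X] is the covector of [Y']; comparing
     its two derivatives yields the acceleration [lam Y']. *)
  have XE s : I' s -> 'D_1 Y s *m tens02_coord c G (Y s) = X s.
    move=> I's; have [[_ ->] _] := PP s I's.1 I's.2.
    by rewrite -mulmxA (mulmx1C (Gh _ (cgA s I's))) mulmx1.
  have d1 := is_derive_covelocity oA oI' cgA I't (metric_chart_smooth ca 1%N) hC YC Gh Gs.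
  have [_ d2] := PP t It t0.
  have := is_derive_unique_on oI' I't XE d1 d2.
  rewrite (XE t I't) => /addIr; rewrite -(XE t I't) scalemxAl.
  by apply: (can_inj (mulmxK _)); exact: (mulmx1_unit (Gh _ (cgA t I't))).1.
exists e, gamma; split; split=> //.
- move=> t It; apply/eqP => v0; have := grad1 t It.
  by rewrite v0 mul0mx dot0l => /eqP; rewrite eq_sym oner_eq0.
- move=> tv; have := grad1 0 e0in; rewrite g0 => /eqP.
  by rewrite (tangent_grad ca PM fP cp Up pp tv) eq_sym oner_eq0.
- apply: (chart_pregeodesic (lam := lam) ca).
  + by rewrite oppr_lt0.
  + apply: (smooth_curve_sub _ gS) => t /=; rewrite !in_itv /= => /andP[-> t0] /=.
    exact: lt_trans t0 e0.
  + move=> i; apply: (Cn_sub _ (lS i)) => t /=; rewrite !in_itv /= => /andP[-> t0] /=.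
    by rewrite (lt_trans t0 e0) lt_eqF.
  + move=> t; rewrite in_itv /= => /andP[et t0].
    have It : t \in `]-e, e[ by rewrite in_itv /= et (lt_trans t0 e0).
    have tn0 : t != 0 by rewrite lt_eqF.
    by split; [exact: cg|exact: gpol|exact: acc].
- apply: (chart_pregeodesic (lam := lam) ca) => //.
  + apply: (smooth_curve_sub _ gS) => t /=; rewrite !in_itv /= => /andP[t0 ->].
    by rewrite andbT (lt_trans _ t0)// oppr_lt0.
  + move=> i; apply: (Cn_sub _ (lS i)) => t /=; rewrite !in_itv /= => /andP[t0 ->].
    by rewrite andbT (lt_trans _ t0) ?oppr_lt0// gt_eqF.
  + move=> t; rewrite in_itv /= => /andP[t0 te].
    have It : t \in `]-e, e[ by rewrite in_itv /= te (lt_trans _ t0)// oppr_lt0.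
    have tn0 : t != 0 by rewrite gt_eqF.
    by split; [exact: cg|exact: gpol|exact: acc].
Unshelve. all: by end_near. Qed.

End Existence.

(** * Uniqueness of the crossing pregeodesic *)

Section LocalInverse.
Context {R : realType}.

Lemma near0_itv (P : set R) : (\forall t \near (0 : R), P t) ->
  exists2 d : R, 0 < d & forall t, t \in `]-d, d[ -> P t.
Proof.
move=> /nbhs_ballP[d /= d0 dP]; exists d => // t; rewrite in_itv /= -ltr_norml => td.
by apply: dP; rewrite /ball /= sub0r normrN.
Qed.

Lemma itv_sym_sub (d e t : R) : d <= e -> t \in `]-d, d[ -> t \in `]-e, e[.
Proof.
by move=> de; rewrite !in_itv /= -!ltr_norml => td; exact: lt_le_trans de.
Qed.

Lemma local_inverse (phi : R -> R) (I : set R) : open I -> I 0 -> smooth_on I phi ->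
  phi 0 = 0 -> 'D_1 phi 0 != 0 ->
  exists (d r : R) (g : R -> R), [/\ 0 < d, 0 < r, smooth_on `]-r, r[%classic g &
    forall t, t \in `]-d, d[ -> I t /\ 'D_1 phi t != 0] /\
    (forall u, u \in `]-r, r[ -> [/\ g u \in `]-d, d[, phi (g u) = u & 'D_1 g u != 0]) /\
    forall t, t \in `]-d, d[ -> g (phi t) = t.
Proof.
move=> oI I0 phS phi0 dphi0.
(* Multiplying by the sign of the derivative reduces to an increasing function. *)
pose ep := Num.sg ('D_1 phi 0).
have ep2 : ep * ep = 1 by rewrite /ep -expr2 sqr_sg dphi0.
have ep0 : ep != 0 by rewrite sgr_eq0.
pose psi t := ep *: phi t; pose dpsi t := ep *: 'D_1 phi t.
have psid t : I t -> is_derive t 1 psi (dpsi t).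
  by move=> It; exact: is_deriveZ (Cn_is_derive (1 : R) (phS 1%N) It).
have psiS : smooth_on I dpsi.
  by move=> i; apply: (CnZ_cst _ oI); exact: (Cn_derive (1 : R) (phS i.+1)).
have dpsi0 : 0 < dpsi 0.
  by rewrite /dpsi /GRing.scale /= /ep -normrEsg normr_gt0.
have [d d0 dP] : exists2 d, 0 < d & forall t, t \in `]-d, d[ -> I t /\ 0 < dpsi t.
  apply: near0_itv; near=> t; split; first by near: t; exact: (open_nbhs_nbhs (conj oI I0)).
  by near: t; exact: (pos_continuous_near (Cn_cont (psiS 0%N) I0) dpsi0).
have psiS' : smooth_on `]-d, d[%classic dpsi.
  by move=> i; apply: (Cn_sub _ (psiS i)) => t /dP[].
have [g [gpsi oJ gS gd]] := inverse_function1 (fun t It => psid t (dP t It).1)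
  (fun t It => (dP t It).2) psiS'.
have d0in : (0 : R) \in `]-d, d[ by rewrite in_itv /= oppr_lt0 d0.
have J0 : (psi @` `]-d, d[%classic) 0 by exists 0 => //; rewrite /psi phi0 scaler0.
have [r r0 rJ] := near0_itv (open_nbhs_nbhs (conj oJ J0)).
have epr u : u \in `]-r, r[ -> ep *: u \in `]-r, r[.
  rewrite !in_itv /= -!ltr_norml /GRing.scale /= normrM.
  by rewrite /ep normr_sg dphi0 mul1r.
have epr' (u : R) : ep *: (ep *: u) = u by rewrite scalerA ep2 scale1r.
exists d, r, (fun u => g (ep *: u)); split; split=> //.
- have oK : open (`]-r, r[%classic : set R) by exact: interval_open.
  move=> i; apply: (Cn_comp1 (f := g) (g := fun u => ep *: u) oK oJ) (gS i).
    by move=> u /epr /rJ.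
  by apply: (CnZ_cst _ oK); exact: Cn_id.
- move=> t /dP[It dt]; split=> //; apply: contraTneq dt => dt.
  by rewrite /dpsi dt scaler0 ltxx.
- move=> u ur; have [t td tu] := rJ _ (epr u ur).
  have gt : g (ep *: u) = t by rewrite -tu gpsi.
  have pt : phi t = u by rewrite -[RHS]epr' -tu /psi epr'.
  rewrite gt; split=> //.
  have gdt := gd t td; rewrite tu in gdt.
  have epd : is_derive u 1 (fun u : R => ep *: u) (ep *: (1 : R)).
    exact: is_deriveZ (is_derive_id u (1 : R)).
  have [_ ->] := is_derive_chain1 epd gdt.
  rewrite /GRing.scale /= mulr1 mulf_neq0// invr_eq0.
  by have [_ /lt0r_neq0] := dP t td.
Unshelve. all: by end_near. Qed.

(** A reparametrization gives the domain of the geodesic only as an image, and openness is needed to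
    differentiate on it. It follows from [local_inverse] at each translated point. *)
Lemma open_image (s : R -> R) (I : set R) : open I -> smooth_on I s ->
  (forall t, I t -> 'D_1 s t != 0) -> open (s @` I).
Proof.
move=> oI sS ds; rewrite openE => _ [t It <-]; rewrite /interior.
pose phi u := s (u + t) - s t.
have sht (u : R) : is_derive u 1 (fun u : R => u + t) 1.
  by have := is_derive_shift u (1 : R) t.
pose I' : set R := [set u | I (u + t)].
have oI' : open I'.
  rewrite (_ : I' = setT `&` (fun u : R => u + t) @^-1` I); last by rewrite setTI.
  apply: open_setI_preimage => //; first exact: openT.
  by move=> u _; have [/derivable1_diffP/differentiable_continuous] := sht u.
have I'0 : I' 0 by rewrite /I' /= add0r.
have phS : smooth_on I' phi.
  move=> i; apply: (CnB oI'); last exact: Cn_cst.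
  apply: (Cn_comp1 (f := s) oI' oI) (sS i) => //.
  apply: (CnD oI'); [exact: Cn_id|exact: Cn_cst].
have [|//|d [r [g [[d0 r0 _ dP] [gP _]]]]] := local_inverse oI' I'0 phS.
- by rewrite /phi add0r subrr.
- have sd : is_derive (0 + t) 1 s ('D_1 s t).
    by rewrite add0r; exact: (Cn_is_derive (1 : R) (sS 1%N) It).
  have d1 := is_derive_chain1 (sht 0) sd.
  have [_] := is_deriveB d1 (is_derive_cst (s t) (0 : R) (1 : R)).
  by rewrite subr0 scale1r => ->; exact: ds.
apply/nbhs_ballP; exists r => //= x; rewrite /ball /= => xr.
have ur : x - s t \in `]-r, r[ by rewrite in_itv /= -ltr_norml distrC.
have [gd phg _] := gP _ ur; have [Ig _] := dP _ gd.
exists (g (x - s t) + t) => //.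
by move: phg; rewrite /phi => /(congr1 (fun z => z + s t)); rewrite !subrK.
Qed.

End LocalInverse.

Section Crossing.
Context {R : realType} {m : nat} {M : riemannLorentz R m}.
Local Notation E := 'rV[R]_m.
Local Notation G := (metric M).
Local Notation h := (dual_metric M).

(** Converse of [chart_pregeodesic]: for [gamma = sig o s] with [sig] a geodesic, the factor is
    [s'' / s']. *)
Lemma pregeodesic_chart_acc (c : chart R m M) (I : set R) (gamma : R -> M) t : atlas c ->
  open I -> smooth_curve I gamma -> pregeodesic I gamma -> I t -> cdom c (gamma t) ->
  exists mu, chart_acc (tens02_coord c G) (c \o gamma) t = mu *: 'D_1 (c \o gamma) t.
Proof.
move=> ca oI gS [J [sig [[sigS geo] [s [sS ds sJ gs]]]]] It cgt.
have ds' u : I u -> 'D_1 s u != 0 by move=> Iu; rewrite -derive1E; exact: ds.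
have oJ : open J by rewrite -sJ; exact: open_image.
have IJ u : I u -> J (s u) by move=> Iu; rewrite -sJ; exists u.
pose J' := J `&` sig @^-1` cdom c.
have oJ' : open J' by exact: (open_curve_dom (c := c) oJ sigS).
pose I' := I `&` gamma @^-1` cdom c.
have oI' : open I' by exact: (open_curve_dom (c := c) oI gS).
have I't : I' t by [].
have IJ' u : I' u -> J' (s u).
  by move=> [Iu cu]; split; [exact: IJ|rewrite /= -gs].
pose A := c @` (~` polar M `&` cdom c).
have oA : open A by apply: open_chart_image; apply: closed_openC; exact: polar_closed.
have JA u : J' u -> A ((c \o sig) u).
  by move=> [Ju cu]; exists (sig u) => //; split=> //; have [] := geo u Ju.
have sC : Cn 2 I' s by apply: (Cn_sub _ (sS 2%N)) => u [].
have [d1 acc] := chart_acc_reparam oA oI' oJ' JA IJ' I't (metric_chart_smooth ca 1%N)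
  (sigS.2 c ca 2%N) sC.
have E1 : \forall u \near t, (c \o gamma) u = (c \o sig) (s u).
  near=> u; have [Iu _] : I' u by near: u; exact: (open_nbhs_nbhs (conj oI' I't)).
  by rewrite /comp gs.
have [Jst cst] := IJ' t I't; have [npol acc0] := geo _ Jst.
have /(acceleration_eq0 ca oJ sigS Jst cst npol) {}acc0 := acc0.
rewrite (near_eq_chart_acc _ E1) acc acc0 scaler0 add0r (near_eq_derive (1 : R) E1) d1.
exists ('D_1 ('D_1 s) t / 'D_1 s t).
by rewrite scalerA divfK// ds'.
Unshelve. all: by end_near. Qed.

Variables (p : M) (c : chart R m M) (U : set E) (B : E -> 'M[R]_m) (f k : E -> R) (n : E -> E).
Hypotheses (pp : polar M p) (ca : atlas c) (cp : cdom c p) (Up : U (c p)).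
Hypothesis PM : polar_model U (tens20_coord c h) B f k n.
Hypothesis fP : forall x, cdom c x -> U (c x) -> polar M x <-> f (c x) = 0.

Let fp : f (c p) = 0.
Proof. exact/fP. Qed.

(* [f] is used as parameter along the curve. *)
Lemma crossing_normalize e gamma : crossing_pregeodesic p e gamma ->
  exists (d r : R) (g : R -> R) X lam,
  [/\ 0 < d <= e, 0 < r, smooth_on `]-r, r[%classic g &
    crossing_curve U (tens20_coord c h) B f (c p) r (fun u => c (gamma (g u))) X lam] /\
  [/\ forall t, t \in `]-d, d[ -> cdom c (gamma t) /\ 'D_1 (f \o c \o gamma) t != 0,
    smooth_on `]-d, d[%classic (f \o c \o gamma),
    forall u, u \in `]-r, r[ -> (g u \in `]-d, d[) /\ 'D_1 g u != 0 &
    forall t, t \in `]-d, d[ -> g (f (c (gamma t))) = t].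
Proof.
move=> [[e0 gS _] [g0 gt gpol pg1 pg2]].
have oI : open (`]-e, e[%classic : set R) by exact: interval_open.
have e0in : (`]-e, e[%classic : set R) 0 by rewrite /= in_itv /= oppr_lt0 e0.
have oU := pm_open PM.
have oT := open_curve_dom (c := c) oI gS.
have ZS := gS.2 c ca.
pose I' := (`]-e, e[%classic `&` gamma @^-1` cdom c) `&` (c \o gamma) @^-1` U.
have oI' : open I' by exact: (open_setI_preimage oT oU (fun t Tt => Cn_cont (ZS 0%N) Tt)).
have I'0 : I' 0 by split; [split=> //=; rewrite g0|rewrite /= g0].
have ZS' i : Cn i I' (c \o gamma) by apply: (Cn_sub _ (ZS i)) => t [].
have phS : smooth_on I' (f \o c \o gamma).
  move=> i; apply: (Cn_comp_scalar (f := f) (g := c \o gamma) oI' oU _ (ZS' i) (pm_f PM i)).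
  by move=> t [].
have ph0 : (f \o c \o gamma) 0 = 0 by rewrite /= g0.
have cg0 : cdom c (gamma 0) by rewrite g0.
(* A zero derivative would mean that [df] kills the velocity, which would then be tangent:
   transversality is what allows [f] as parameter. *)
have dph0 : 'D_1 (f \o c \o gamma) 0 != 0.
  have Zd := Cn_is_derive (1 : R) (ZS' 1%N) I'0.
  have Uc0 : U ((c \o gamma) 0) by rewrite /= g0.
  have [_ ->] := is_derive_comp_scalar oU Uc0 (pm_f PM 1%N) Zd.
  rewrite (derive_grad _ oU Uc0 (pm_f PM 1%N)) /= g0; apply/eqP => d0; apply: gt.
  have := grad_tangent ca PM fP cp Up pp d0.
  rewrite (velocity_chart oI gS ca e0in cg0) g0 -mulmxA.
  by rewrite (coord_jacV (chart_at_atlas p) ca (chart_at_dom p) cp) mulmx1.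
have [d [r [g [[d0 r0 grS dP] [gP gph]]]]] := local_inverse oI' I'0 phS ph0 dph0.
have oK : open (`]-r, r[%classic : set R) by exact: interval_open.
pose Y u := c (gamma (g u)).
have gI u : `]-r, r[%classic u -> I' (g u) by move=> /gP[/dP[]].
have YS : smooth_on `]-r, r[%classic Y.
  by move=> i; exact: (Cn_comp1_mx (f := c \o gamma) (g := g) oK oI' gI (grS i) (ZS' i)).
have Yf u : u \in `]-r, r[ -> f (Y u) = u by move=> /gP[].
have g00 : g 0 = 0.
  by have := gph 0; rewrite ph0; apply; rewrite in_itv /= oppr_lt0 d0.
have acc u : u \in `]-r, r[ -> u != 0 -> exists mu,
    chart_acc (tens02_coord c G) Y u = mu *: 'D_1 Y u.
  move=> ur u0; have [gd phg dg] := gP u ur; have [[[Ig cg] Ug] _] := dP _ gd.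
  have gn0 : g u != 0.
    by apply: contraNneq u0 => gu; rewrite -phg gu ph0.
  have gneg : ~ polar M (gamma (g u)) by exact: gpol.
  have [mu muE] : exists mu, chart_acc (tens02_coord c G) (c \o gamma) (g u) =
      mu *: 'D_1 (c \o gamma) (g u).
    move: Ig; rewrite /= in_itv /= => /andP[eg ge].
    case: (ltgtP (g u) 0) gn0 => // [gu0 _|gu0 _].
      have g1 : smooth_curve `]-e, 0[%classic gamma.
        apply: smooth_curve_sub gS => t /=; rewrite !in_itv /= => /andP[-> t0] /=.
        exact: lt_trans t0 e0.
      have it : `]-e, 0[%classic (g u) by rewrite /= in_itv /= eg.
      exact: (pregeodesic_chart_acc ca (@itv_oo_open _ (- e) 0) g1 pg1 it cg).
    have g1 : smooth_curve `]0, e[%classic gamma.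
      apply: smooth_curve_sub gS => t /=; rewrite !in_itv /= => /andP[t0 ->].
      by rewrite andbT (lt_trans _ t0)// oppr_lt0.
    have it : `]0, e[%classic (g u) by rewrite /= in_itv /= ge andbT.
    exact: (pregeodesic_chart_acc ca (@itv_oo_open _ 0 e) g1 pg2 it cg).
  pose A := c @` (~` polar M `&` cdom c).
  have oN : open (~` polar M) by apply: closed_openC; exact: polar_closed.
  have oA : open A by exact: open_chart_image.
  pose J' := I' `&` gamma @^-1` (~` polar M).
  have oJ' : open J'.
    by apply: open_setI_preimage => // t [[It _] _]; exact: gS.1.
  have JA t : J' t -> A ((c \o gamma) t) by move=> [[[_ ct] _] nt]; exists (gamma t).
  pose K' := `]-r, r[%classic `&` g @^-1` J'.
  have oK' : open K' by exact: (open_setI_preimage oK oJ' (fun t Tt => Cn_cont (grS 0%N) Tt)).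
  have K'u : K' u by split=> //; split=> //; exact: gI.
  have KJ v : K' v -> J' (g v) by move=> [].
  have ZC : Cn 2 J' (c \o gamma) by apply: (Cn_sub _ (ZS' 2%N)) => t [].
  have gC : Cn 2 K' g by apply: (Cn_sub _ (grS 2%N)) => t [].
  have [d1 a1] := chart_acc_reparam oA oK' oJ' JA KJ K'u (metric_chart_smooth ca 1%N) ZC gC.
  have -> : 'D_1 Y u = 'D_1 g u *: 'D_1 (c \o gamma) (g u) by exact: d1.
  have -> : chart_acc (tens02_coord c G) Y u =
    'D_1 g u ^+ 2 *: chart_acc (tens02_coord c G) (c \o gamma) (g u) +
    'D_1 ('D_1 g) u *: 'D_1 (c \o gamma) (g u) by exact: a1.
  rewrite muE; move: dg; move: ('D_1 g u) ('D_1 ('D_1 g) u) ('D_1 (c \o gamma) (g u)) => x y z x0.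
  by exists ((x ^+ 2 * mu + y) / x); rewrite !scalerA divfK// scalerDl.
(* [lam] is chosen pointwise; its value at [u = 0] is a mere default, since [crossing_curve]
   constrains it off 0 only. *)
have [lam lamP] : exists lam : R -> R, forall u, u \in `]-r, r[ -> u != 0 ->
    chart_acc (tens02_coord c G) Y u = lam u *: 'D_1 Y u.
  have /choice[lam lamP] : forall u, exists mu, u \in `]-r, r[ -> u != 0 ->
      chart_acc (tens02_coord c G) Y u = mu *: 'D_1 Y u.
    move=> u; have [ur|nur] := boolP (u \in `]-r, r[); last by exists 0.
    by have [->|/(acc u ur)[mu muE]] := eqVneq u 0; [exists 0|exists mu].
  by exists lam.
have sub0 x : -r < x -> x < r -> x \in `]-r, r[ by move=> h1 h2; rewrite in_itv /= h1 h2.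
exists d, r, g, (fun u => u^-1 *: ('D_1 Y u *m B (Y u))), lam; split; split=> //.
- rewrite d0 /= leNgt; apply/negP => ed.
  have /dP[[[+ _] _] _] : e \in `]-d, d[.
    by rewrite in_itv /= ed andbT (lt_trans _ e0)// oppr_lt0.
  by rewrite /= in_itv /= ltxx andbF.
- split=> //.
  + by rewrite /= g00 g0.
  + by move=> u ur; have [_] := gI u ur.
  + move=> u ur u0; have [gd phg _] := gP u ur; have [[[Ig cg] Ug] _] := dP _ gd.
    pose A := c @` (~` polar M `&` cdom c).
    have oN : open (~` polar M) by apply: closed_openC; exact: polar_closed.
    have oA : open A by exact: open_chart_image.
    pose K' : set R := `]-r, r[%classic `&` [set t | t != 0].
    have oK' : open K' by apply: openI => //; exact: open_neq.
    have K'u : K' u by [].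
    have KA v : K' v -> A (Y v).
      move=> [vr v0]; have [gvd phv _] := gP v vr; have [[[Igv cgv] Ugv] _] := dP _ gvd.
      exists (gamma (g v)) => //; split=> //; apply: gpol => //.
      by apply: contraNneq v0 => gv; rewrite -phv gv ph0.
    have Gh y : A y -> tens02_coord c G y *m tens20_coord c h y = 1%:M.
      by move=> [x [nx cx] <-]; exact: chart_metric_dual.
    have Gs y : A y -> (tens02_coord c G y)^T = tens02_coord c G y.
      by move=> [x [nx cx] <-]; exact: chart_metric_tr.
    have hC : Cn 1 A (tens20_coord c h).
      by apply: (Cn_sub _ (dual_chart_smooth ca 1%N)) => _ [x [_ cx] <-]; exists x.
    have YC : Cn 2 K' Y by apply: (Cn_sub _ (YS 2%N)) => s [].
    (* Since [B h = f] and [f (Y v) = v], the metric along the curve is [B / v]. *)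
    have XE v : K' v -> v^-1 *: ('D_1 Y v *m B (Y v)) = 'D_1 Y v *m tens02_coord c G (Y v).
      move=> [vr v0]; have Uv : U (Y v) by have [_] := gI v vr.
      have hG := mulmx1C (Gh _ (KA v (conj vr v0))).
      have -> : B (Y v) = v *: tens02_coord c G (Y v).
        rewrite -[LHS]mulmx1 -hG mulmxA (pm_Bh PM Uv) (Yf v vr).
        by rewrite mul_scalar_mx.
      by rewrite -scalemxAr scalerA mulVf// scale1r.
    have d1 := is_derive_covelocity oA oK' KA K'u (metric_chart_smooth ca 1%N) hC YC Gh Gs.
    rewrite (lamP u ur u0) -scalemxAl -(XE u K'u) in d1.
    have nE : \forall v \near u, 'D_1 Y v *m tens02_coord c G (Y v) = v^-1 *: ('D_1 Y v *m B (Y v)).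
      by near=> v; apply/esym/XE; near: v; exact: (open_nbhs_nbhs (conj oK' K'u)).
    exact: (near_eq_is_derive nE d1).
- by move=> t /dP[[[_ ct] _] dt].
- by move=> i; apply: (Cn_sub _ (phS i)) => t /dP[].
- by move=> u /gP[].
Unshelve. all: by end_near. Qed.

End Crossing.

Section Uniqueness.
Context {R : realType} {m : nat} {M : riemannLorentz R m}.
Local Notation E := 'rV[R]_m.
Local Notation G := (metric M).
Local Notation h := (dual_metric M).

(** Reparametrized by [f], the curve has velocity [n] at the crossing; undoing the parametrization
    contributes the factor [1 / g' 0]. *)
Lemma crossing_velocity (p : M) (U : set E) (B : E -> 'M[R]_m) (f k : E -> R) (n : E -> E)
    e gamma : polar M p -> U (chart_at p p) ->
  polar_model U (tens20_coord (chart_at p) h) B f k n ->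
  (forall x, cdom (chart_at p) x -> U (chart_at p x) -> polar M x <-> f (chart_at p x) = 0) ->
  crossing_pregeodesic p e gamma -> exists a, velocity gamma 0 = a *: n (chart_at p p).
Proof.
move=> pp Up PM fP cg.
have ca := chart_at_atlas p; have cp := chart_at_dom p.
have fp : f (chart_at p p) = 0 by apply/fP.
have [d [r [g [X [lam [[/andP[d0 de] r0 gS CC] [dP phS gP gph]]]]]]] :=
  crossing_normalize pp ca cp Up PM fP cg.
have [[e0 gaS _] [g0 _ _ _ _]] := cg.
have [Y0 _] := crossing_curve_normal_form PM fp CC.
have r0in : (0 : R) \in `]-r, r[ by rewrite in_itv /= oppr_lt0 r0.
have d0in : (0 : R) \in `]-d, d[ by rewrite in_itv /= oppr_lt0 d0.
have g00 : g 0 = 0 by have := gph 0 d0in; rewrite g0 fp.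
have [_ dg] := gP 0 r0in.
have e0in : (`]-e, e[%classic : set R) 0 by rewrite /= in_itv /= oppr_lt0 e0.
have cg0 : cdom (chart_at p) (gamma 0) by rewrite g0.
have gd := Cn_is_derive (1 : R) (gS 1%N) r0in.
have Zd : is_derive (g 0) 1 (chart_at p \o gamma) ('D_1 (chart_at p \o gamma) 0).
  by rewrite g00; apply: (Cn_is_derive (1 : R) (gaS.2 _ ca 1%N)); split.
have [_ YE] := is_derive_chain1 gd Zd.
exists ('D_1 g 0)^-1; rewrite -Y0.
rewrite [X in _ = _ *: X]YE scalerA mulVf// scale1r.
rewrite (velocity_chart (itv_oo_open (a := - e) (b := e)) gaS ca e0in cg0).
by rewrite g0 coord_jac_id// mulmx1.
Qed.

Theorem crossing_pregeodesic_unique (p : M) (e1 e2 : R) (gamma1 gamma2 : R -> M) :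
  polar M p -> crossing_pregeodesic p e1 gamma1 -> crossing_pregeodesic p e2 gamma2 ->
  exists (d : R) (J : set R),
    [/\ 0 < d <= e1, J `<=` `]-e2, e2[, J 0 & reparam `]-d, d[ gamma1 J gamma2].
Proof.
move=> pp cg1 cg2; set c := chart_at p.
have ca : atlas c := chart_at_atlas p; have cp : cdom c p := chart_at_dom p.
have [U [B [f [k [n [Up UO PM fP _]]]]]] := chart_polar_model ca cp pp.
have fp : f (c p) = 0 by apply/fP.
have [d1 [r1 [g1 [X1 [lam1 [[/andP[d10 de1] r10 gS1 C1] [dP1 phS1 gP1 gph1]]]]]]] :=
  crossing_normalize pp ca cp Up PM fP cg1.
have [d2 [r2 [g2 [X2 [lam2 [[/andP[d20 de2] r20 gS2 C2] [dP2 phS2 gP2 gph2]]]]]]] :=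
  crossing_normalize pp ca cp Up PM fP cg2.
have [[e10 gaS1 _] [g10 _ _ _ _]] := cg1.
have [[e20 gaS2 _] [g20 _ _ _ _]] := cg2.
have [a a0 aP] := crossing_curve_unique PM fp C1 C2.
set phi := f \o c \o gamma1 in phS1.
have phi0 : phi 0 = 0 by rewrite /phi /= g10.
have d10in : (0 : R) \in `]-d1, d1[ by rewrite in_itv /= oppr_lt0 d10.
have d20in : (0 : R) \in `]-d2, d2[ by rewrite in_itv /= oppr_lt0 d20.
pose b := Num.min a (Num.min r1 r2).
have b0 : 0 < b by rewrite !lt_min a0 r10 r20.
have [d d0 dP] : exists2 d, 0 < d & forall t, t \in `]-d, d[ -> (t \in `]-d1, d1[) /\ `|phi t| < b.
  apply: near0_itv; near=> t; split.
    by near: t; exact: (open_nbhs_nbhs (conj (itv_oo_open (a := - d1) (b := d1)) d10in)).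
  near: t; have phc := Cn_cont (phS1 0%N) d10in.
  have /cvgrPdist_lt /(_ b b0) := phc; rewrite phi0.
  by apply: filterS => t; rewrite sub0r normrN.
have inb t x : b <= x -> t \in `]-d, d[ -> phi t \in `]-x, x[.
  by move=> bx /dP[_ tb]; rewrite in_itv /= -ltr_norml (lt_le_trans tb).
have pr1 t : t \in `]-d, d[ -> phi t \in `]-r1, r1[.
  by apply: inb; rewrite /b !ge_min lexx !orbT.
have pr2 t : t \in `]-d, d[ -> phi t \in `]-r2, r2[.
  by apply: inb; rewrite /b !ge_min lexx !orbT.
have pra t : t \in `]-d, d[ -> phi t \in `]-a, a[ by apply: inb; rewrite /b !ge_min lexx.
have sub1 t : t \in `]-d, d[ -> t \in `]-d1, d1[ by move=> /dP[].
(* Parametrized by [f], the two curves coincide near 0; the point of [gamma2] matching [gamma1 t] is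
   the one with the same value of [f]. *)
pose s t := g2 (phi t).
have oD : open (`]-d, d[%classic : set R) by exact: interval_open.
have phSd : smooth_on `]-d, d[%classic phi by move=> i; exact: (Cn_sub sub1 (phS1 i)).
have sS : smooth_on `]-d, d[%classic s.
  by move=> i; exact: (Cn_comp1 (f := g2) oD (itv_oo_open (a := - r2) (b := r2)) pr2 (phSd i) (gS2 i)).
have s0 : s 0 = 0.
  by rewrite /s phi0; have := gph2 0 d20in; rewrite g20 fp.
have d0in : (0 : R) \in `]-d, d[ by rewrite in_itv /= oppr_lt0 d0.
exists d, (s @` `]-d, d[%classic); split.
- rewrite d0 /= (le_trans _ de1)// leNgt; apply/negP => dd.
  have : d1 \in `]-d, d[ by rewrite in_itv /= dd andbT (lt_trans _ d10)// oppr_lt0.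
  by move=> /sub1; rewrite in_itv /= ltxx andbF.
- by move=> _ [t td <-] /=; apply: (itv_sym_sub de2); have [] := gP2 _ (pr2 t td).
- by exists 0.
exists s; split=> // t td.
  rewrite derive1E; have [_ dg] := gP2 _ (pr2 t td).
  have gd := Cn_is_derive (1 : R) (gS2 1%N) (pr2 t td).
  have phd := Cn_is_derive (1 : R) (phSd 1%N) td.
  have [_ ->] := is_derive_chain1 phd gd.
  by rewrite mulf_neq0//; have [_] := dP1 t (sub1 t td).
have [ct _] := dP1 t (sub1 t td).
have [gd2 _] := gP2 _ (pr2 t td); have [ct2 _] := dP2 _ gd2.
rewrite -(cmapK ct) -(cmapK ct2); congr (cinv c _).
by rewrite -[in LHS](gph1 t (sub1 t td)); exact: (aP _ (pra t td)).
Unshelve. all: by end_near. Qed.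

End Uniqueness.

(** * The polar-normal direction *)

Section Connection.
Context {R : realType} {m : nat} {M : riemannLorentz R m}.
Local Notation E := 'rV[R]_m.
Local Notation G := (metric M).

(** As for curves, the second derivatives of the change of charts cancel between the two terms of
    [nabla]. *)
Lemma nabla_chart (c : chart R m M) (W : set M) (X Y : M -> E) x : atlas c -> open W ->
  W x -> cdom c x -> ~ polar M x -> smooth_vec W Y ->
  nabla G X Y x *m coord_jac (chart_at x) c x =
  'D_(vec_coord c X (c x)) (vec_coord c Y) (c x)
  + christoffel (tens02_coord c G) (c x) (vec_coord c X (c x)) (vec_coord c Y (c x)).
Proof.
move=> ca oW Wx cx nx YS.
have xa := chart_at_atlas x; have xx := chart_at_dom x; set c0 := chart_at x in xa xx *.
rewrite /nabla -/c0 mulmxDl (christoffel_chart _ _ xa ca xx cx nx).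
rewrite -(vec_coordE X cx) -(vec_coordE Y cx) [_ + 'D_(X x) _ _]addrC addrA; congr (_ + _).
have oW' : open (W `&` cdom c) by apply: openI => //; exact: cdom_open.
pose A := c0 @` ((W `&` cdom c) `&` cdom c0).
have oA : open A by exact: open_chart_image.
have Ax : A (c0 x) by exists x.
have subA : A `<=` c0 @` (cdom c0 `&` cdom c).
  by move=> _ [z [[Wz cz] c0z] <-]; exists z.
have subA' : A `<=` c0 @` (W `&` cdom c0).
  by move=> _ [z [[Wz cz] c0z] <-]; exists z.
have phC : Cn 2 A (c \o cinv c0) := Cn_sub subA (Cn_transition 2 xa ca).
have Y0d := Cn_is_derive (X x) (Cn_sub subA' (YS c0 xa 1%N)) Ax.
have Jd := Cn_is_derive (X x) (Cn_jacobian oA phC) Ax.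
have d1 := is_derive_mulmx Y0d Jd.
have q : vec_coord c0 Y (c0 x) = Y x := vec_coord_chart_at Y x.
rewrite q in d1.
have phd := Cn_is_derive (X x) (CnW phC) Ax.
have oB : open (c @` (W `&` cdom c)) by exact: open_chart_image.
have e : (c \o cinv c0) (c0 x) = c x by rewrite /comp (cmapK xx).
have Bx : (c @` (W `&` cdom c)) ((c \o cinv c0) (c0 x)) by rewrite e; exists x.
have d2 := is_derive_comp oB Bx (YS c ca 1%N) phd.
have EE y : A y -> vec_coord c0 Y y *m jacobian (c \o cinv c0) y = vec_coord c Y ((c \o cinv c0) y).
  move=> [z [[Wz cz] c0z] <-].
  have -> : (c \o cinv c0) (c0 z) = c z by rewrite /comp (cmapK c0z).
  by rewrite (vec_coord_change Y xa ca c0z cz).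
have := is_derive_unique_on oA Ax EE d1 d2.
rewrite (derive_jacobian2 _ _ oA Ax phC) e (coord_jacE _ xa ca xx cx) -(vec_coordE X cx).
exact: id.
Qed.

Lemma box_chart (c : chart R m M) (W : set M) (X Y Z : M -> E) x : atlas c -> open W ->
  W x -> cdom c x -> ~ polar M x -> smooth_vec W Y ->
  box G X Y Z x = dot (('D_(vec_coord c X (c x)) (vec_coord c Y) (c x)
  + christoffel (tens02_coord c G) (c x) (vec_coord c X (c x)) (vec_coord c Y (c x)))
  *m tens02_coord c G (c x)) (vec_coord c Z (c x)).
Proof.
move=> ca oW Wx cx nx YS; rewrite /box (ev02_coord G _ _ ca cx).
have := nabla_chart X ca oW Wx cx nx YS; have := vec_coordE Z cx.
by move: (coord_jac _ _ _) (nabla _ _ _ _) => K v -> ->.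
Qed.

End Connection.

(** * Polar normality in coordinates *)

Section PolarNormalLocal.
Context {R : realType} {m : nat}.
Local Notation E := 'rV[R]_m.
Local Notation e_ l := (delta_mx 0 l : E).

Lemma eq0_off_regular_zeros_scalar (O : set E) (g F : E -> R) :
  open O -> (forall y, O y -> g y = 0 -> exists v, 'D_v g y != 0) ->
  (forall y, O y -> {for y, continuous F}) ->
  (forall y, O y -> g y != 0 -> F y = 0) -> forall y, O y -> F y = 0.
Proof.
move=> oO greg Fc F0 y Oy.
have := @eq0_off_regular_zeros R m 1 1 O g (fun y => const_mx (F y)) oO greg.
move=> /(_ _ _ y Oy) H; suff : (const_mx (F y) : 'M[R]_1) = 0 by move=> /matrixP/(_ 0 0); rewrite !mxE.
apply: H => z Oz; last by move=> gz; apply/matrixP => i j; rewrite !mxE (F0 z Oz gz).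
apply/continuous_mxP => i j; apply: near_eq_continuous (Fc z Oz).
by near=> u; rewrite mxE.
Unshelve. all: by end_near. Qed.

Lemma dot_hessian_sym (A : set E) (f : E -> R) y u v : open A -> A y -> Cn 2 A f ->
  dot ('D_u (grad f) y) v = dot u ('D_v (grad f) y).
Proof.
move=> oA Ay fC; rewrite (derive_dirE v oA Ay (Cn_grad oA fC)) dot_sumr dotE.
by apply: eq_bigr => l _; rewrite (hessian_sym _ _ oA Ay fC) mulrC.
Qed.

Variables (O : set E) (h B : E -> 'M[R]_m) (f k : E -> R) (n : E -> E).
Hypothesis PM : polar_model O h B f k n.
Variables (A : set E) (N X : E -> E) (hh : E -> R) (y : E) (b : R) (w : E).
Hypotheses (oA : open A) (AO : A `<=` O) (Ay : A y) (fy : f y = 0).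
Hypotheses (NC : Cn 2 A N) (XC : Cn 2 A X) (hhC : Cn 1 A hh) (hhy : hh y = 0).
Hypothesis Xy : X y = b *: (w *m h y).

(** The coordinate expression of [g(nabla_N N, X)] with [B] in place of the metric: unlike the
    latter, it is smooth on the polar end. *)
Definition box_polar (z : E) : R :=
  dot ('D_(N z) N z *m B z) (X z) + dot (N z *m 'D_(N z) B z) (X z)
  - 2^-1 * dot (N z *m 'D_(X z) B z) (N z).

Hypothesis perp : forall z, A z -> f z != 0 -> dot (N z *m B z) (X z) = 0.
Hypothesis boxE : forall z, A z -> f z != 0 ->
  hh z * f z * dot (N z *m B z) (N z) =
  f z * box_polar z + 2^-1 * (dot (X z) (grad f z) * dot (N z *m B z) (N z)).
Hypothesis tan : 'D_(X y)
  (fun z => dot (N y *m (B z - (grad f z)^T *m grad f z)) (N y)) y = 0.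

Lemma polar_normal_local : dot (N y) (grad f y) != 0 ->
  b * dot (N y - dot (N y) (grad f y) *: n y) w = 0.
Proof.
set a := dot _ _ => a0; have Oy := AO Ay.
have fC i : Cn i A f := Cn_sub AO (pm_f PM i).
have BC i : Cn i A B := Cn_sub AO (pm_B PM i).
have gC i : Cn i A (grad f) by apply: (Cn_grad oA); exact: fC.
have NC1 := CnW NC; have XC1 := CnW XC.
have reg z : A z -> f z = 0 -> exists v, 'D_v f z != 0.
  move=> Az fz; exists (n z); rewrite (derive_grad _ oA Az (fC 1%N)) (pm_norm PM (AO Az)).
  by rewrite fz mul0r addr0 oner_eq0.
have NBXC : Cn 1 A (fun z => dot (N z *m B z) (X z)).
  exact: (Cn_dot oA (Cn_mulmx oA NC1 (BC 1%N)) XC1).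
have perp' : forall z, A z -> dot (N z *m B z) (X z) = 0.
  by apply: (eq0_off_regular_zeros_scalar oA reg _ perp) => z Az; exact: (Cn_cont NBXC).
have NBNC : Cn 1 A (fun z => dot (N z *m B z) (N z)).
  exact: (Cn_dot oA (Cn_mulmx oA NC1 (BC 1%N)) NC1).
have XfC : Cn 1 A (fun z => dot (X z) (grad f z)) by exact: (Cn_dot oA XC1 (gC 1%N)).
have DNNC : Cn 1 A (fun z => 'D_(N z) N z).
  exact: (Cn_derive_along oA oA (fun z Az => Az) (Cn_id 1 A) NC1 NC).
have DNBC : Cn 1 A (fun z => 'D_(N z) B z).
  exact: (Cn_derive_along oA oA (fun z Az => Az) (Cn_id 1 A) NC1 (BC 2%N)).
have DXBC : Cn 1 A (fun z => 'D_(X z) B z).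
  exact: (Cn_derive_along oA oA (fun z Az => Az) (Cn_id 1 A) XC1 (BC 2%N)).
have FC : Cn 1 A box_polar.
  apply: (CnB oA); first apply: (CnD oA).
  - exact: (Cn_dot oA (Cn_mulmx oA DNNC (BC 1%N)) XC1).
  - exact: (Cn_dot oA (Cn_mulmx oA NC1 DNBC) XC1).
  - apply: (CnM oA); first exact: Cn_cst.
    exact: (Cn_dot oA (Cn_mulmx oA NC1 DXBC) NC1).
pose Phi z := hh z * f z * dot (N z *m B z) (N z) -
  (f z * box_polar z + 2^-1 * (dot (X z) (grad f z) * dot (N z *m B z) (N z))).
have PhiC : Cn 1 A Phi.
  apply: (CnB oA); first exact: (CnM oA (CnM oA hhC (fC 1%N)) NBNC).
  apply: (CnD oA); first exact: (CnM oA (fC 1%N) FC).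
  by apply: (CnM oA); [exact: Cn_cst|exact: (CnM oA XfC NBNC)].
have Phi0 : forall z, A z -> Phi z = 0.
  apply: (eq0_off_regular_zeros_scalar oA reg) => [z Az|z Az fz]; first exact: (Cn_cont PhiC).
  by rewrite /Phi boxE// subrr.
pose g := grad f y; pose v := N y; pose H := 'D_v (grad f) y.
have gn : dot (n y) g = 1 by rewrite (pm_norm PM Oy) fy mul0r addr0.
have By : B y = g^T *m g by exact: (pm_B0 PM Oy fy).
have Xg : dot (X y) g = 0.
  rewrite Xy dotZl dot_mulmx (pm_hsym PM Oy) (pm_grad PM Oy) fy scale0r dot0r.
  exact: mulr0.
have BX u : dot (u *m B y) (X y) = 0.
  by rewrite By row_dyad dotZl [dot g _]dotC Xg mulr0.
have dfv : 'D_v f y = a by rewrite (derive_grad _ oA Ay (fC 1%N)).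
have dN := Cn_is_derive v NC1 Ay. have dX := Cn_is_derive v XC1 Ay.
have dB := Cn_is_derive v (BC 1%N) Ay. have dg := Cn_is_derive v (gC 1%N) Ay.
have df := Cn_is_derive v (fC 1%N) Ay.
pose S := dot (v *m 'D_v B y) (X y).
(* Derivative along [N] of the orthogonality relation [perp']. *)
have i1 : S + a * dot g ('D_v X y) = 0.
  have d1 := is_derive_dot (is_derive_mulmx dN dB) dX.
  have := is_derive_unique_on oA Ay perp' d1 (is_derive_cst (0 : R) y v).
  by rewrite dotDl BX add0r By row_dyad dotZl.
(* Derivative along [N] of [boxE]. The derivatives of [hh], [box_polar] and [N B N] drop out because
   [f], [hh] and [df(X)] vanish at [y]. *)
have i2 : a * box_polar y + 2^-1 * ((dot ('D_v X y) g + dot (X y) H) * a ^+ 2) = 0.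
  have dhh := Cn_is_derive v hhC Ay. have dF := Cn_is_derive v FC Ay.
  have dq := Cn_is_derive v NBNC Ay.
  have d1 := is_deriveM (is_deriveM dhh df) dq.
  have d2 := is_deriveM df dF.
  have d3 := is_deriveM (is_derive_cst (2^-1 : R) y v) (is_deriveM (is_derive_dot dX dg) dq).
  have d4 := is_deriveB d1 (is_deriveD d2 d3).
  have := is_derive_unique_on oA Ay Phi0 d4 (is_derive_cst (0 : R) y v).
  have qa : dot (N y *m B y) (N y) = a ^+ 2.
    by rewrite By row_dyad dotZl [dot g _]dotC expr2.
  rewrite /GRing.scale /= /cst /GRing.scale /= hhy fy dfv qa -/g Xg -/H.
  move: (dot _ _ + dot _ _) (box_polar y) ('D_v hh y) => r1 r2 r3.
  have -> : (hh * f) y = 0 by change (hh y * f y = 0); rewrite hhy mul0r.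
  by rewrite !(mul0r, mulr0, addr0, add0r) => /eqP; rewrite oppr_eq0 => /eqP <-; ring.
have i3 : dot (v *m 'D_(X y) B y) v = 2 * (a * dot (X y) H).
  have dXB := Cn_is_derive (X y) (BC 1%N) Ay; have dXg := Cn_is_derive (X y) (gC 1%N) Ay.
  have d1 := is_deriveB dXB (is_derive_mulmx (is_derive_tr dXg) dXg).
  have d2 := is_derive_dot (is_derive_mulmx (is_derive_cst v y (X y)) d1) (is_derive_cst v y (X y)).
  have [_] := d2; rewrite [X in X = _ -> _]tan mul0mx add0r dot0r addr0 /cst.
  rewrite mulmxBr dotDl dotNl mulmxDr dotDl !row_dyad !dotZl -/g.
  have va : dot v g = a by [].
  rewrite [dot g v]dotC va [dot v ('D__ _ _)]dotC (dot_hessian_sym (X y) v oA Ay (fC 2%N)) -/H.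
  by move=> /esym/eqP; rewrite subr_eq0 => /eqP ->; ring.
(* [i1] and [i2] share the unknown [df('D_v X)]; eliminating it expresses [S] by the Hessian of
   [f]. *)
have i4 : S = a * dot (X y) H.
  have Fy : box_polar y = S - a * dot (X y) H.
    by rewrite /box_polar (BX ('D_(N y) N y)) add0r -/v i3 -/S mulKf.
  move: i1 i2; rewrite Fy {Fy} [dot _ g]dotC; move: S (dot (X y) H) (dot g _) => S' q r i1 i2.
  apply: (mulfI a0); apply/eqP; rewrite -subr_eq0; apply/eqP.
  transitivity (2 * (a * (S' - a * q) + 2^-1 * ((r + q) * a ^+ 2)) - a * (S' + a * r)).
    by field.
  by rewrite i1 i2 !mulr0 subrr.
have i5 : dot (n y *m 'D_v B y) (X y) = dot (X y) H.
  have dn := Cn_is_derive v (Cn_sub AO (pm_n PM 1%N)) Ay.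
  have := is_derive_unique_on oA Ay (fun z Az => pm_nB PM (AO Az)) (is_derive_mulmx dn dB) dg.
  by rewrite -/H => <-; rewrite [RHS]dotC dotDl BX add0r.
set T := _ - _.
have Tg : dot T g = 0 by rewrite dotDl dotNl dotZl gn mulr1 subrr.
have i6 : dot (T *m 'D_v B y) (X y) = 0.
  by rewrite mulmxBl -scalemxAl dotDl dotNl dotZl i5 -i4 subrr.
(* Derivative of [B h = f]; the term with the derivative of [h] disappears because
   [T B = df(T) df = 0] at [y]. *)
have i7 : T *m 'D_v B y *m h y = a *: T.
  have dh := Cn_is_derive v (Cn_sub AO (pm_h PM 1%N)) Ay.
  have d1 := is_derive_mulmx dB dh.
  have d2 : is_derive y v (fun z => f z *: (1%:M : 'M[R]_m)) (a *: 1%:M + f y *: 0).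
    by rewrite -dfv; exact: (is_derive_scalemx df (is_derive_cst 1%:M y v)).
  have EE z : A z -> B z *m h z = f z *: (1%:M : 'M[R]_m).
    by move=> Az; rewrite (pm_Bh PM (AO Az)) scalemx1.
  have := is_derive_unique_on oA Ay EE d1 d2.
  rewrite scaler0 addr0 => /(congr1 (mulmx T)).
  rewrite mulmxDr !mulmxA By row_dyad Tg scale0r mul0mx addr0 => ->.
  by rewrite -scalemxAr mulmx1.
move: i6; rewrite Xy dotZr dotC dot_mulmx (pm_hsym PM Oy) i7 dotZr [dot w T]dotC.
by move=> /eqP; rewrite mulrCA mulf_eq0 (negbTE a0) /= => /eqP.
Qed.

End PolarNormalLocal.

Section PolarBox.
Context {R : realType} {m : nat}.
Local Notation E := 'rV[R]_m.

(** Substitute [B = f G]: the derivatives of [f] enter through the pairing of [N] with [X], which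
    vanishes, and through [df(X)], which gives the last term. *)
Lemma box_polarE (A : set E) (G B : E -> 'M[R]_m) (f : E -> R) (N X : E -> E) z :
  open A -> A z -> Cn 1 A G -> Cn 1 A B -> Cn 1 A f ->
  (forall y, A y -> B y = f y *: G y) -> G z \in unitmx -> f z != 0 ->
  dot (N z *m B z) (X z) = 0 ->
  f z * dot (('D_(N z) N z + christoffel G z (N z) (N z)) *m G z) (X z) =
  box_polar B N X z + 2^-1 * (dot (X z) (grad f z) / f z * dot (N z *m B z) (N z)).
Proof.
move=> oA Az GC BC fC BE Gu f0 perp.
have dB u a b : dot (a *m 'D_u B z) b =
    'D_u f z * dot (a *m G z) b + f z * ev02 ('D_u G z) a b.
  have df := Cn_is_derive u fC Az; have dG := Cn_is_derive u GC Az.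
  have d1 := is_derive_scalemx df dG.
  have -> : 'D_u B z = 'D_u f z *: G z + f z *: 'D_u G z.
    exact: (is_derive_unique_on oA Az BE (Cn_is_derive u BC Az) d1).
  by rewrite mulmxDr -!scalemxAr dotDl !dotZl ev02E.
have BEz := BE z Az.
have NGX : dot (N z *m G z) (X z) = 0.
  by move: perp; rewrite BEz -scalemxAr dotZl => /eqP; rewrite mulf_eq0 (negbTE f0) => /eqP.
rewrite mulmxDl (christoffel_lowered _ _ Gu) dotDl (lowered_christoffel_dot _ _ _ oA Az GC).
have e1 : dot (N z *m 'D_(N z) B z) (X z) = f z * ev02 ('D_(N z) G z) (N z) (X z).
  by rewrite dB NGX mulr0 add0r.
have e2 : dot (N z *m 'D_(X z) B z) (N z) =
    dot (X z) (grad f z) * dot (N z *m G z) (N z) + f z * ev02 ('D_(X z) G z) (N z) (N z).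
  by rewrite dB (derive_grad (X z) oA Az fC).
rewrite /box_polar e1 e2 BEz -!scalemxAr !dotZl {e1 e2 dB NGX}.
move: (dot (X z) _) (dot (N z *m G z) (N z)) (ev02 ('D_(N z) G z) _ _) => r2 r3 r4.
by move: (ev02 ('D_(X z) G z) _ _) (dot ('D_(N z) N z *m _) _) => r5 r1; field.
Qed.

End PolarBox.

Section PolarNormal.
Context {R : realType} {m : nat} {M : riemannLorentz R m}.
Local Notation E := 'rV[R]_m.
Local Notation G := (metric M).
Local Notation h := (dual_metric M).

Lemma tangent0 x : polar M x -> tangent (polar M) x 0.
Proof.
by move=> px; rewrite -(polar_tangent px) => mu _; rewrite /covec_app mul0mx mxE.
Qed.

Variables (p : M) (c : chart R m M) (U : set E) (B : E -> 'M[R]_m) (f k : E -> R) (n : E -> E).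
Hypotheses (ca : atlas c) (cp : cdom c p) (UO : U `<=` c @` cdom c).
Hypothesis PM : polar_model U (tens20_coord c h) B f k n.
Hypothesis fP : forall x, cdom c x -> U (c x) -> polar M x <-> f (c x) = 0.

Lemma polar_model_metric x : cdom c x -> U (c x) -> ~ polar M x ->
  B (c x) = f (c x) *: tens02_coord c G (c x).
Proof.
move=> cx Ux nx; rewrite -[LHS]mulmx1 -(mulmx1C (chart_metric_dual ca cx nx)).
by rewrite mulmxA (pm_Bh PM Ux) mul_scalar_mx.
Qed.

Variables (b : E -> R) (q : E) (r : R) (w : E).
Hypotheses (bS : smooth_on setT b) (bq : forall y, b y != 0 -> `|y - q| < r).
Hypothesis qU : forall y, `|y - q| <= r -> U y.

(* On the polar end [w h] is tangent, since [df h = f n] vanishes there. *)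
Definition bump_field (x : M) : E :=
  if `[< cdom c x >] then
    (b (c x) *: (w *m tens20_coord c h (c x))) *m coord_jac c (chart_at x) x
  else 0.

Lemma bump_fieldE x : cdom c x -> bump_field x =
  (b (c x) *: (w *m tens20_coord c h (c x))) *m coord_jac c (chart_at x) x.
Proof. by move=> cx; rewrite /bump_field asboolT. Qed.

Lemma bump_field_tangent x : polar M x -> tangent (polar M) x (bump_field x).
Proof.
move=> px; have [cx|ncx] := pselect (cdom c x); last first.
  by rewrite /bump_field asboolF//; exact: tangent0.
rewrite bump_fieldE//; have [->|bx] := eqVneq (b (c x)) 0.
  by rewrite scale0r mul0mx; exact: tangent0.
have Ux : U (c x) by apply: qU; exact: ltW (bq bx).
apply: (grad_tangent ca PM fP cx Ux px).
rewrite dotZl dot_mulmx (pm_hsym PM Ux) (pm_grad PM Ux) (iffLR (fP cx Ux) px).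
by rewrite scale0r dot0r mulr0.
Qed.

Lemma bump_field_smooth : smooth_vec (cdom c) bump_field.
Proof.
move=> c' c'a i.
have oA' : open (c' @` (cdom c `&` cdom c')) by apply: open_chart_image; exact: cdom_open.
have oA : open (c @` (cdom c `&` cdom c')) by exact: open_chart_domI.
pose Psi u := (b u *: (w *m tens20_coord c h u)) *m coord_jac c c' (cinv c u).
apply: (Cn_eq oA' (f := fun y => Psi ((c \o cinv c') y))).
  move=> _ [z [cz c'z] <-].
  have -> : (c \o cinv c') (c' z) = c z by rewrite /comp (cmapK c'z).
  have za := chart_at_atlas z; have zz := chart_at_dom z.
  rewrite (vec_coordE _ c'z) (bump_fieldE cz) /Psi (cmapK cz).
  by rewrite -(coord_jac_comp ca za c'a cz zz c'z); exact: mulmxA.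
apply: (Cn_comp (f := Psi) (g := c \o cinv c') oA' oA).
- move=> _ [z [cz c'z] <-]; exists z => //.
  by rewrite /comp (cmapK c'z).
- by rewrite setIC; exact: Cn_transition.
- apply: (Cn_mulmx oA); last exact: Cn_coord_jac.
  apply: (Cn_scale oA); first by apply: (Cn_sub _ (bS i)).
  apply: (Cn_mulmx oA); first exact: Cn_cst.
  by apply: (Cn_sub _ (dual_chart_smooth ca i)) => _ [z [cz _] <-]; exists z.
Qed.

(** A smooth extension is required around every polar point, also outside the domain of [c]. There 0
    is one: the field vanishes off [K], the image of a closed ball, which is compact and hence
    closed because the manifold is Hausdorff. *)
Lemma bump_field_polar_vec (W : set M) : polar_vec W bump_field.
Proof.
move=> x Wx px; split; first exact: bump_field_tangent.
have [cx|ncx] := pselect (cdom c x).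
  exists (cdom c), bump_field; split=> //; [exact: cdom_open|exact: bump_field_smooth].
pose K := cinv c @` closed_ball_ Num.norm q r.
have Kc : closed K.
  apply: compact_closed; first exact: (@carrier_hausdorff _ _ M).
  apply: continuous_compact.
    apply: continuous_in_subspaceT => y; rewrite inE /closed_ball_ /= => yr.
    by apply: cinv_cont; apply: UO; apply: qU; rewrite distrC.
  apply: bounded_closed_compact; last exact: closed_closed_ball_.
  exists (`|q| + r); split; first exact: num_real.
  move=> s sr y; rewrite /closed_ball_ /= => yr; apply: le_trans (ltW sr).
  by rewrite -[y](subKr q) (le_trans (ler_normB _ _))// lerD2l.
exists (~` K), (fun _ => 0); split.
- exact: closed_openC.
- move=> [y yr yx]; apply: ncx; rewrite -yx; apply: cinv_dom; apply: UO; apply: qU.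
  by rewrite distrC.
- move=> c' c'a i; rewrite (_ : vec_coord c' _ = (fun _ => 0)); first exact: Cn_cst.
  by apply/funext => y; rewrite /vec_coord mul0mx.
- move=> y [nKy Wy] py; have [cy|ncy] := pselect (cdom c y); last by rewrite /bump_field asboolF.
  rewrite bump_fieldE//; have [->|bx] := eqVneq (b (c y)) 0; first by rewrite scale0r mul0mx.
  case: nKy; exists (c y); last exact: cmapK.
  by rewrite /closed_ball_ /= distrC; exact: ltW (bq bx).
Qed.

End PolarNormal.

Section Direction.
Context {R : realType} {m : nat} {M : riemannLorentz R m}.
Local Notation E := 'rV[R]_m.
Local Notation G := (metric M).
Local Notation h := (dual_metric M).

Theorem polar_normal_direction (p : M) (U : set E) (B : E -> 'M[R]_m) (f k : E -> R)
    (n : E -> E) (W0 : set M) (N : M -> E) : polar M p -> U (chart_at p p) ->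
  U `<=` chart_at p @` cdom (chart_at p) ->
  polar_model U (tens20_coord (chart_at p) h) B f k n ->
  (forall x, cdom (chart_at p) x -> U (chart_at p x) ->
     polar M x <-> f (chart_at p x) = 0) ->
  open W0 -> W0 p -> polar_normal W0 N ->
  exists2 a, a != 0 & N p = a *: n (chart_at p p).
Proof.
set c := chart_at p => pp Up UO PM fP oW0 W0p [NS NT Nbeta].
have ca : atlas c := chart_at_atlas p; have cp : cdom c p := chart_at_dom p.
pose Nc := vec_coord c N; pose y0 := c p.
have N0 : Nc y0 = N p := vec_coord_chart_at N p.
have f0 : f y0 = 0 by apply/fP.
have oU := pm_open PM.
pose a := dot (Nc y0) (grad f y0).
have a0 : a != 0.
  apply/eqP => a0; apply: (NT p W0p pp); rewrite -N0.
  have := grad_tangent ca PM fP cp Up pp a0.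
  by rewrite coord_jac_id// mulmx1.
(* Tested against every covector [w]: each gives a tangent field [w h], cut off by a bump function,
   on which [beta] vanishes. *)
exists a => //; rewrite -N0; apply/eqP; rewrite -subr_eq0; apply/eqP; apply: dot_eq0 => w.
have [e e0 eU] : exists2 e : R, 0 < e & forall y, `|y - y0| < e -> U y.
  have /nbhs_ballP[e /= e0 eU] := open_nbhs_nbhs (conj oU Up).
  by exists e => // y ye; apply: eU; rewrite -ball_normE /= distrC.
(* Half the radius, so that even the closed ball lies in [U]. *)
have e20 : 0 < e / 2 by rewrite divr_gt0.
have qU y : `|y - y0| <= e / 2 -> U y.
  by move=> ye; apply: eU; apply: le_lt_trans ye _; rewrite gtr_pMr// invf_lt1// ltr1n.
have [b [bS b0 bq]] := bump_exists y0 e20.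
pose V := bump_field c b w.
have Vpv : polar_vec W0 V by exact: (bump_field_polar_vec ca UO PM fP w bS bq qU).
have [W [X [hh [[oW Wp XS hhS hhp] [XV perp hhE]]]]] := Nbeta V Vpv p W0p pp.
pose Xc := vec_coord c X.
have Xp : X p = V p by exact: XV.
have X0 : Xc y0 = b y0 *: (w *m tens20_coord c h y0).
  rewrite [LHS](vec_coord_chart_at X p) Xp /V (bump_fieldE _ _ cp).
  by rewrite coord_jac_id// mulmx1.
pose A1 := c @` ((W `&` W0) `&` cdom c) `&` U.
have oA1 : open A1.
  by apply: openI => //; apply: open_chart_image; exact: openI.
have NC i : Cn i A1 Nc.
  by apply: (Cn_sub _ (NS c ca i)) => _ [[x [[Wx W0x] cx] <-] _]; exists x.
have XC i : Cn i A1 Xc.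
  by apply: (Cn_sub _ (XS c ca i)) => _ [[x [[Wx W0x] cx] <-] _]; exists x.
have hC i : Cn i A1 (hh \o cinv c).
  by apply: (Cn_sub _ (hhS c ca i)) => _ [[x [[Wx W0x] cx] <-] _]; exists x.
have A1U : A1 `<=` U by move=> y [].
have BC i : Cn i A1 B := Cn_sub A1U (pm_B PM i).
pose Q z := dot (Nc z *m B z) (Nc z).
have QC : Cn 1 A1 Q by exact: (Cn_dot oA1 (Cn_mulmx oA1 (NC 1%N) (BC 1%N)) (NC 1%N)).
(* Where [N B N] is non-zero the denominator [g(N, N)] can be cleared; at [p] its value is [a^2]. *)
pose A := A1 `&` Q @^-1` [set t | t != 0].
have oA : open A.
  apply: (open_setI_preimage oA1); first exact: open_neq.
  by move=> z Az; exact: (Cn_cont QC).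
have AA1 : A `<=` A1 by move=> y [].
have Ay : A y0.
  split; first by split => //; exists p.
  rewrite /= /Q (pm_B0 PM Up f0) row_dyad dotZl [dot _ (Nc y0)]dotC -/a.
  by rewrite mulf_neq0.
have perpc x : W x -> cdom c x -> U (c x) -> ~ polar M x ->
    dot (Nc (c x) *m B (c x)) (Xc (c x)) = 0.
  move=> Wx cx Ux nx; rewrite (polar_model_metric ca PM cx Ux nx) -scalemxAr dotZl.
  have := perp x Wx nx; rewrite (ev02_coord G _ _ ca cx) -(vec_coordE X cx) -(vec_coordE N cx).
  by rewrite ev02E (dot_sym _ _ (chart_metric_tr cx nx)) => ->; rewrite mulr0.
have np x : cdom c x -> U (c x) -> f (c x) != 0 -> ~ polar M x.
  by move=> cx Ux fx px; move: fx; rewrite (iffLR (fP x cx Ux) px) eqxx.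
have hhy : (hh \o cinv c) y0 = 0 by rewrite /= /y0 (cmapK cp).
have := @polar_normal_local R m U (tens20_coord c h) B f k n PM A Nc Xc (hh \o cinv c) y0 (b y0) w
  oA (fun z Az => A1U _ (AA1 _ Az)) Ay f0 (Cn_sub AA1 (NC 2%N)) (Cn_sub AA1 (XC 2%N))
  (Cn_sub AA1 (hC 1%N)) hhy X0.
move=> H; have {}H : b y0 * dot (Nc y0 - a *: n y0) w = 0.
  apply: H => //.
  - by move=> _ [[[x [[Wx W0x] cx] <-] Ux] _] fx; apply: perpc => //; exact: np.
  - move=> _ [[[x [[Wx W0x] cx] <-] Ux] /= Qx] fx; have nx := np x cx Ux fx.
    rewrite /= (cmapK cx) -/(Q (c x)) hhE//.
    pose A2 := A1 `&` c @` (~` polar M `&` cdom c).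
    have oA2 : open A2.
      apply: openI => //; apply: open_chart_image; apply: closed_openC; exact: polar_closed.
    have A1x : A1 (c x) by split=> //; exists x.
    have A2x : A2 (c x) by split=> //; exists x.
    have GC : Cn 1 A2 (tens02_coord c G) by apply: (Cn_sub _ (metric_chart_smooth ca 1%N)) => y [].
    have BC2 : Cn 1 A2 B by apply: (Cn_sub _ (BC 1%N)) => y [].
    have fC2 : Cn 1 A2 f by apply: (Cn_sub _ (pm_f PM 1%N)) => y [[_ Uy] _].
    have BE y : A2 y -> B y = f y *: tens02_coord c G y.
      by move=> [[_ Uy] [z [nz cz] zy]]; rewrite -zy in Uy *; exact: (polar_model_metric ca PM cz Uy nz).
    have Gu := (mulmx1_unit (chart_metric_dual ca cx nx)).1.
    have := box_polarE oA2 A2x GC BC2 fC2 BE Gu fx (perpc x Wx cx Ux nx).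
    rewrite -(box_chart N X ca oW0 W0x cx nx NS).
    have -> : ev02 (G x) (N x) (N x) = (f (c x))^-1 * Q (c x).
      rewrite /Q (polar_model_metric ca PM cx Ux nx) -scalemxAr dotZl mulKf//.
      by rewrite (ev02_coord G _ _ ca cx) -(vec_coordE N cx).
    rewrite -/(Q (c x)); move: (box G N N X x) (box_polar _ _ _ _) (dot _ _) => r1 r2 r3 rE.
    have -> : r1 / ((f (c x))^-1 * Q (c x)) * f (c x) * Q (c x) = f (c x) * (f (c x) * r1).
      by field; rewrite fx.
    by rewrite rE; field.
  - have := Vpv p W0p pp => -[tV _].
    have FC : Cn 1 U (fun z => dot (Nc y0 *m (B z - (grad f z)^T *m grad f z)) (Nc y0)).
      apply: (Cn_dot oU); last exact: Cn_cst.
      apply: (Cn_mulmx oU); first exact: Cn_cst.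
      apply: (Cn_subm oU); first exact: (pm_B PM).
      have gC : Cn 1 U (grad f) := Cn_grad oU (pm_f PM 2%N).
      exact: (Cn_mulmx oU (Cn_tr oU gC) gC).
    have F0 x : cdom c x -> U (c x) -> polar M x ->
        dot (Nc y0 *m (B (c x) - (grad f (c x))^T *m grad f (c x))) (Nc y0) = 0.
      by move=> cx Ux px; rewrite (pm_B0 PM Ux (iffLR (fP x cx Ux) px)) subrr mulmx0 dot0l.
    have := tangent_derive ca cp Up oU FC F0 tV.
    by rewrite -Xp -(vec_coordE X cp).
by move: H => /eqP; rewrite mulf_eq0 (negbTE b0) => /eqP.
Qed.

End Direction.

Theorem mainTheorem2 (R : realType) (m : nat) (hm : (2 <= m)%N)
    (M : riemannLorentz R m) (p : M) (hp : polar M p) :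
  (exists (e : R) (gamma : R -> M), crossing_pregeodesic p e gamma) /\
  (forall (e1 e2 : R) (gamma1 gamma2 : R -> M),
     crossing_pregeodesic p e1 gamma1 -> crossing_pregeodesic p e2 gamma2 ->
     exists (d : R) (J : set R),
       [/\ 0 < d <= e1, J `<=` `]-e2, e2[, J 0 &
           reparam `]-d, d[ gamma1 J gamma2]) /\
  (forall (e : R) (gamma : R -> M), crossing_pregeodesic p e gamma ->
     forall (U : set M) (N : M -> 'rV[R]_m),
       open U -> U p -> polar_normal U N ->
       exists a : R, velocity gamma 0 = a *: N p).
Proof.
have ca := chart_at_atlas p; have cp := chart_at_dom p.
split; first exact: crossing_pregeodesic_exists.
split; first by move=> e1 e2 g1 g2 c1 c2; exact: (crossing_pregeodesic_unique hp c1 c2).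
move=> e gamma cg U N oU Up NN.
have [V [B [f [k [n [Vp VO PM fP _]]]]]] := chart_polar_model ca cp hp.
have [a1 ->] := crossing_velocity hp Vp PM fP cg.
have [a2 a20 ->] := polar_normal_direction hp Vp VO PM fP oU Up NN.
by exists (a1 / a2); rewrite scalerA divfK.
Qed.
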